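(* Let $R$ be a noetherian integral domain over $\mathbb{F}_q$, and let $\phi$ be a (standard) Drinfeld $A$-module of rank $r\ge1$ over $R$ with associated $A$-motive $\mathcal{M}$. For $\mathfrak p=\infty$ the $A$-motive $\mathcal{M}$ gives rise to an $F_\infty$-isocrystal $\mathcal{M}_{F,\infty}$ over $R$ that is pure of slope $-1/r$.
   Context: $F$ is the function field of a smooth connected projective curve $C$ over the finite field $\mathbb{F}_q$, $\infty\in C$ a fixed closed point, $A\subset F$ the subring of functions regular outside $\infty$. $\deg_A(a):=\dim_{\mathbb{F}_q}(A/Aa)$ for $0\neq a\in A$. A (standard) Drinfeld $A$-module of rank $r$ over $R$ is an $\mathbb{F}_q$-algebra homomorphism $\phi:A\to R[\tau]$ ($\tau\xi=\xi^q\tau$), $a\mapsto\phi_a$, such that for each $0\neq a\in A$ the polynomial $\phi_a$ has degree $r\deg_A(a)$ in $\tau$ with highest coefficient a unit of $R$. The associated $A$-motive is $\mathcal{M}:=R[\tau]$ with $(a\otimes\xi)m:=\xi m\phi_a$ for $a\otimes\xi\in A\otimes_{\mathbb{F}_q}R$ and $\tau$ acting by left multiplication. $F_\infty$ is the completion of $F$ at $\infty$, with ring of integers $A_\infty$, uniformizer $z_\infty$, and residue field of degree $d_\infty$ over $\mathbb{F}_q$. Let $\mathcal{E}_{F_\infty,R}:=F_\infty\widehat\otimes_{\mathbb{F}_q}R$ and $\mathcal{E}_{A_\infty,R}:=A_\infty\widehat\otimes_{\mathbb{F}_q}R$ ($R$ discrete), $\sigma(a\widehat\otimes\xi)=a\widehat\otimes\xi^q$.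 An $F_\infty$-isocrystal over $R$ is a finitely generated projective $\mathcal{E}_{F_\infty,R}$-module $\mathcal{N}$ with an additive map $\tau$, $\tau(em)=\sigma(e)\tau(m)$, whose linearization $\sigma^*\mathcal{N}\to\mathcal{N}$ is an isomorphism. $\mathcal{M}_{F,\infty}$ is the base change of $\mathcal{M}$ along $A\otimes_{\mathbb{F}_q}R\to\mathcal{E}_{F_\infty,R}$. A lattice in $\mathcal{N}$ is a finitely generated projective $\mathcal{E}_{A_\infty,R}$-submodule $\mathcal{L}$ with $\mathcal{L}[z_\infty^{-1}]=\mathcal{N}$. $\mathcal{N}$ is pure of slope $\alpha\in\mathbb{Q}$ if there are an integer $n>0$ with $n\alpha\in\mathbb{Z}$ and a lattice $\mathcal{L}$ such that $\tau^{nd_\infty}\mathcal{L}$ generates $z_\infty^{n\alpha}\mathcal{L}$. *)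

(* Defs.v *)
From HB Require Import structures.
From mathcomp Require Import all_boot all_order all_algebra all_field.
From mathcomp Require Import boolp.
From mathcomp Require pgroup abelian.

Set Implicit Arguments.
Unset Strict Implicit.
Unset Printing Implicit Defensive.
Import Order.TTheory GRing.Theory Num.Theory.
Local Open Scope ring_scope.
Local Open Scope quotient_scope.

Definition restrict_scalars (S T : pzRingType) (f : {rmorphism S -> T})
  (N : lmodType T) : Type := N.

Section Restrict.
Variables (S T : pzRingType) (f : {rmorphism S -> T}) (N : lmodType T).
Local Notation restrict_scalars := (restrict_scalars f N).
HB.instance Definition _ := GRing.Zmodule.on restrict_scalars.

Definition restrict_scale (s : S) (x : restrict_scalars) : restrict_scalars :=
  f s *: (x : N).

Fact restrict_scaleA a b v :
  restrict_scale a (restrict_scale b v) = restrict_scale (a * b) v.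
Proof. by rewrite /restrict_scale scalerA rmorphM. Qed.
Fact restrict_scale1 : left_id 1 restrict_scale.
Proof. by move=> v; rewrite /restrict_scale rmorph1 scale1r. Qed.
Fact restrict_scaleDr : right_distributive restrict_scale +%R.
Proof. by move=> a u v; rewrite /restrict_scale scalerDr. Qed.
Fact restrict_scaleDl v : {morph restrict_scale^~ v : a b / a + b}.
Proof. by move=> a b; rewrite /restrict_scale rmorphD scalerDl. Qed.

HB.instance Definition _ := GRing.Zmodule_isLmodule.Build S restrict_scalars
  restrict_scaleA restrict_scale1 restrict_scaleDr restrict_scaleDl.
End Restrict.


Section Tensor.
Variables (S E : comPzRingType) (f : {rmorphism S -> E}) (M : lmodType S).

Definition balanced (W : zmodType) (b : E -> M -> W) : Prop :=
  [/\ forall x y m, b (x + y) m = b x m + b y m,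
      forall x m n, b x (m + n) = b x m + b x n
    & forall x s m, b (x * f s) m = b x (s *: m)].

Definition formal_eval (W : zmodType) (b : E -> M -> W) (u : seq (E * M)) : W :=
  \sum_(p <- u) b p.1 p.2.

(* The tensor product E (x)_S M along f, by its universal property: formal   *)
(* sums of pure tensors, two of them being identified when every balanced    *)
(* map takes the same value on both.                                         *)
Definition tensor_eq (u v : seq (E * M)) : bool :=
  `[< forall (W : zmodType) (b : E -> M -> W), balanced b ->
        formal_eval b u = formal_eval b v >].

Fact tensor_eq_refl : reflexive tensor_eq.
Proof. by move=> u; apply/asboolP. Qed.
Fact tensor_eq_sym : symmetric tensor_eq.
Proof.
by move=> u v; apply/asboolP/asboolP => h W b hb; rewrite (h W b).
Qed.
Fact tensor_eq_trans : transitive tensor_eq.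
Proof.
move=> v u w /asboolP h1 /asboolP h2; apply/asboolP => W b hb.
by rewrite h1 ?h2.
Qed.
Canonical tensor_equiv :=
  EquivRel tensor_eq tensor_eq_refl tensor_eq_sym tensor_eq_trans.

Definition tensor : Type := {eq_quot tensor_eq}.
HB.instance Definition _ := Choice.on tensor.
HB.instance Definition _ := EqQuotient.on tensor.

Definition tensor_lift (W : zmodType) (b : E -> M -> W) (x : tensor) : W :=
  formal_eval b (repr x).

Lemma tensor_liftE W b u : @balanced W b ->
  tensor_lift b (\pi_tensor u) = formal_eval b u.
Proof.
move=> hb; rewrite /tensor_lift.
have /eqmodP /asboolP h : \pi_tensor (repr (\pi_tensor u)) = \pi_tensor u.
  by rewrite reprK.
exact: h.
Qed.

Lemma tensor_ext (x y : tensor) :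
  (forall (W : zmodType) (b : E -> M -> W), balanced b ->
     tensor_lift b x = tensor_lift b y) -> x = y.
Proof.
move=> h; rewrite -[x]reprK -[y]reprK; apply/eqmodP/asboolP => W b hb.
exact: h.
Qed.

Definition pure_tensor (e : E) (m : M) : tensor := \pi_tensor [:: (e, m)].

Definition tensor_zero : tensor := \pi_tensor [::].
Definition tensor_add (x y : tensor) : tensor := \pi_tensor (repr x ++ repr y).
Definition tensor_opp (x : tensor) : tensor :=
  \pi_tensor [seq (- p.1, p.2) | p <- repr x].
Definition tensor_scale (e : E) (x : tensor) : tensor :=
  \pi_tensor [seq (e * p.1, p.2) | p <- repr x].

Section Balanced.
Variables (W : zmodType) (b : E -> M -> W) (hb : balanced b).

Lemma balanced0l m : b 0 m = 0.
Proof.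
by case: hb => h _ _; apply: (addrI (b 0 m)); rewrite -h !addr0.
Qed.
Lemma balanced0r e : b e 0 = 0.
Proof.
by case: hb => _ h _; apply: (addrI (b e 0)); rewrite -h !addr0.
Qed.
Lemma balancedNl e m : b (- e) m = - b e m.
Proof.
case: hb => h _ _; apply: (addrI (b e m)).
by rewrite -h !subrr balanced0l.
Qed.
Lemma balanced_scale e : balanced (fun a m => b (e * a) m).
Proof.
case: hb => h1 h2 h3; split => [x y m|x m n|x s m]; first by rewrite mulrDr h1.
- exact: h2.
- by rewrite mulrA h3.
Qed.

Lemma tensor_lift_pure e m : tensor_lift b (pure_tensor e m) = b e m.
Proof. by rewrite tensor_liftE // /formal_eval big_seq1. Qed.
Lemma tensor_lift_zero : tensor_lift b tensor_zero = 0.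
Proof. by rewrite tensor_liftE // /formal_eval big_nil. Qed.
Lemma tensor_lift_add x y :
  tensor_lift b (tensor_add x y) = tensor_lift b x + tensor_lift b y.
Proof. by rewrite tensor_liftE // /formal_eval big_cat. Qed.
Lemma tensor_lift_opp x : tensor_lift b (tensor_opp x) = - tensor_lift b x.
Proof.
rewrite tensor_liftE // /formal_eval big_map -sumrN.
by apply: eq_bigr => p _; rewrite balancedNl.
Qed.
Lemma tensor_lift_scale e x :
  tensor_lift b (tensor_scale e x) = tensor_lift (fun a m => b (e * a) m) x.
Proof. by rewrite tensor_liftE // /formal_eval big_map. Qed.
End Balanced.

Fact tensor_addA : associative tensor_add.
Proof.
by move=> x y z; apply: tensor_ext => W b hb; rewrite !tensor_lift_add // addrA.
Qed.
Fact tensor_addC : commutative tensor_add.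
Proof.
by move=> x y; apply: tensor_ext => W b hb; rewrite !tensor_lift_add // addrC.
Qed.
Fact tensor_add0 : left_id tensor_zero tensor_add.
Proof.
move=> x; apply: tensor_ext => W b hb.
by rewrite tensor_lift_add // tensor_lift_zero // add0r.
Qed.
Fact tensor_addN : left_inverse tensor_zero tensor_opp tensor_add.
Proof.
move=> x; apply: tensor_ext => W b hb.
by rewrite tensor_lift_add // tensor_lift_opp // tensor_lift_zero // addNr.
Qed.
HB.instance Definition _ := GRing.isZmodule.Build tensor
  tensor_addA tensor_addC tensor_add0 tensor_addN.

Lemma tensor_lift0 W b : @balanced W b -> tensor_lift b 0 = 0.
Proof. exact: tensor_lift_zero. Qed.
Lemma tensor_liftD W b : @balanced W b ->
  {morph tensor_lift b : x y / x + y}.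
Proof. by move=> hb x y; exact: tensor_lift_add. Qed.
Lemma tensor_liftN W b : @balanced W b -> {morph tensor_lift b : x / - x}.
Proof. by move=> hb x; exact: tensor_lift_opp. Qed.
Lemma tensor_liftB W b : @balanced W b ->
  {morph tensor_lift b : x y / x - y}.
Proof. by move=> hb x y; rewrite tensor_liftD // tensor_liftN. Qed.

Fact tensor_scaleA a b v :
  tensor_scale a (tensor_scale b v) = tensor_scale (a * b) v.
Proof.
apply: tensor_ext => W c hc; rewrite !tensor_lift_scale //.
  by congr (tensor_lift _ v); apply/funext => x; apply/funext => y; rewrite mulrA.
exact: balanced_scale.
Qed.
Fact tensor_scale1 : left_id 1 tensor_scale.
Proof.
move=> v; apply: tensor_ext => W c hc; rewrite !tensor_lift_scale //.
by congr (tensor_lift _ v); apply/funext => x; apply/funext => y; rewrite mul1r.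
Qed.
Fact tensor_scaleDr : right_distributive tensor_scale +%R.
Proof.
move=> a u v; apply: tensor_ext => W c hc.
rewrite tensor_liftD // !tensor_lift_scale // tensor_liftD //.
exact: balanced_scale.
Qed.
Fact tensor_scaleDl v : {morph tensor_scale^~ v : a b / a + b}.
Proof.
move=> a b; apply: tensor_ext => W c hc.
rewrite tensor_liftD // !tensor_lift_scale // /tensor_lift /formal_eval.
rewrite -big_split /=; apply: eq_bigr => p _.
by case: hc => h _ _; rewrite mulrDl h.
Qed.
HB.instance Definition _ := GRing.Zmodule_isLmodule.Build E tensor
  tensor_scaleA tensor_scale1 tensor_scaleDr tensor_scaleDl.

Lemma pure_balanced : balanced pure_tensor.
Proof.
split=> [x y m|x m n|x s m]; apply: tensor_ext => W b hb;
  rewrite ?tensor_liftD // !tensor_lift_pure //; by case: hb.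
Qed.

Lemma tensorP (x : tensor) :
  x = \sum_(p <- repr x) pure_tensor p.1 p.2.
Proof.
apply: tensor_ext => W b hb.
rewrite (big_morph _ (tensor_liftD hb) (tensor_lift0 hb)).
by apply: eq_bigr => p _; rewrite tensor_lift_pure.
Qed.

Lemma tensor_ind (P : tensor -> Prop) :
  (forall x y, P x -> P y -> P (x + y)) -> P 0 ->
  (forall e m, P (pure_tensor e m)) -> forall x, P x.
Proof.
move=> hD h0 hp x; rewrite (tensorP x).
by elim: (repr x) => [|p s IH]; rewrite ?big_nil // big_cons; apply: hD.
Qed.

Lemma scale_pure e a m : e *: pure_tensor a m = pure_tensor (e * a) m.
Proof.
apply: tensor_ext => W b hb; rewrite [LHS]tensor_lift_scale //.
by rewrite !tensor_lift_pure //; exact: balanced_scale.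
Qed.
End Tensor.

(* The S-algebra B (x)_S C; the S-algebra structures are given by f and g.   *)
Section TensorRing.
Variables (S B C : comPzRingType).
Variables (f : {rmorphism S -> B}) (g : {rmorphism S -> C}).

Definition tensor_ring : Type := tensor f (restrict_scalars g C^o).
HB.instance Definition _ := GRing.Zmodule.on tensor_ring.

Definition ptensor (b : B) (c : C) : tensor_ring :=
  pure_tensor f b (c : restrict_scalars g C^o).

Definition tr_lift (W : zmodType) (h : B -> C -> W) (x : tensor_ring) : W :=
  tensor_lift (f := f) (M := restrict_scalars g C^o) h x.

Definition tr_balanced (W : zmodType) (h : B -> C -> W) : Prop :=
  [/\ forall x y c, h (x + y) c = h x c + h y c,
      forall x c d, h x (c + d) = h x c + h x d
    & forall x s c, h (x * f s) c = h x (g s * c)].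

Lemma tr_balancedP W h :
  @tr_balanced W h -> @balanced _ _ f (restrict_scalars g C^o) W h.
Proof. by []. Qed.

Lemma tr_liftD W h : @tr_balanced W h -> {morph tr_lift h : x y / x + y}.
Proof. by move=> /tr_balancedP hb x y; exact: (tensor_liftD hb). Qed.
Lemma tr_liftB W h : @tr_balanced W h -> {morph tr_lift h : x y / x - y}.
Proof. by move=> /tr_balancedP hb x y; exact: (tensor_liftB hb). Qed.
Lemma tr_lift0 W h : @tr_balanced W h -> tr_lift h 0 = 0.
Proof. by move=> /tr_balancedP hb; exact: (tensor_lift0 hb). Qed.
Lemma tr_lift_pure W h b c : @tr_balanced W h -> tr_lift h (ptensor b c) = h b c.
Proof. by move=> /tr_balancedP hb; exact: (tensor_lift_pure hb). Qed.

Lemma ptensor_balanced : tr_balanced ptensor.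
Proof. exact: (@pure_balanced S B f (restrict_scalars g C^o)). Qed.

Definition tr_one : tensor_ring := ptensor 1 1.
Definition tr_mul (x y : tensor_ring) : tensor_ring :=
  tr_lift (fun b c => tr_lift (fun b' c' => ptensor (b * b') (c * c')) y) x.

Lemma tr_mul_bal1 b c :
  tr_balanced (fun b' c' => ptensor (b * b') (c * c')).
Proof.
case: ptensor_balanced => h1 h2 h3; split => [x y d|x d e|x s d].
- by rewrite mulrDr h1.
- by rewrite mulrDr h2.
- by rewrite mulrA h3 mulrCA.
Qed.

Lemma tr_mul_bal2 y :
  tr_balanced
    (fun b c => tr_lift (fun b' c' => ptensor (b * b') (c * c')) y).
Proof.
case: ptensor_balanced => h1 h2 h3; split => [x x' d|x d e|x s d];
  rewrite /tr_lift /tensor_lift /formal_eval -?big_split /=;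
  apply: eq_bigr => p _.
- by rewrite mulrDl h1.
- by rewrite mulrDl h2.
- by rewrite mulrAC h3 -mulrA.
Qed.

Lemma tr_mulDl : left_distributive tr_mul +%R.
Proof. by move=> x y z; exact: (tr_liftD (tr_mul_bal2 z)). Qed.
Lemma tr_mul0l y : tr_mul 0 y = 0.
Proof. exact: (tr_lift0 (tr_mul_bal2 y)). Qed.
Lemma tr_mulDr : right_distributive tr_mul +%R.
Proof.
move=> x y z; rewrite /tr_mul {1 3 5}/tr_lift /tensor_lift /formal_eval.
rewrite -big_split /=; apply: eq_bigr => p _.
exact: (tr_liftD (tr_mul_bal1 _ _)).
Qed.
Lemma tr_mul0r x : tr_mul x 0 = 0.
Proof.
rewrite /tr_mul {1}/tr_lift /tensor_lift /formal_eval.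
by rewrite big1 // => p _; exact: (tr_lift0 (tr_mul_bal1 _ _)).
Qed.
Lemma tr_mul_pure b c b' c' :
  tr_mul (ptensor b c) (ptensor b' c') = ptensor (b * b') (c * c').
Proof.
rewrite /tr_mul tr_lift_pure; last exact: tr_mul_bal2.
by rewrite tr_lift_pure //; exact: tr_mul_bal1.
Qed.

Lemma tr_ind (P : tensor_ring -> Prop) :
  (forall x y, P x -> P y -> P (x + y)) -> P 0 ->
  (forall b c, P (ptensor b c)) -> forall x, P x.
Proof. exact: tensor_ind. Qed.

Fact tr_mulA : associative tr_mul.
Proof.
move=> x y z; elim/tr_ind: x => [x x' h h'||b c].
- by rewrite !tr_mulDl h h'.
- by rewrite !tr_mul0l.
elim/tr_ind: y => [y y' h h'||b' c'].
- by rewrite tr_mulDl !tr_mulDr tr_mulDl h h'.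
- by rewrite tr_mul0l !tr_mul0r tr_mul0l.
elim/tr_ind: z => [z z' h h'||b'' c''].
- by rewrite !tr_mulDr h h'.
- by rewrite !tr_mul0r.
by rewrite !tr_mul_pure !mulrA.
Qed.
Fact tr_mulC : commutative tr_mul.
Proof.
move=> x y; elim/tr_ind: x => [x x' h h'||b c].
- by rewrite tr_mulDl tr_mulDr h h'.
- by rewrite tr_mul0l tr_mul0r.
elim/tr_ind: y => [y y' h h'||b' c'].
- by rewrite tr_mulDl tr_mulDr h h'.
- by rewrite tr_mul0l tr_mul0r.
by rewrite !tr_mul_pure mulrC [c * _]mulrC.
Qed.
Fact tr_mul1 : left_id tr_one tr_mul.
Proof.
move=> x; elim/tr_ind: x => [x x' h h'||b c].
- by rewrite tr_mulDr h h'.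
- by rewrite tr_mul0r.
by rewrite tr_mul_pure !mul1r.
Qed.
HB.instance Definition _ := GRing.Zmodule_isComPzRing.Build tensor_ring
  tr_mulA tr_mulC tr_mul1 tr_mulDl.

Lemma ptensorM b c b' c' :
  ptensor b c * ptensor b' c' = ptensor (b * b') (c * c').
Proof. exact: tr_mul_pure. Qed.
Lemma ptensor11 : ptensor 1 1 = 1. Proof. by []. Qed.
End TensorRing.

(* h1 (x) h2 for S-algebra morphisms h1 and h2. *)
Section TensorMap.
Variables (S B C B' C' : comPzRingType).
Variables (f : {rmorphism S -> B}) (g : {rmorphism S -> C}).
Variables (f' : {rmorphism S -> B'}) (g' : {rmorphism S -> C'}).
Variables (h1 : {rmorphism B -> B'}) (h2 : {rmorphism C -> C'}).
Hypotheses (hf : forall s, h1 (f s) = f' s) (hg : forall s, h2 (g s) = g' s).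

Definition tensor_map_fun (x : tensor_ring f g) : tensor_ring f' g' :=
  tr_lift (fun b c => ptensor f' g' (h1 b) (h2 c)) x.

Lemma tensor_map_bal :
  tr_balanced f g (fun b c => ptensor f' g' (h1 b) (h2 c)).
Proof.
case: (ptensor_balanced f' g') => e1 e2 e3.
split=> [x y c|x c d|x s c]; first by rewrite rmorphD e1.
- by rewrite rmorphD e2.
- by rewrite !rmorphM hf hg e3.
Qed.

Fact tensor_map_additive : zmod_morphism tensor_map_fun.
Proof. by move=> x y; exact: (tr_liftB tensor_map_bal). Qed.

Lemma tensor_map_pure b c :
  tensor_map_fun (ptensor f g b c) = ptensor f' g' (h1 b) (h2 c).
Proof. exact: (tr_lift_pure _ _ tensor_map_bal). Qed.

Fact tensor_map_monoid : monoid_morphism tensor_map_fun.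
Proof.
have hD : {morph tensor_map_fun : x y / x + y}.
  exact: (tr_liftD tensor_map_bal).
have h0 : tensor_map_fun 0 = 0 by exact: (tr_lift0 tensor_map_bal).
split; first by rewrite -ptensor11 tensor_map_pure !rmorph1.
move=> x y; elim/tr_ind: x => [x x' h h'||b c].
- by rewrite mulrDl !hD mulrDl h h'.
- by rewrite mul0r h0 mul0r.
elim/tr_ind: y => [y y' h h'||b' c'].
- by rewrite mulrDr !hD mulrDr h h'.
- by rewrite mulr0 h0 mulr0.
by rewrite ptensorM !tensor_map_pure ptensorM !rmorphM.
Qed.

Definition tensor_map (_ : forall s, h1 (f s) = f' s)
    (_ : forall s, h2 (g s) = g' s) : tensor_ring f g -> tensor_ring f' g' :=
  tensor_map_fun.
End TensorMap.

Section TensorMapMorphism.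
Variables (S B C B' C' : comPzRingType).
Variables (f : {rmorphism S -> B}) (g : {rmorphism S -> C}).
Variables (f' : {rmorphism S -> B'}) (g' : {rmorphism S -> C'}).
Variables (h1 : {rmorphism B -> B'}) (h2 : {rmorphism C -> C'}).
Variables (hf : forall s, h1 (f s) = f' s) (hg : forall s, h2 (g s) = g' s).
HB.instance Definition _ := GRing.isZmodMorphism.Build _ _
  (tensor_map hf hg) (tensor_map_additive hf hg).
HB.instance Definition _ := GRing.isMonoidMorphism.Build _ _
  (tensor_map hf hg) (tensor_map_monoid hf hg).
End TensorMapMorphism.

(* A basis of neighbourhoods of 0 indexed by int, increasing to the whole    *)
(* ring at -oo (e.g. the powers of the maximal ideal of a valued field).     *)
Record filtration (B : comPzRingType) := Filtration {
  fil :> int -> B -> Prop;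
  fil0 : forall n, fil n 0;
  filB : forall n x y, fil n x -> fil n y -> fil n (x - y);
  filS : forall m n x, (m <= n)%R -> fil n x -> fil m x;
  fil1 : fil 0 1;
  filM : forall m n x y, fil m x -> fil n y -> fil (m + n) (x * y);
  fil_exhaustive : forall x, exists n, fil n x }.

Section FilTheory.
Variables (B : comPzRingType) (Fl : filtration B).
Lemma filN n x : Fl n x -> Fl n (- x).
Proof. by move=> hx; rewrite -sub0r; apply: filB => //; exact: fil0. Qed.
Lemma filD n x y : Fl n x -> Fl n y -> Fl n (x + y).
Proof. by move=> hx hy; rewrite -[y]opprK; apply: filB => //; exact: filN. Qed.
Lemma fil_subl n x y : Fl n x -> Fl n (y - x) -> Fl n y.
Proof. by move=> hx h; rewrite -[y](subrK x); apply: filD. Qed.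

Definition eventually_fil (n : int) (u : nat -> B) : Prop :=
  exists N, forall i, (N <= i)%N -> Fl n (u i).
Definition cauchy (u : nat -> B) : Prop :=
  forall n : int, exists N, forall i j, (N <= i)%N -> (N <= j)%N ->
    Fl n (u i - u j).
Definition null (u : nat -> B) : Prop := forall n : int, eventually_fil n u.

Lemma eventually2 (P Q : nat -> Prop) :
  (exists N, forall i, (N <= i)%N -> P i) ->
  (exists N, forall i, (N <= i)%N -> Q i) ->
  exists N, forall i, (N <= i)%N -> P i /\ Q i.
Proof.
move=> [N hN] [N' hN']; exists (maxn N N') => i; rewrite geq_max => /andP[h h'].
by split; [exact: hN|exact: hN'].
Qed.

Lemma cauchy_cst x : cauchy (fun=> x).
Proof. by move=> n; exists 0%N => i j _ _; rewrite subrr; exact: fil0. Qed.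
Lemma cauchyD u v : cauchy u -> cauchy v -> cauchy (fun i => u i + v i).
Proof.
move=> hu hv n; have [N hN] := hu n; have [N' hN'] := hv n.
exists (maxn N N') => i j; rewrite !geq_max => /andP[h1 h2] /andP[h3 h4].
by rewrite opprD addrACA; apply: filD; [exact: hN|exact: hN'].
Qed.
Lemma cauchyN u : cauchy u -> cauchy (fun i => - u i).
Proof.
move=> hu n; have [N hN] := hu n; exists N => i j h h'.
by rewrite -opprD; apply: filN; exact: hN.
Qed.
Lemma cauchy_bounded u : cauchy u -> exists n, eventually_fil n u.
Proof.
move=> /(_ 0) [N hN]; have [m hm] := fil_exhaustive Fl (u N).
exists (Order.min m 0); exists N => i hi.
apply: (@fil_subl _ (u N)); first by apply: filS hm; rewrite ge_min lexx.
by apply: filS (hN _ _ hi (leqnn N)); rewrite ge_min lexx orbT.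
Qed.
Lemma cauchyM u v : cauchy u -> cauchy v -> cauchy (fun i => u i * v i).
Proof.
move=> hu hv n; have [a [Na ha]] := cauchy_bounded hu.
have [b [Nb hb]] := cauchy_bounded hv.
have [N hN] := hu (n - b); have [N' hN'] := hv (n - a).
exists (maxn (maxn N N') (maxn Na Nb)) => i j.
rewrite !geq_max => /andP[/andP[h1 h2] /andP[h3 h4]].
move=> /andP[/andP[k1 k2] /andP[k3 k4]].
have -> : u i * v i - u j * v j = u i * (v i - v j) + (u i - u j) * v j.
  by rewrite mulrBr mulrBl addrA subrK.
apply: filD.
- by rewrite -[n](subrK a) addrC; apply: filM; [exact: ha|exact: hN'].
- by rewrite -[n](subrK b); apply: filM; [exact: hN|exact: hb].
Qed.
Lemma null_cauchy u : null u -> cauchy u.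
Proof.
move=> h n; have [N hN] := h n; exists N => i j hi hj.
by apply: filB; exact: hN.
Qed.
Lemma null0 : null (fun=> 0).
Proof. by move=> n; exists 0%N => i _; exact: fil0. Qed.
Lemma nullD u v : null u -> null v -> null (fun i => u i + v i).
Proof.
move=> hu hv n; have [N hN] := eventually2 (hu n) (hv n).
by exists N => i /hN [h h']; exact: filD.
Qed.
Lemma nullN u : null u -> null (fun i => - u i).
Proof. by move=> hu n; have [N hN] := hu n; exists N => i /hN; exact: filN. Qed.
Lemma nullM u v : cauchy u -> null v -> null (fun i => u i * v i).
Proof.
move=> /cauchy_bounded [a ha] hv n.
have [N hN] := eventually2 ha (hv (n - a)).
exists N => i /hN [h h'].
by rewrite -[n](subrK a) addrC; exact: filM.
Qed.

Definition is_cauchy (u : nat -> B) : bool := `[< cauchy u >].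
Definition cauchy_seq : Type := {u : nat -> B | is_cauchy u}.
HB.instance Definition _ := Choice.on cauchy_seq.
Definition cseq (u : cauchy_seq) : nat -> B := sval u.
Definition mk_cauchy (u : nat -> B) (hu : cauchy u) : cauchy_seq :=
  exist _ u (asboolT hu).
Lemma cseqP (u : cauchy_seq) : cauchy (cseq u).
Proof. by case: u => u /= /asboolP. Qed.

Definition cauchy_eq (u v : cauchy_seq) : bool :=
  `[< null (fun i => cseq u i - cseq v i) >].
Fact cauchy_eq_refl : reflexive cauchy_eq.
Proof.
move=> u; apply/asboolP => n; exists 0%N => i _; rewrite subrr; exact: fil0.
Qed.
Fact cauchy_eq_sym : symmetric cauchy_eq.
Proof.
move=> u v; apply/asboolP/asboolP => /nullN h n; have [N hN] := h n;
  by exists N => i /hN; rewrite opprB.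
Qed.
Fact cauchy_eq_trans : transitive cauchy_eq.
Proof.
move=> v u w /asboolP h /asboolP h'; apply/asboolP => n.
have [N hN] := nullD h h' n; exists N => i /hN; by rewrite addrA subrK.
Qed.
Canonical cauchy_equiv :=
  EquivRel cauchy_eq cauchy_eq_refl cauchy_eq_sym cauchy_eq_trans.
End FilTheory.

(* Cauchy sequences modulo null sequences. *)
Definition completion (B : comPzRingType) (Fl : filtration B) : Type :=
  {eq_quot (@cauchy_eq B Fl)}.

Section Completion.
Variables (B : comPzRingType) (Fl : filtration B).
Local Notation BB := (completion Fl).
HB.instance Definition _ := Choice.on BB.
HB.instance Definition _ := EqQuotient.on BB.

Definition limit (u : nat -> B) (hu : cauchy Fl u) : BB :=
  \pi_BB (mk_cauchy hu).
Definition approx (x : BB) : nat -> B := cseq (repr x).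

Lemma approxP (x : BB) : cauchy Fl (approx x). Proof. exact: cseqP. Qed.

Lemma limit_eq u v (hu : cauchy Fl u) (hv : cauchy Fl v) :
  limit hu = limit hv <-> null Fl (fun i => u i - v i).
Proof.
by rewrite /limit; split=> [/eqmodP/asboolP|h]; last apply/eqmodP/asboolP.
Qed.
Lemma limit_approx (x : BB) (h : cauchy Fl (approx x)) : limit h = x.
Proof.
rewrite -[RHS]reprK; apply/eqmodP/asboolP => n; exists 0%N => i _.
by rewrite /= subrr; exact: fil0.
Qed.
Lemma approx_limit u (hu : cauchy Fl u) :
  null Fl (fun i => approx (limit hu) i - u i).
Proof. by apply/(limit_eq (approxP _) hu); rewrite limit_approx. Qed.

Lemma completion_ext (x y : BB) :
  null Fl (fun i => approx x i - approx y i) -> x = y.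
Proof.
by move=> h; rewrite -(limit_approx (approxP x)) -(limit_approx (approxP y));
  apply/limit_eq.
Qed.
Lemma completion_ind (P : BB -> Prop) :
  (forall u (hu : cauchy Fl u), P (limit hu)) -> forall x, P x.
Proof. by move=> h x; rewrite -(limit_approx (approxP x)). Qed.

Definition to_completion (x : B) : BB := limit (cauchy_cst Fl x).
Definition c_add (x y : BB) : BB := limit (cauchyD (approxP x) (approxP y)).
Definition c_opp (x : BB) : BB := limit (cauchyN (approxP x)).
Definition c_mul (x y : BB) : BB := limit (cauchyM (approxP x) (approxP y)).

Lemma c_addE u v (hu : cauchy Fl u) (hv : cauchy Fl v) :
  c_add (limit hu) (limit hv) = limit (cauchyD hu hv).
Proof.
apply/limit_eq => n.
have [N hN] := nullD (approx_limit hu) (approx_limit hv) n.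
by exists N => i /hN; rewrite opprD addrACA.
Qed.
Lemma c_oppE u (hu : cauchy Fl u) : c_opp (limit hu) = limit (cauchyN hu).
Proof.
apply/limit_eq => n; have [N hN] := nullN (approx_limit hu) n.
by exists N => i /hN; rewrite opprD.
Qed.
Lemma c_mulE u v (hu : cauchy Fl u) (hv : cauchy Fl v) :
  c_mul (limit hu) (limit hv) = limit (cauchyM hu hv).
Proof.
apply/limit_eq => n.
have [N hN] := nullD (nullM (approxP (limit hu)) (approx_limit hv))
                     (nullM hv (approx_limit hu)) n.
exists N => i /hN; congr (Fl n _).
by rewrite !mulrBr addrA -addrA [v i * _ in X in _ + X]mulrC
  [v i * u i]mulrC addrA subrK.
Qed.

Lemma limit_ext u v (hu : cauchy Fl u) (hv : cauchy Fl v) :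
  (forall i, u i = v i) -> limit hu = limit hv.
Proof.
move=> h; apply/limit_eq => n; exists 0%N => i _.
by rewrite h subrr; exact: fil0.
Qed.

Fact c_addA : associative c_add.
Proof.
elim/completion_ind => u hu; elim/completion_ind => v hv.
elim/completion_ind => w hw; rewrite !c_addE.
by apply: limit_ext => i; rewrite addrA.
Qed.
Fact c_addC : commutative c_add.
Proof.
elim/completion_ind => u hu; elim/completion_ind => v hv.
by rewrite !c_addE; apply: limit_ext => i; rewrite addrC.
Qed.
Fact c_add0 : left_id (to_completion 0) c_add.
Proof.
by elim/completion_ind => u hu; rewrite c_addE; apply: limit_ext => i;
  rewrite add0r.
Qed.
Fact c_addN : left_inverse (to_completion 0) c_opp c_add.
Proof.
by elim/completion_ind => u hu; rewrite c_oppE c_addE; apply: limit_ext => i;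
  rewrite addNr.
Qed.
HB.instance Definition _ :=
  GRing.isZmodule.Build BB c_addA c_addC c_add0 c_addN.

Fact c_mulA : associative c_mul.
Proof.
elim/completion_ind => u hu; elim/completion_ind => v hv.
elim/completion_ind => w hw; rewrite !c_mulE.
by apply: limit_ext => i; rewrite mulrA.
Qed.
Fact c_mulC : commutative c_mul.
Proof.
elim/completion_ind => u hu; elim/completion_ind => v hv.
by rewrite !c_mulE; apply: limit_ext => i; rewrite mulrC.
Qed.
Fact c_mul1 : left_id (to_completion 1) c_mul.
Proof.
by elim/completion_ind => u hu; rewrite c_mulE; apply: limit_ext => i;
  rewrite mul1r.
Qed.
Fact c_mulDl : left_distributive c_mul +%R.
Proof.
elim/completion_ind => u hu; elim/completion_ind => v hv.
elim/completion_ind => w hw.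
rewrite -[X in c_mul X _]/(c_add _ _) -[RHS]/(c_add _ _) !(c_addE, c_mulE).
by apply: limit_ext => i; rewrite mulrDl.
Qed.
HB.instance Definition _ := GRing.Zmodule_isComPzRing.Build BB
  c_mulA c_mulC c_mul1 c_mulDl.

Lemma limitD u v (hu : cauchy Fl u) (hv : cauchy Fl v) :
  limit hu + limit hv = limit (cauchyD hu hv).
Proof. exact: c_addE. Qed.
Lemma limitN u (hu : cauchy Fl u) : - limit hu = limit (cauchyN hu).
Proof. exact: c_oppE. Qed.
Lemma limitM u v (hu : cauchy Fl u) (hv : cauchy Fl v) :
  limit hu * limit hv = limit (cauchyM hu hv).
Proof. exact: c_mulE. Qed.

Fact to_completion_additive : zmod_morphism to_completion.
Proof.
by move=> x y; rewrite limitN limitD; exact: limit_ext.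
Qed.
Fact to_completion_monoid : monoid_morphism to_completion.
Proof. by split=> // x y; rewrite limitM; exact: limit_ext. Qed.
HB.instance Definition _ :=
  GRing.isZmodMorphism.Build B BB to_completion to_completion_additive.
HB.instance Definition _ :=
  GRing.isMonoidMorphism.Build B BB to_completion to_completion_monoid.

(* The closure of the n-th step of the filtration. *)
Definition cfil (n : int) (x : BB) : Prop := eventually_fil Fl n (approx x).

Lemma cfil_limit n u (hu : cauchy Fl u) :
  cfil n (limit hu) <-> eventually_fil Fl n u.
Proof.
split=> h; have [N hN] := eventually2 h (approx_limit hu n); exists N => i /hN.
- by move=> [h1 h2]; apply: fil_subl h1 _; rewrite -opprB; exact: filN.
- by move=> [h1 h2]; exact: fil_subl h2.
Qed.

Fact cfil0 n : cfil n 0.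
Proof. by apply/cfil_limit; exists 0%N => i _; exact: fil0. Qed.
Fact cfilB n x y : cfil n x -> cfil n y -> cfil n (x - y).
Proof.
elim/completion_ind: x => u hu; elim/completion_ind: y => v hv.
rewrite limitN limitD !cfil_limit => h h'.
by have [N hN] := eventually2 h h'; exists N => i /hN [? ?]; exact: filB.
Qed.
Fact cfilS m n x : (m <= n)%R -> cfil n x -> cfil m x.
Proof. by move=> le [N hN]; exists N => i /hN; exact: filS. Qed.
Fact cfil1 : cfil 0 1.
Proof. by apply/cfil_limit; exists 0%N => i _; exact: fil1. Qed.
Fact cfilM m n x y : cfil m x -> cfil n y -> cfil (m + n) (x * y).
Proof.
elim/completion_ind: x => u hu; elim/completion_ind: y => v hv.
rewrite limitM !cfil_limit => h h'.
by have [N hN] := eventually2 h h'; exists N => i /hN [? ?]; exact: filM.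
Qed.
Fact cfil_exhaustive x : exists n, cfil n x.
Proof. exact: cauchy_bounded (approxP x). Qed.

Definition completed_filtration : filtration BB :=
  Filtration cfil0 cfilB cfilS cfil1 cfilM cfil_exhaustive.

(* The closed subring of integral elements. *)
Definition integral_pred : {pred BB} := fun x => `[< cfil 0 x >].
Fact integral_pred_closed : subring_closed integral_pred.
Proof.
split=> [|x y|x y]; first by apply/asboolP; exact: cfil1.
- by move=> /asboolP h /asboolP h'; apply/asboolP; exact: cfilB.
- by move=> /asboolP h /asboolP h'; apply/asboolP; apply: (@cfilM 0 0).
Qed.
HB.instance Definition _ :=
  GRing.isSubringClosed.Build BB integral_pred integral_pred_closed.

Definition integral_elements : Type := {x : BB | integral_pred x}.
HB.instance Definition _ := SubChoice.on integral_elements.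
HB.instance Definition _ := GRing.SubChoice_isSubComPzRing.Build BB
  integral_pred integral_elements (subringClosedP _).
End Completion.

Section CompletionMap.
Variables (B B' : comPzRingType) (Fl : filtration B) (Fl' : filtration B').
Variable g : {rmorphism B -> B'}.

Definition filtered : Prop := forall n x, Fl n x -> Fl' n (g x).

Lemma cauchy_map (hg : filtered) u :
  cauchy Fl u -> cauchy Fl' (fun i => g (u i)).
Proof.
move=> hu n; have [N hN] := hu n; exists N => i j hi hj.
by rewrite -rmorphB; apply: hg; exact: hN.
Qed.

Definition completion_map (hg : filtered) (x : completion Fl) :
  completion Fl' := limit (cauchy_map hg (approxP x)).

Variable hg : filtered.
Lemma completion_mapE u (hu : cauchy Fl u) :
  completion_map hg (limit hu) = limit (cauchy_map hg hu).
Proof.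
apply/limit_eq => n; have [N hN] := approx_limit hu n.
by exists N => i /hN h; rewrite -rmorphB; exact: hg.
Qed.
Fact completion_map_additive : zmod_morphism (completion_map hg).
Proof.
elim/completion_ind => u hu; elim/completion_ind => v hv.
rewrite limitN limitD !completion_mapE limitN limitD; apply: limit_ext => i.
by rewrite /= rmorphB.
Qed.
Fact completion_map_monoid : monoid_morphism (completion_map hg).
Proof.
split; first by rewrite [LHS]completion_mapE; apply: limit_ext => i;
  rewrite rmorph1.
elim/completion_ind => u hu; elim/completion_ind => v hv.
rewrite limitM !completion_mapE limitM; apply: limit_ext => i.
by rewrite /= rmorphM.
Qed.
HB.instance Definition _ := GRing.isZmodMorphism.Build _ _
  (completion_map hg) completion_map_additive.
HB.instance Definition _ := GRing.isMonoidMorphism.Build _ _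
  (completion_map hg) completion_map_monoid.
End CompletionMap.

Definition frob (k : finFieldType) (R : comNzRingType)
  (iR : {rmorphism k -> R}) (x : R) : R := x ^+ #|k|.

Section Frobenius.
Variables (k : finFieldType) (R : comNzRingType) (iR : {rmorphism k -> R}).

Fact frobD : {morph frob iR : x y / x + y}.
Proof.
move=> x y; rewrite /frob; apply: exprDn_pchar.
have [p p_pr pk] := finPcharP k.
have /abelian.abelem_pgroup := abelian.fin_ring_pchar_abelem pk.
rewrite /pgroup.pgroup cardsT; apply: sub_in_pnat => p' _ /eqP ->.
exact: (rmorph_pchar iR).
Qed.
Fact frob_additive : zmod_morphism (frob iR).
Proof.
by move=> x y; apply: (addIr (frob iR y)); rewrite -frobD !subrK.
Qed.
Fact frob_monoid : monoid_morphism (frob iR).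
Proof. by split=> [|x y]; rewrite /frob ?expr1n ?exprMn. Qed.
HB.instance Definition _ :=
  GRing.isZmodMorphism.Build R R (frob iR) frob_additive.
HB.instance Definition _ :=
  GRing.isMonoidMorphism.Build R R (frob iR) frob_monoid.

Lemma frob_const c : frob iR (iR c) = iR c.
Proof. by rewrite /frob -rmorphXn expf_card. Qed.
End Frobenius.

Definition twisted_poly (k : finFieldType) (R : comNzRingType)
  (iR : {rmorphism k -> R}) : Type := {poly R}.

Section TwistedPoly.
Variables (k : finFieldType) (R : comNzRingType) (iR : {rmorphism k -> R}).
Local Notation TP := (twisted_poly iR).
HB.instance Definition _ := GRing.Zmodule.on TP.

(* The coefficients of tau^i * s, moved to the left of tau^i. *)
Definition twist (i : nat) (s : {poly R}) : {poly R} :=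
  iter i (map_poly (frob iR)) s.

(* 'X stands for tau: sum_i p_i tau^i s with tau^i xi = xi^(q^i) tau^i. *)
Definition tp_mul (p s : TP) : TP :=
  \sum_(i < size (p : {poly R})) (p : {poly R})`_i *: (twist i s * 'X^i).

Lemma twistD i : {morph twist i : x y / x + y}.
Proof. by move=> x y; elim: i => //= i ->; rewrite rmorphD. Qed.
Lemma twist0 i : twist i 0 = 0.
Proof. by elim: i => //= i ->; rewrite rmorph0. Qed.
Lemma twistM i : {morph twist i : x y / x * y}.
Proof. by move=> x y; elim: i => //= i ->; rewrite rmorphM. Qed.
Lemma twistXn i j : twist i 'X^j = 'X^j.
Proof. by elim: i => //= i ->; rewrite map_polyXn. Qed.
Lemma twistC i a : twist i a%:P = (iter i (frob iR) a)%:P.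
Proof. by elim: i => //= i ->; rewrite map_polyC. Qed.
Lemma twistZ i a s : twist i (a *: s) = iter i (frob iR) a *: twist i s.
Proof. by rewrite -!mul_polyC twistM twistC. Qed.
Lemma twist_add i j s : twist i (twist j s) = twist (i + j) s.
Proof. by rewrite /twist iterD. Qed.

Lemma tp_mulE n (p s : TP) : (size (p : {poly R}) <= n)%N ->
  tp_mul p s = \sum_(i < n) (p : {poly R})`_i *: (twist i s * 'X^i).
Proof.
move=> le; rewrite /tp_mul.
rewrite (big_ord_widen n (fun i => (p : {poly R})`_i *: (twist i s * 'X^i))) //.
rewrite big_mkcond /=; apply: eq_bigr => i _; case: ltnP => // h.
by rewrite nth_default // scale0r.
Qed.

Fact tp_mulDl : left_distributive tp_mul +%R.
Proof.
move=> p p' s; pose n := maxn (size (p : {poly R})) (size (p' : {poly R})).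
rewrite !(@tp_mulE n) ?leq_maxl ?leq_maxr ?(leq_trans (size_polyD _ _)) //.
by rewrite -big_split; apply: eq_bigr => i _; rewrite /= coefD scalerDl.
Qed.
Fact tp_mulDr : right_distributive tp_mul +%R.
Proof.
move=> p s s'; rewrite /tp_mul -big_split; apply: eq_bigr => i _.
by rewrite /= twistD mulrDl scalerDr.
Qed.
Lemma tp_mul0l s : tp_mul 0 s = 0.
Proof. by rewrite /tp_mul size_poly0 big_ord0. Qed.
Lemma tp_mul0r p : tp_mul p 0 = 0.
Proof. by rewrite /tp_mul big1 // => i _; rewrite twist0 mul0r scaler0. Qed.

Lemma tp_mul_mono a i s :
  tp_mul (a *: 'X^i : {poly R}) s = a *: (twist i s * 'X^i).
Proof.
rewrite (@tp_mulE i.+1); last first.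
  by apply: leq_trans (size_scale_leq _ _) _; rewrite size_polyXn.
rewrite big_ord_recr big1 /= => [|j _].
  by rewrite add0r coefZ coefXn eqxx mulr1.
by rewrite coefZ coefXn ltn_eqF // mulr0 scale0r.
Qed.

Lemma poly_mono_ind (P : {poly R} -> Prop) :
  (forall x y, P x -> P y -> P (x + y)) -> P 0 ->
  (forall a i, P (a *: 'X^i)) -> forall p, P p.
Proof.
move=> hD h0 hm p; rewrite -[p]coefK poly_def.
by apply: big_ind => // i _; exact: hm.
Qed.

Fact tp_mulA : associative tp_mul.
Proof.
move=> p s t; elim/poly_mono_ind: p => [x y hx hy||a i].
- by rewrite !tp_mulDl hx hy.
- by rewrite !tp_mul0l.
elim/poly_mono_ind: s => [x y hx hy||b j].
- by rewrite tp_mulDl !tp_mulDr tp_mulDl hx hy.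
- by rewrite tp_mul0l !tp_mul0r tp_mul0l.
rewrite !tp_mul_mono !twistZ !twistM !twistXn twist_add.
have -> : a *: (iter i (frob iR) b *: 'X^j * 'X^i) =
    (a * iter i (frob iR) b) *: 'X^(i + j) :> {poly R}.
  by rewrite -scalerAl scalerA -exprD addnC.
by rewrite tp_mul_mono -scalerAl scalerA -mulrA -exprD (addnC j).
Qed.
Fact tp_mul1l : left_id (1 : {poly R}) tp_mul.
Proof.
by move=> s; have := tp_mul_mono 1 0 s; rewrite /= expr0 mulr1 !scale1r.
Qed.
Fact tp_mul1r : right_id (1 : {poly R}) tp_mul.
Proof.
move=> p; rewrite -[RHS]coefK poly_def /tp_mul; apply: eq_bigr => i _.
by rewrite [twist i 1](twistXn i 0) mul1r.
Qed.
Fact tp_one_neq0 : (1 : {poly R}) != 0 :> TP.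
Proof. exact: (@oner_neq0 {poly R}). Qed.
HB.instance Definition _ := GRing.Zmodule_isNzRing.Build TP
  tp_mulA tp_mul1l tp_mul1r tp_mulDl tp_mulDr tp_one_neq0.

Definition tp_const (xi : R) : TP := xi%:P.
Definition tp_tau : TP := 'X.

Lemma tp_constE xi (s : TP) : tp_const xi * s = (xi *: (s : {poly R}) : TP).
Proof.
have := tp_mul_mono xi 0 s; rewrite /= expr0 mulr1 alg_polyC; exact.
Qed.
Lemma tp_constD : {morph tp_const : x y / x + y}.
Proof. by move=> x y; rewrite /tp_const polyCD. Qed.
Lemma tp_constM : {morph tp_const : x y / x * y}.
Proof. by move=> x y; rewrite tp_constE /tp_const polyCM mul_polyC. Qed.
Lemma tp_tau_const xi : tp_tau * tp_const xi = tp_const (frob iR xi) * tp_tau.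
Proof.
rewrite tp_constE -[LHS]/(tp_mul _ _) /tp_tau /tp_const.
rewrite -[X in tp_mul X]scale1r -['X]expr1 tp_mul_mono scale1r.
by rewrite twistC mul_polyC.
Qed.
Lemma tp_const_central c (s : TP) : tp_const (iR c) * s = s * tp_const (iR c).
Proof.
rewrite tp_constE; elim/poly_mono_ind: s => [x y hx hy||a i].
- by rewrite mulrDl -hx -hy scalerDr.
- by rewrite mul0r scaler0.
rewrite -[RHS]/(tp_mul _ _) tp_mul_mono twistC mul_polyC !scalerA mulrC.
by congr (a * _ *: _); elim: i => //= i <-; rewrite frob_const.
Qed.
End TwistedPoly.

Definition finitely_generated (S : pzRingType) (N : lmodType S) : Prop :=
  exists n (e : 'I_n -> N), forall x, exists c : 'I_n -> S,
    x = \sum_i c i *: e i.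

Definition projective (S : pzRingType) (N : lmodType S) : Prop :=
  forall (U V : lmodType S) (g : {linear U -> V}) (h : {linear N -> V}),
    (forall v, exists u, g u = v) ->
    exists h' : {linear N -> U}, forall x, g (h' x) = h x.

Definition noetherian (R : comPzRingType) : Prop :=
  forall I : R -> Prop,
    I 0 -> (forall x y, I x -> I y -> I (x + y)) ->
    (forall a x, I x -> I (a * x)) ->
    exists n (e : 'I_n -> R), forall x,
      I x <-> exists c : 'I_n -> R, x = \sum_i c i * e i.

Record submodule (S : pzRingType) (N : lmodType S) := Submodule {
  sub_mem :> N -> Prop;
  sub_mem0 : sub_mem 0;
  sub_memD : forall x y, sub_mem x -> sub_mem y -> sub_mem (x + y);
  sub_memZ : forall a x, sub_mem x -> sub_mem (a *: x) }.

Section SubmoduleType.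
Variables (S : pzRingType) (N : lmodType S) (L : submodule N).
Definition sub_pred : {pred N} := fun x => `[< L x >].
Fact sub_pred_closed : submod_closed sub_pred.
Proof.
split=> [|a x y /asboolP hx /asboolP hy]; apply/asboolP; first exact: sub_mem0.
by apply: sub_memD => //; exact: sub_memZ.
Qed.
HB.instance Definition _ :=
  GRing.isSubmodClosed.Build S N sub_pred sub_pred_closed.
Definition submodule_type : Type := {x : N | sub_pred x}.
HB.instance Definition _ := SubChoice.on submodule_type.
HB.instance Definition _ := [SubChoice_isSubLmodule of submodule_type by <:].
End SubmoduleType.

(* d = dim_k (V / W), for k-subspaces W of V of the k-algebra B: some d      *)
(* elements of V form a basis modulo W.                                      *)
Definition has_quotient_dim (k : finFieldType) (B : pzRingType)
    (i : {rmorphism k -> B}) (V W : B -> Prop) (d : nat) : Prop :=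
  exists e : 'I_d -> B, (forall j, V (e j)) /\
    forall x, V x -> exists! c : {ffun 'I_d -> k},
      W (x - \sum_j i (c j) * e j).

Definition quotient_dim (k : finFieldType) (B : pzRingType)
    (i : {rmorphism k -> B}) (V W : B -> Prop) : nat :=
  if pselect (exists d, has_quotient_dim i V W d) is left h
  then projT1 (cid h) else 0%N.

(* F is finitely generated of transcendence degree 1 over k: it is finite    *)
(* over k(x) for some transcendental x.                                      *)
Definition function_field (k : finFieldType) (F : fieldType)
    (iF : {rmorphism k -> F}) : Prop :=
  exists x : F,
    (forall p : {poly k}, (map_poly iF p).[x] = 0 -> p = 0) /\
    exists n (e : 'I_n -> F), forall y, exists a b : 'I_n -> {poly k},
      (forall i, b i != 0) /\
      y = \sum_i (map_poly iF (a i)).[x] / (map_poly iF (b i)).[x] * e i.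

(* The closed points of the smooth projective model C of F over k are the    *)
(* normalized discrete valuations of F / k; the value at 0 is a convention.  *)
Record place (k : finFieldType) (F : fieldType) (iF : {rmorphism k -> F}) :=
  Place {
  val_at :> F -> int;
  val_at0 : val_at 0 = 0;
  val_atM : forall x y, x != 0 -> y != 0 ->
    val_at (x * y) = val_at x + val_at y;
  val_atD : forall x y, x != 0 -> y != 0 -> x + y != 0 ->
    Num.min (val_at x) (val_at y) <= val_at (x + y);
  val_at_const : forall c, val_at (iF c) = 0;
  val_at_onto : exists x, x != 0 /\ val_at x = 1 }.

Section Curve.
Variables (k : finFieldType) (F : fieldType) (iF : {rmorphism k -> F}).
Variable oo : place iF.

Lemma val_at1 (P : place iF) : P 1 = 0.
Proof. by rewrite -(rmorph1 iF) val_at_const. Qed.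
Lemma val_atN (P : place iF) x : P (- x) = P x.
Proof.
have [->|x0] := eqVneq x 0; first by rewrite oppr0.
rewrite -mulN1r val_atM // ?oppr_eq0 ?oner_eq0 //.
by rewrite -(rmorph1 iF) -rmorphN val_at_const add0r.
Qed.

Definition order_ge (P : place iF) (n : int) (x : F) : Prop :=
  x = 0 \/ n <= P x.

Fact order_ge0 P n : order_ge P n 0. Proof. by left. Qed.
Fact order_geB P n x y : order_ge P n x -> order_ge P n y -> order_ge P n (x - y).
Proof.
move=> [->|hx].
  by move=> [->|hy]; rewrite sub0r; [left; rewrite oppr0|right; rewrite val_atN].
move=> [->|hy]; first by rewrite subr0; right.
have [->|x0] := eqVneq x 0; first by rewrite sub0r; right; rewrite val_atN.
have [->|y0] := eqVneq y 0; first by rewrite subr0; right.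
have [->|xy0] := eqVneq (x - y) 0; first by left.
right; have y0' : - y != 0 by rewrite oppr_eq0.
by apply: (le_trans _ (val_atD P x0 y0' xy0)); rewrite val_atN le_min hx.
Qed.
Fact order_geS P m n x : (m <= n)%R -> order_ge P n x -> order_ge P m x.
Proof. by move=> h [->|h']; [left|right; exact: le_trans h']. Qed.
Fact order_ge1 P : order_ge P 0 1.
Proof. by right; rewrite val_at1. Qed.
Fact order_geM P m n x y :
  order_ge P m x -> order_ge P n y -> order_ge P (m + n) (x * y).
Proof.
move=> [->|hx]; first by left; rewrite mul0r.
move=> [->|hy]; first by left; rewrite mulr0.
have [->|x0] := eqVneq x 0; first by left; rewrite mul0r.
have [->|y0] := eqVneq y 0; first by left; rewrite mulr0.
by right; rewrite val_atM // lerD.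
Qed.
Fact order_ge_exhaustive P x : exists n, order_ge P n x.
Proof. by exists (P x); right. Qed.

Definition place_filtration (P : place iF) : filtration F :=
  Filtration (order_ge0 P) (@order_geB P) (@order_geS P) (order_ge1 P)
    (@order_geM P) (order_ge_exhaustive P).

(* A: the functions regular outside oo. *)
Definition regular_pred : {pred F} := fun x =>
  `[< forall P : place iF, P <> oo :> (F -> int) -> order_ge P 0 x >].
Fact regular_pred_closed : subring_closed regular_pred.
Proof.
split=> [|x y|x y]; first by apply/asboolP => P _; exact: order_ge1.
- move=> /asboolP h /asboolP h'; apply/asboolP => P hP.
  by apply: order_geB; [exact: h|exact: h'].
- move=> /asboolP h /asboolP h'; apply/asboolP => P hP.
  by apply: (@order_geM P 0 0); [exact: h|exact: h'].
Qed.
HB.instance Definition _ :=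
  GRing.isSubringClosed.Build F regular_pred regular_pred_closed.

Definition regular_ring : Type := {x : F | regular_pred x}.
HB.instance Definition _ := SubChoice.on regular_ring.
HB.instance Definition _ := [SubChoice_isSubComNzRing of regular_ring by <:].

Definition regular_incl : {rmorphism regular_ring -> F} :=
  GRing.RMorphism.clone _ _ (val : regular_ring -> F) _.

Fact const_regular c : iF c \in regular_pred.
Proof. by apply/asboolP => P _; right; rewrite val_at_const. Qed.
Definition const_regular_ring (c : k) : regular_ring :=
  exist _ (iF c) (const_regular c).
Fact const_regular_ring_additive : zmod_morphism const_regular_ring.
Proof. by move=> x y; apply: val_inj; rewrite /= rmorphB. Qed.
Fact const_regular_ring_monoid : monoid_morphism const_regular_ring.
Proof.
by split=> [|x y]; apply: val_inj; rewrite /= ?rmorph1 ?rmorphM.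
Qed.
HB.instance Definition _ := GRing.isZmodMorphism.Build k regular_ring
  const_regular_ring const_regular_ring_additive.
HB.instance Definition _ := GRing.isMonoidMorphism.Build k regular_ring
  const_regular_ring const_regular_ring_monoid.

(* deg_A(a) = dim_k (A / Aa). *)
Definition deg_A (a : regular_ring) : nat :=
  quotient_dim const_regular_ring (fun=> True) (fun x => exists b, x = b * a).

Definition F_oo : Type := completion (place_filtration oo).
HB.instance Definition _ := GRing.ComPzRing.on F_oo.

Definition F_oo_fil : filtration F_oo :=
  completed_filtration (place_filtration oo).

Definition F_to_F_oo : {rmorphism F -> F_oo} :=
  GRing.RMorphism.clone _ _ (to_completion (place_filtration oo)) _.
Definition const_F_oo : {rmorphism k -> F_oo} :=
  GRing.RMorphism.clone _ _ (F_to_F_oo \o iF) _.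
Definition regular_F_oo : {rmorphism regular_ring -> F_oo} :=
  GRing.RMorphism.clone _ _ (F_to_F_oo \o regular_incl) _.

Fact F_oo_one_neq0 : (1 : F_oo) != 0.
Proof.
apply/negP => /eqP /limit_eq /(_ 1) [N /(_ N (leqnn N))].
rewrite subr0 => -[|]; first exact/eqP/oner_neq0.
by rewrite val_at1.
Qed.
HB.instance Definition _ := GRing.PzSemiRing_isNonZero.Build F_oo F_oo_one_neq0.

Fact F_oo_inv_subproof (x : F_oo) : x != 0 -> exists y, y * x = 1.
Proof.
elim/completion_ind: x => u hu u0.
have [n hn] : exists n, ~ eventually_fil (place_filtration oo) n u.
  apply: contrapT => /forallNP h; move/eqP: u0; apply; apply/limit_eq => n.
  by have /contrapT [N hN] := h n; exists N => i /hN; rewrite subr0.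
have [N hN] := hu n.
have [i0 [hi0 hi0n]] : exists i0, (N <= i0)%N /\ ~ order_ge oo n (u i0).
  apply: contrapT => /forallNP h; apply: hn; exists N => i hi.
  by apply: contrapT => hc; apply: (h i).
have hnz j : (N <= j)%N -> ~ order_ge oo n (u j).
  move=> hj hc; apply: hi0n.
  by apply: (@fil_subl _ (place_filtration oo) _ (u j)) => //; exact: hN.
have u_neq0 j : (N <= j)%N -> u j != 0.
  by move=> /hnz h; apply/eqP => e; apply: h; left.
have u_lt j : (N <= j)%N -> oo (u j) < n.
  by move=> /hnz h; rewrite ltNge; apply/negP => le; apply: h; right.
have vV (y : F) : y != 0 -> oo y^-1 = - oo y.
  move=> y0; apply/eqP; rewrite -addr_eq0 -val_atM ?invr_eq0 // mulVf //.
  by rewrite val_at1.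
have lowb : exists m : int, forall j, (N <= j)%N -> m <= - oo (u j).
  by exists (- n) => j /u_lt h; rewrite lerN2 ltW.
have [m hm] := lowb.
have hw : cauchy (place_filtration oo) (fun i => (u i)^-1).
  move=> c; have [N' hN'] := hu (c - m - m).
  exists (maxn N N') => i j; rewrite !geq_max => /andP[i1 i2] /andP[j1 j2].
  have -> : (u i)^-1 - (u j)^-1 = (u i)^-1 * (u j - u i) * (u j)^-1.
    rewrite mulrBr mulrBl mulVf ?u_neq0 // mul1r -mulrA mulfV ?u_neq0 //.
    by rewrite mulr1.
  rewrite -[c](subrK m); apply: order_geM; last first.
    by right; rewrite vV ?u_neq0 // hm.
  rewrite -[c - m](subrK m) addrC; apply: order_geM; last exact: hN'.
  by right; rewrite vV ?u_neq0 // hm.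
exists (limit hw); rewrite [LHS]limitM; apply/limit_eq => c.
by exists N => i hi; rewrite mulVf ?u_neq0 // subrr; left.
Qed.

Definition F_oo_inv (x : F_oo) : F_oo :=
  if pselect (exists y, y * x = 1) is left h then projT1 (cid h) else 0.
Fact F_oo_mulVf x : x != 0 -> F_oo_inv x * x = 1.
Proof.
move=> /F_oo_inv_subproof h; rewrite /F_oo_inv; case: pselect => // h'.
by case: cid.
Qed.
Fact F_oo_inv0 : F_oo_inv 0 = 0.
Proof.
rewrite /F_oo_inv; case: pselect => // h; exfalso; case: h => y.
by rewrite mulr0 => /eqP; rewrite eq_sym (negPf F_oo_one_neq0).
Qed.
HB.instance Definition _ :=
  GRing.ComNzRing_isField.Build F_oo F_oo_mulVf F_oo_inv0.

Definition in_A_oo (x : F_oo) : Prop := F_oo_fil 0 x.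
Definition in_m_oo (x : F_oo) : Prop := F_oo_fil 1 x.

(* The degree of the residue field A_oo / m_oo over k. *)
Definition d_oo : nat := quotient_dim const_F_oo in_A_oo in_m_oo.

Definition uniformizer (z : F_oo) : Prop :=
  forall x, in_m_oo x <-> exists y, in_A_oo y /\ x = z * y.

End Curve.

(* The size of a polynomial is its degree plus 1. *)
Record drinfeld_module (k : finFieldType) (F : fieldType)
    (iF : {rmorphism k -> F}) (oo : place iF) (R : idomainType)
    (iR : {rmorphism k -> R}) (r : nat) := DrinfeldModule {
  dm_map :> {rmorphism regular_ring oo -> twisted_poly iR};
  dm_const : forall c,
    dm_map (const_regular_ring oo c) = tp_const iR (iR c);
  dm_degree : forall a, a != 0 ->
    size (dm_map a : {poly R}) = (r * deg_A a).+1 /\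
    lead_coef (dm_map a : {poly R}) \is a GRing.unit }.

Section Motive.
Variables (k : finFieldType) (F : fieldType) (iF : {rmorphism k -> F}).
Variables (oo : place iF) (R : idomainType) (iR : {rmorphism k -> R}) (r : nat).
Variable phi : drinfeld_module oo iR r.

(* A (x)_k R *)
Definition AR : Type := tensor_ring (const_regular_ring oo) iR.
HB.instance Definition _ := GRing.ComPzRing.on AR.

Definition A_motive (_ : drinfeld_module oo iR r) : Type := twisted_poly iR.
Local Notation M := (A_motive phi).
HB.instance Definition _ := GRing.Zmodule.on M.

Definition motive_action (m : twisted_poly iR) (a : regular_ring oo) (xi : R) :
  twisted_poly iR := tp_const iR xi * m * phi a.

Lemma motive_action_bal m :
  tr_balanced (const_regular_ring oo) iR (motive_action m).
Proof.
rewrite /motive_action; split=> [x y c|x c d|x s c].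
- by rewrite rmorphD mulrDr.
- by rewrite tp_constD !mulrDl.
rewrite rmorphM dm_const tp_constM -!mulrA tp_const_central.
by rewrite -!mulrA.
Qed.

Definition motive_scale (s : AR) (m : M) : M :=
  tr_lift (motive_action m) s.

Lemma motive_scaleD m : {morph motive_scale^~ m : s t / s + t}.
Proof. exact: (tr_liftD (motive_action_bal m)). Qed.
Lemma motive_scale0 m : motive_scale 0 m = 0.
Proof. exact: (tr_lift0 (motive_action_bal m)). Qed.
Lemma motive_scale_pure a xi m :
  motive_scale (ptensor _ _ a xi) m = tp_const iR xi * m * phi a.
Proof. exact: (tr_lift_pure _ _ (motive_action_bal m)). Qed.

Fact motive_scaleDr : right_distributive motive_scale +%R.
Proof.
move=> s m n; elim/tr_ind: s => [x y hx hy||a xi].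
- by rewrite !motive_scaleD hx hy addrACA.
- by rewrite !motive_scale0 addr0.
by rewrite !motive_scale_pure mulrDr mulrDl.
Qed.
Lemma motive_scale0r s : motive_scale s 0 = 0.
Proof. by apply: (addrI (motive_scale s 0)); rewrite -motive_scaleDr !addr0. Qed.
Fact motive_scaleA s t m :
  motive_scale s (motive_scale t m) = motive_scale (s * t) m.
Proof.
elim/tr_ind: s => [x y hx hy||a xi].
- by rewrite mulrDl !motive_scaleD hx hy.
- by rewrite mul0r !motive_scale0.
elim/tr_ind: t => [x y hx hy||b zeta].
- by rewrite mulrDr !motive_scaleD motive_scaleDr hx hy.
- by rewrite mulr0 !motive_scale0 motive_scale0r.
by rewrite ptensorM !motive_scale_pure tp_constM mulrC rmorphM -!mulrA.
Qed.
Fact motive_scale1 : left_id 1 motive_scale.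
Proof.
move=> m; rewrite -[1]/(ptensor _ _ 1 1) motive_scale_pure rmorph1 mulr1.
by rewrite tp_constE scale1r.
Qed.
HB.instance Definition _ := GRing.Zmodule_isLmodule.Build AR M
  motive_scaleA motive_scale1 motive_scaleDr motive_scaleD.

Definition motive_tau (m : M) : M := tp_tau iR * (m : twisted_poly iR).

End Motive.

Section CompletedTensor.
Variables (k : finFieldType) (F : fieldType) (iF : {rmorphism k -> F}).
Variables (oo : place iF) (R : idomainType) (iR : {rmorphism k -> R}).

(* F_oo (x)_k R *)
Definition FR : Type := tensor_ring (const_F_oo oo) iR.
HB.instance Definition _ := GRing.ComPzRing.on FR.

(* The subgroup m_oo^n (x) R; R carries the discrete topology. *)
Definition FR_order_ge (n : int) (x : FR) : Prop :=
  exists s : seq (F_oo oo * R),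
    (forall p, p \in s -> F_oo_fil oo n p.1) /\
    x = \sum_(p <- s) ptensor (const_F_oo oo) iR p.1 p.2.

Lemma FR_order_geD n x y :
  FR_order_ge n x -> FR_order_ge n y -> FR_order_ge n (x + y).
Proof.
move=> [s [hs ->]] [t [ht ->]]; exists (s ++ t); split; last by rewrite big_cat.
by move=> p; rewrite mem_cat => /orP[/hs|/ht].
Qed.
Lemma FR_order_ge_pure n a c :
  F_oo_fil oo n a -> FR_order_ge n (ptensor (const_F_oo oo) iR a c).
Proof.
move=> h; exists [:: (a, c)]; split; last by rewrite big_seq1.
by move=> p; rewrite inE => /eqP ->.
Qed.
Fact FR_order_ge0 n : FR_order_ge n 0.
Proof. by exists [::]; rewrite big_nil. Qed.
Lemma FR_order_ge_sum n (s : seq (F_oo oo * R)) (G : F_oo oo * R -> FR) :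
  (forall p, p \in s -> FR_order_ge n (G p)) ->
  FR_order_ge n (\sum_(p <- s) G p).
Proof.
move=> h; rewrite big_seq; apply: big_ind => //; first exact: FR_order_ge0.
exact: FR_order_geD.
Qed.
Lemma ptensorN a c :
  ptensor (const_F_oo oo) iR (- a) c = - ptensor (const_F_oo oo) iR a c.
Proof. exact: (balancedNl (tr_balancedP (ptensor_balanced _ _))). Qed.
Fact FR_order_geB n x y :
  FR_order_ge n x -> FR_order_ge n y -> FR_order_ge n (x - y).
Proof.
move=> hx [s [hs ->]]; apply: FR_order_geD => //; rewrite -sumrN.
apply: FR_order_ge_sum => p /hs hp; rewrite -ptensorN.
by apply: FR_order_ge_pure; exact: filN.
Qed.
Fact FR_order_geS m n x : (m <= n)%R -> FR_order_ge n x -> FR_order_ge m x.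
Proof.
move=> le [s [hs ->]]; apply: FR_order_ge_sum => p /hs hp.
by apply: FR_order_ge_pure; exact: filS hp.
Qed.
Fact FR_order_ge1 : FR_order_ge 0 1.
Proof. by apply: FR_order_ge_pure; exact: fil1. Qed.
Fact FR_order_geM m n x y :
  FR_order_ge m x -> FR_order_ge n y -> FR_order_ge (m + n) (x * y).
Proof.
move=> [s [hs ->]] [t [ht ->]]; rewrite mulr_suml.
apply: FR_order_ge_sum => p /hs hp; rewrite mulr_sumr.
apply: FR_order_ge_sum => p' /ht hp'; rewrite ptensorM.
by apply: FR_order_ge_pure; exact: filM.
Qed.
Fact FR_order_ge_exhaustive x : exists n, FR_order_ge n x.
Proof.
elim/tr_ind: x => [x y [m hm] [n hn]||a c].
- exists (Order.min m n); apply: FR_order_geD.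
    by apply: FR_order_geS hm; rewrite ge_min lexx.
  by apply: FR_order_geS hn; rewrite ge_min lexx orbT.
- by exists 0; exact: FR_order_ge0.
have [n hn] := fil_exhaustive (F_oo_fil oo) a.
by exists n; exact: FR_order_ge_pure.
Qed.

Definition FR_filtration : filtration FR :=
  Filtration FR_order_ge0 FR_order_geB FR_order_geS FR_order_ge1
    FR_order_geM FR_order_ge_exhaustive.

(* E_F is the completed tensor product of F_oo and R. That of A_oo and R is  *)
(* the completion of A_oo (x) R along the m_oo^n (x) R, which is the closure *)
(* of A_oo (x) R in E_F: k being a field, A_oo (x) R embeds in F_oo (x) R.   *)
Definition E_F : Type := completion FR_filtration.
HB.instance Definition _ := GRing.ComPzRing.on E_F.
Definition E_A : Type := integral_elements FR_filtration.
HB.instance Definition _ := GRing.ComPzRing.on E_A.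
Definition E_A_incl : {rmorphism E_A -> E_F} :=
  GRing.RMorphism.clone _ _ (val : integral_elements FR_filtration -> E_F) _.

Definition F_oo_to_E (a : F_oo oo) : E_F :=
  to_completion FR_filtration (ptensor (const_F_oo oo) iR a 1).

(* id (x) Frob_q on F_oo (x) R and its continuous extension sigma. *)
Definition FR_sigma : {rmorphism FR -> FR} :=
  GRing.RMorphism.clone _ _
    (tensor_map (f := const_F_oo oo) (g := iR) (f' := const_F_oo oo) (g' := iR)
       (h1 := idfun) (h2 := frob iR) (fun=> erefl) (frob_const iR)) _.

Lemma FR_sigma_pure a xi :
  FR_sigma (ptensor _ _ a xi) = ptensor _ _ a (xi ^+ #|k|).
Proof.
exact: (tensor_map_pure (f := const_F_oo oo) (f' := const_F_oo oo)
  (h1 := idfun) (h2 := frob iR) (fun=> erefl) (frob_const iR) a xi).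
Qed.

Fact FR_sigma_filtered : filtered FR_filtration FR_filtration FR_sigma.
Proof.
move=> n x [s [hs ->]]; rewrite rmorph_sum; apply: FR_order_ge_sum => p /hs hp.
by rewrite FR_sigma_pure; exact: FR_order_ge_pure.
Qed.

Definition sigma : {rmorphism E_F -> E_F} :=
  GRing.RMorphism.clone _ _ (completion_map FR_sigma_filtered) _.

(* A (x)_k R -> F_oo (x)_k R -> E_F *)
Definition AR_to_FR : {rmorphism AR oo iR -> FR} :=
  GRing.RMorphism.clone _ _
    (tensor_map (f := const_regular_ring oo) (g := iR) (f' := const_F_oo oo)
       (g' := iR) (h1 := regular_F_oo oo) (h2 := idfun)
       (fun=> erefl) (fun=> erefl)) _.
Definition AR_to_E : {rmorphism AR oo iR -> E_F} :=
  GRing.RMorphism.clone _ _ (to_completion FR_filtration \o AR_to_FR) _.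

(* sigma^* N -> N, e (x) x |-> e tau(x) *)
Definition linearization (N : lmodType E_F) (t : N -> N) :
  tensor sigma N -> N := tensor_lift (fun e x => e *: t x).

Definition isocrystal (N : lmodType E_F) (t : N -> N) : Prop :=
  [/\ finitely_generated N, projective N,
      {morph t : x y / x + y},
      forall e x, t (e *: x) = sigma e *: t x
    & bijective (linearization t)].

Definition lattice (z : F_oo oo) (N : lmodType E_F)
    (L : submodule (restrict_scalars E_A_incl N)) : Prop :=
  [/\ finitely_generated (submodule_type L), projective (submodule_type L)
    & forall x : N, exists m : nat, L (F_oo_to_E (z ^+ m) *: x)].

(* The last condition: tau^(n d_oo) L generates z^(n alpha) L over E_A.      *)
Definition pure (z : F_oo oo) (N : lmodType E_F) (t : N -> N)
    (alpha : rat) : Prop :=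
  exists (n : nat) (m : int) (L : submodule (restrict_scalars E_A_incl N)),
    [/\ (0 < n)%N, m%:~R = n%:R * alpha, lattice z L
      & forall x : N,
          (exists y : N, L y /\ x = F_oo_to_E (z ^ m) *: y) <->
          (exists s : seq (E_A * N), (forall p, p \in s -> L p.2) /\
             x = \sum_(p <- s)
                   E_A_incl p.1 *: iter (n * d_oo oo) t p.2)].

Section MotiveIsocrystal.
Variables (r : nat) (phi : drinfeld_module oo iR r).

(* M_{F,oo} = E_F (x)_{A (x) R} M, with tau (e (x) m) = sigma e (x) tau m. *)
Definition motive_isocrystal : Type := tensor AR_to_E (A_motive phi).
HB.instance Definition _ := GRing.Lmodule.on motive_isocrystal.

Definition motive_isocrystal_tau (x : motive_isocrystal) : motive_isocrystal :=
  tensor_lift (W := motive_isocrystal)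
    (fun e m => pure_tensor AR_to_E (sigma e) (motive_tau m)) x.

Lemma sigma_cst x :
  sigma (to_completion FR_filtration x) =
  to_completion FR_filtration (FR_sigma x).
Proof. by rewrite [LHS]completion_mapE; exact: limit_ext. Qed.
Lemma AR_to_E_pure a xi :
  AR_to_E (ptensor _ _ a xi) =
  to_completion FR_filtration (ptensor _ _ (regular_F_oo oo a) xi).
Proof.
by congr (to_completion _ _);
  exact: (tensor_map_pure (f := const_regular_ring oo) (f' := const_F_oo oo)
    (h1 := regular_F_oo oo) (h2 := idfun) (fun=> erefl) (fun=> erefl) a xi).
Qed.
Lemma sigma_AR_to_E a xi :
  sigma (AR_to_E (ptensor _ _ a xi)) = AR_to_E (ptensor _ _ a (xi ^+ #|k|)).
Proof. by rewrite !AR_to_E_pure sigma_cst FR_sigma_pure. Qed.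
Lemma motive_tau_scale a xi (m : A_motive phi) :
  motive_tau ((ptensor _ _ a xi : AR oo iR) *: m) =
  (ptensor _ _ a (xi ^+ #|k|) : AR oo iR) *: motive_tau m.
Proof.
have scaleE a' xi' (n : A_motive phi) :
    (ptensor _ _ a' xi' : AR oo iR) *: n =
    tp_const iR xi' * (n : twisted_poly iR) * phi a'.
  exact: motive_scale_pure.
rewrite /motive_tau scaleE [RHS]scaleE.
by rewrite !mulrA tp_tau_const.
Qed.
Lemma motive_tauD : {morph @motive_tau _ _ _ _ _ _ _ phi : m n / m + n}.
Proof. exact: mulrDr. Qed.

Lemma motive_isocrystal_balanced :
  balanced AR_to_E (W := motive_isocrystal)
    (fun e (m : A_motive phi) =>
       pure_tensor AR_to_E (sigma e) (motive_tau m)).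
Proof.
have [h1 h2 h3] := pure_balanced AR_to_E (A_motive phi).
split=> [x y m|x m n|x s m]; first by rewrite rmorphD h1.
- by rewrite motive_tauD h2.
elim/tr_ind: s => [s t hs ht||a xi].
- by rewrite rmorphD mulrDr rmorphD h1 hs ht scalerDl motive_tauD h2.
- rewrite rmorph0 mulr0 rmorph0 scale0r.
  have -> : motive_tau (0 : A_motive phi) = 0 by exact: mulr0.
  by rewrite (balanced0l (pure_balanced _ _)) (balanced0r (pure_balanced _ _)).
by rewrite rmorphM sigma_AR_to_E h3 motive_tau_scale.
Qed.

Lemma motive_isocrystal_tau_pure e m :
  motive_isocrystal_tau (pure_tensor AR_to_E e m) =
  pure_tensor AR_to_E (sigma e) (motive_tau m).
Proof. exact: (tensor_lift_pure motive_isocrystal_balanced). Qed.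
End MotiveIsocrystal.
End CompletedTensor.

Arguments motive_isocrystal {k F iF oo R iR r} phi.
Arguments motive_isocrystal_tau {k F iF oo R iR r} phi x.

(* Main.v *)
(* Let q = #|k|, d = d_oo and D = r d. For a in A with a pole of order n at   *)
(* oo, phi_a has degree D n and a unit as leading coefficient. Hence the      *)
(* degree in tau extends to a filtration Lam_j of the isocrystal, spanned by  *)
(* the e tau^i with i - D ord(e) <= j, for which multiplication by z maps     *)
(* Lam_j onto Lam_(j-D), and Lam_(s+D-1) / Lam_(s-1) is free over R with      *)
(* basis tau^s, ..., tau^(s+D-1). By Nakayama's lemma these D powers of tau   *)
(* form a basis of Lam_(s+D-1) over R[[z]] and of the isocrystal over R((z)). *)
(* As tau maps the basis for s to the basis for s + 1, the linearization is   *)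
(* bijective, and tau^D Lam_(D-1) generates Lam_(2D-1) = z^-1 Lam_(D-1),      *)
(* which is purity of slope -1/r. The isocrystal and Lam_(D-1) are projective *)
(* since averaging the R((z))-coordinates over the group of Teichmuller       *)
(* representatives of the residue field makes them E_F-linear.                *)
From HB Require Import structures.
From mathcomp Require Import all_boot all_order all_algebra all_field.
From mathcomp Require Import boolp classical_sets functions.
From mathcomp Require Import generic_quotient ring_quotient.
From mathcomp Require Import zify ring.
Require Import Defs.
Set Implicit Arguments.
Unset Strict Implicit.
Unset Printing Implicit Defensive.
Import Order.TTheory GRing.Theory Num.Theory.
Local Open Scope ring_scope.
Local Open Scope quotient_scope.

(** * Functions algebraic over k(t) *)

(** Write q for the order of k, d for [d_oo] and D = r d. The slope is read off from the degree in
    tau, once this degree is tied to the order at oo. By [deg_AE] the degree of a in A is d times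
    its pole order at oo, so multiplication by phi_a raises the tau-degree by D times that pole
    order. Giving e tau^i the degree i - D ord(e) therefore defines a filtration [Lam] of the
    isocrystal that multiplication by z shifts by exactly -D and tau raises by at most 1.

    Its graded pieces are controlled from two sides. From above, [Lam_top] shows that tau^l
    generates the piece of degree l over R: elements of F_oo are approximated by quotients of
    elements of A, and the leading coefficients of phi are units. From below, [pure_detect] shows
    that a nonzero m in the motive is not a sum of terms of smaller degree. Hence Nakayama's lemma
    ([window_span]) and a divisibility argument ([window_free]) make any D consecutive powers tau^s,
    ..., tau^(s+D-1) a basis over R[[z]] of Lam_(s+D-1). The windows s = 0, 1 and D give
    respectively the lattice, the bijectivity of the linearization and the slope.

    The ring E_A is larger than R[[z]] by the residue field at oo, so these are not bases over E_A.
    Averaging coordinates over the Teichmuller representatives ([averageZ], [averageE]) turns them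
    into dual bases over E_F and E_A, which yields finite generation and projectivity.

    The arithmetic input is that A is large: F_oo is the sum of A and a fixed power of the maximal
    ideal, with control of orders ([regular_approximation]). This rests on a function whose only
    pole is oo ([pole_at_infinity]). Places are constructed as in Chevalley's extension theorem
    ([place_exists]), and pigeonhole counts over the finite field k do the work of Riemann-Roch. *)

Lemma pigeonhole (T T' : finType) (f : T -> T') :
  (#|T'| < #|T|)%N -> exists x y, x != y /\ f x = f y.
Proof.
move=> lt; apply: contrapT => h; move: lt; rewrite ltnNge => /negP; apply.
apply: (@leq_card _ _ f) => x y exy; apply/eqP; apply: contrapT => /negP nxy.
by apply: h; exists x, y.
Qed.

Lemma card_finField_gt1 (k : finFieldType) : (1 < #|k|)%N.
Proof. by rewrite finNzRing_gt1. Qed.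

Section Evaluation.
Variables (k : finFieldType) (F : fieldType) (iF : {rmorphism k -> F}).

Definition ev (t : F) (p : {poly k}) : F := (map_poly iF p).[t].

Lemma evE t n (p : {poly k}) : (size p <= n)%N ->
  ev t p = \sum_(i < n) iF p`_i * t ^+ i.
Proof.
move=> le; rewrite /ev (@horner_coef_wide _ n) ?size_map_poly //.
by apply: eq_bigr => i _; rewrite coef_map.
Qed.
Lemma evD t : {morph ev t : p r / p + r}.
Proof. by move=> p r; rewrite /ev rmorphD hornerD. Qed.
Lemma evM t : {morph ev t : p r / p * r}.
Proof. by move=> p r; rewrite /ev rmorphM hornerM. Qed.
Lemma evN t : {morph ev t : p / - p}.
Proof. by move=> p; rewrite /ev rmorphN hornerN. Qed.
Lemma evB t : {morph ev t : p r / p - r}.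
Proof. by move=> p r; rewrite evD evN. Qed.
Lemma ev0 t : ev t 0 = 0. Proof. by rewrite /ev rmorph0 horner0. Qed.
Lemma ev1 t : ev t 1 = 1. Proof. by rewrite /ev rmorph1 hornerE. Qed.
Lemma evC t c : ev t c%:P = iF c.
Proof. by rewrite /ev map_polyC hornerC. Qed.
Lemma evX t : ev t 'X = t. Proof. by rewrite /ev map_polyX hornerX. Qed.
Lemma ev_exp t p m : ev t (p ^+ m) = ev t p ^+ m.
Proof. by rewrite /ev rmorphXn horner_exp. Qed.

Definition transcendental (t : F) : Prop := forall p, ev t p = 0 -> p = 0.

(* F has dimension less than n over k(t). *)
Definition dependent (t : F) (n : nat) : Prop := forall f : 'I_n -> F,
  exists p : 'I_n -> {poly k},
    (exists i, p i != 0) /\ \sum_i ev t (p i) * f i = 0.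

Section Siegel.
Variables (x : F) (xtr : transcendental x) (n : nat) (e : 'I_n -> F).
Hypothesis span : forall y, exists a b : 'I_n -> {poly k},
  (forall i, b i != 0) /\ y = \sum_i ev x (a i) / ev x (b i) * e i.

Let ev_neq0 p : p != 0 -> ev x p != 0.
Proof. by apply: contra_neq; exact: xtr. Qed.

Let bounded (C : nat) (g : F) : Prop := exists c : 'I_n -> {poly k},
  (forall l, size (c l) <= C)%N /\ g = \sum_l ev x (c l) * e l.

Let boundedW C C' g : (C <= C')%N -> bounded C g -> bounded C' g.
Proof. by move=> le [c [hc ->]]; exists c; split=> // l; exact: leq_trans le. Qed.
Let boundedD C g g' : bounded C g -> bounded C g' -> bounded C (g + g').
Proof.
move=> [c [hc ->]] [c' [hc' ->]]; exists (fun l => c l + c' l).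
split=> [l|]; last by rewrite -big_split; apply: eq_bigr => l _; rewrite evD mulrDl.
by apply: leq_trans (size_polyD _ _) _; rewrite geq_max hc hc'.
Qed.
Let bounded0 C : bounded C 0.
Proof.
exists (fun=> 0); split=> [l|]; first by rewrite size_poly0.
by rewrite big1 // => l _; rewrite ev0 mul0r.
Qed.
Let boundedM C (a : {poly k}) g : bounded C g -> bounded (C + size a) (ev x a * g).
Proof.
move=> [c [hc ->]]; exists (fun l => a * c l); split=> [l|].
  apply: leq_trans (size_polyMleq _ _) _; have := hc l; lia.
by rewrite mulr_sumr; apply: eq_bigr => l _; rewrite evM mulrA.
Qed.
Let bounded_sum C (I : finType) (g : I -> F) :
  (forall i, bounded C (g i)) -> bounded C (\sum_i g i).
Proof. by move=> h; apply: big_ind => //; exact: boundedD. Qed.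

Let denominator (g : F) :
  exists (h : {poly k}) C, h != 0 /\ bounded C (ev x h * g).
Proof.
have [a [b [hb ->]]] := span g.
pose h := \prod_i b i.
have h0 : h != 0 by apply/prodf_neq0.
pose c l := a l * \prod_(i | i != l) b i.
exists h, (\max_l size (c l)); split=> //.
exists c; split=> [l|]; first exact: (leq_bigmax l).
rewrite mulr_sumr; apply: eq_bigr => l _; rewrite /h (bigD1 l) //= !evM.
rewrite !mulrA; congr (_ * _); rewrite -[RHS]mulr1 -(mulfV (ev_neq0 (hb l))).
ring.
Qed.

Let denominators (m : nat) (g : 'I_m -> F) :
  exists (h : {poly k}) C, h != 0 /\ forall i, bounded C (ev x h * g i).
Proof.
pose h i := projT1 (cid (denominator (g i))).
pose C i := projT1 (cid (projT2 (cid (denominator (g i))))).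
have hP i : h i != 0 /\ bounded (C i) (ev x (h i) * g i).
  exact: (projT2 (cid (projT2 (cid (denominator (g i)))))).
pose w i := \prod_(j | j != i) h j.
exists (\prod_i h i), (\max_i (C i + size (w i))); split.
  by apply/prodf_neq0 => i _; case: (hP i).
move=> i; rewrite [\prod_i h i](bigD1 i) //= -/(w i) evM.
have [_ /(boundedM (w i)) hb] := hP i.
have le : (C i + size (w i) <= \max_i (C i + size (w i)))%N.
  exact: (leq_bigmax (F := fun i => C i + size (w i))%N i).
apply: boundedW le _.
by rewrite (_ : _ * _ = ev x (w i) * (ev x (h i) * g i)) //; ring.
Qed.

(** A count in the manner of Siegel's lemma. Written in the generators e over k[x] with a common
    denominator, multiplication by t raises the degree of coefficients by at most a constant K. With
    more than n K functions f_i there are more combinations of bounded degree in t than possible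
    values, so two of them coincide. *)
Lemma siegel_dependent (t : F) : exists m, dependent t m.
Proof.
have [h [K0 [h0 hK0]]] := denominators (fun j => t * e j).
pose K := (K0 + size h)%N.
exists (n * K).+1 => f.
have [H [C [H0 hC]]] := denominators f.
have stepT c g : bounded c g -> bounded (c + K) (ev x h * (t * g)).
  move=> [w [hw ->]]; rewrite !mulr_sumr; apply: bounded_sum => l.
  apply: (@boundedW (K0 + size (w l))); first by have := hw l; rewrite /K; lia.
  rewrite (_ : _ * _ = ev x (w l) * (ev x h * (t * e l))); last ring.
  exact: boundedM.
have stepH c g : bounded c g -> bounded (c + K) (ev x h * g).
  by move=> /(boundedM h); apply: boundedW; rewrite /K; lia.
have pow N j g : (j <= N)%N -> bounded C g ->
    bounded (C + K * N) (ev x h ^+ N * (t ^+ j * g)).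
  elim: N j => [|N IH] j.
    by rewrite leqn0 => /eqP -> hg; rewrite !expr0 !mul1r muln0 addn0.
  move=> le hg; rewrite mulnSr addnA exprS.
  case: j le => [|j] le.
    by rewrite -mulrA; apply: stepH; exact: IH.
  rewrite (_ : _ * _ = ev x h * (t * (ev x h ^+ N * (t ^+ j * g)))).
    by apply: stepT; exact: IH.
  rewrite exprS; ring.
(* N is chosen so that m (N + 1) = (n K + 1)(n C + 1) exceeds n (C + K N), the exponents of q in the
   two cardinalities. *)
pose N := (n * C)%N; pose m := (n * K).+1.
pose val (A : 'M[k]_(m, N.+1)) := \sum_i ev t (rVpoly (row i A)) * f i.
have hval A : bounded (C + K * N) (ev x h ^+ N * (ev x H * val A)).
  rewrite /val !mulr_sumr; apply: bounded_sum => i.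
  rewrite (@evE t N.+1) ?size_poly // mulr_suml !mulr_sumr.
  apply: bounded_sum => j.
  rewrite -(evC x) (_ : _ * _ = ev x ((rVpoly (row i A))`_j)%:P *
    (ev x h ^+ N * (t ^+ j * (ev x H * f i)))); last by ring.
  have [c [hc ->]] : bounded (C + K * N) (ev x h ^+ N * (t ^+ j * (ev x H * f i))).
    by apply: pow; [rewrite -ltnS|exact: hC].
  exists (fun l => ((rVpoly (row i A))`_j)%:P * c l); split=> [l|].
    rewrite mul_polyC; exact: leq_trans (size_scale_leq _ _) (hc l).
  by rewrite mulr_sumr; apply: eq_bigr => l _; rewrite evM mulrA.
pose code A : 'M[k]_(n, C + K * N) :=
  \matrix_(i, j) (projT1 (cid (hval A)) i)`_j.
have codeP A : ev x h ^+ N * (ev x H * val A) =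
    \sum_l ev x (rVpoly (row l (code A))) * e l.
  have [hc ->] := projT2 (cid (hval A)); apply: eq_bigr => l _; congr (ev x _ * _).
  apply/polyP => j; rewrite coef_rVpoly; case: insubP => [j' hj' vj'|].
    by rewrite !mxE vj'.
  by rewrite -leqNgt => hj; rewrite nth_default // (leq_trans (hc l)).
have [|A [A' [neq eqc]]] := @pigeonhole _ _ code.
  rewrite !card_mx ltn_exp2l ?card_finField_gt1 // /m /N; nia.
exists (fun i => rVpoly (row i A) - rVpoly (row i A')); split.
  apply: contrapT => /forallNP hn; move/eqP: neq; apply; apply/row_matrixP => i.
  apply: (can_inj rVpolyK); apply/eqP; rewrite -subr_eq0; apply/negPn/negP.
  exact: hn.
have : val A = val A'.
  have := codeP A; rewrite eqc -codeP => eqv.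
  by apply: (mulfI (ev_neq0 H0)); apply: mulfI eqv; rewrite expf_neq0 ?ev_neq0.
move=> eqv; transitivity (val A - val A'); last by rewrite eqv subrr.
by rewrite /val -sumrB; apply: eq_bigr => i _; rewrite evB mulrBl.
Qed.

End Siegel.

Lemma function_field_dependent (hF : function_field iF) (t : F) :
  exists n, dependent t n.
Proof.
have [x [xtr [n [e span]]]] := hF.
exact: (@siegel_dependent x xtr n e span).
Qed.
End Evaluation.

Lemma int_mulrn (a : int) n : a *+ n = a * n%:Z.
Proof. by rewrite -mulr_natr natz. Qed.

Section Reverse.
Variables (k : finFieldType) (F : fieldType) (iF : {rmorphism k -> F}).

(** The witness is the reversed polynomial. It transfers relations over k[t] to k[1/t]. *)
Lemma ev_rev (t : F) n (p : {poly k}) : t != 0 -> (size p <= n.+1)%N ->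
  exists r, (r = 0 -> p = 0) /\ ev iF t^-1 r = ev iF t p * t^-1 ^+ n.
Proof.
move=> t0 le; exists (\poly_(i < n.+1) p`_(n - i)); split.
  move=> r0; apply/polyP => i; rewrite coef0.
  case: (leqP i n) => [lei|lt]; last by rewrite nth_default // (leq_trans le).
  have := coef_poly n.+1 (fun i => p`_(n - i)) (n - i).
  by rewrite r0 coef0 ltnS leq_subr subKn.
rewrite (evE _ _ le) (@evE _ _ _ _ n.+1) ?size_poly //.
rewrite mulr_suml [RHS](reindex_inj rev_ord_inj) /=; apply: eq_bigr => i _.
move: (leq_ord i); move: (nat_of_ord i) => {}i lei.
rewrite subSS coef_poly ltnS lei -mulrA; congr (_ * _).
have e : t ^+ n = t ^+ (n - i) * t ^+ i by rewrite -exprD subnK.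
by rewrite !exprVn e invfM mulrA mulfV ?mul1r ?expf_neq0.
Qed.

Lemma dependentV (t : F) n : t != 0 -> dependent iF t n -> dependent iF t^-1 n.
Proof.
move=> t0 dep f; have [p [[i0 hi0] e]] := dep f.
pose N := (\max_i size (p i))%N.
have szp i : (size (p i) <= N.+1)%N by apply/leqW/(leq_bigmax i).
pose r i := projT1 (cid (ev_rev t0 (szp i))).
have rP i : (r i = 0 -> p i = 0) /\
    ev iF t^-1 (r i) = ev iF t (p i) * t^-1 ^+ N.
  exact: (projT2 (cid (ev_rev t0 (szp i)))).
exists r; split; first by exists i0; apply: contra_neq hi0; case: (rP i0).
transitivity ((\sum_i ev iF t (p i) * f i) * t^-1 ^+ N); last by rewrite e mul0r.
rewrite mulr_suml; apply: eq_bigr => i _.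
by have [_ ->] := rP i; rewrite mulrAC.
Qed.
End Reverse.

(** * Orders at a place and integrality over k[t] *)

Section Places.
Variables (k : finFieldType) (F : fieldType) (iF : {rmorphism k -> F}).
Implicit Types (P Q : place iF) (x y t : F).

Lemma val_atV P x : P x^-1 = - P x.
Proof.
have [->|x0] := eqVneq x 0; first by rewrite invr0 val_at0 oppr0.
by apply/eqP; rewrite -addr_eq0 -val_atM ?invr_eq0 // mulVf // val_at1.
Qed.
Lemma val_atX P x m : P (x ^+ m) = P x *+ m.
Proof.
have [->|x0] := eqVneq x 0.
  by case: m => [|m]; rewrite ?expr0 ?val_at1 // expr0n val_at0 mul0rn.
elim: m => [|m IH]; first by rewrite expr0 val_at1.
by rewrite exprS val_atM ?expf_neq0 // IH mulrS.
Qed.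
Lemma val_atF P x y : x != 0 -> y != 0 -> P (x / y) = P x - P y.
Proof. by move=> x0 y0; rewrite val_atM ?invr_eq0 // val_atV. Qed.

Lemma order_geD P n x y :
  order_ge P n x -> order_ge P n y -> order_ge P n (x + y).
Proof. exact: (@filD _ (place_filtration P)). Qed.
Lemma order_ge_sum P n (I : Type) (r : seq I) (Q : pred I) (G : I -> F) :
  (forall i, Q i -> order_ge P n (G i)) -> order_ge P n (\sum_(i <- r | Q i) G i).
Proof.
by move=> h; apply: big_ind => //; [exact: order_ge0|exact: order_geD].
Qed.
Lemma order_ge_const P c : order_ge P 0 (iF c).
Proof. by right; rewrite val_at_const. Qed.
Lemma order_geX P n x m : order_ge P n x -> order_ge P (n *+ m) (x ^+ m).
Proof.
move=> h; elim: m => [|m IH]; first by rewrite expr0; exact: order_ge1.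
by rewrite exprS mulrS; exact: order_geM.
Qed.
Lemma order_ge_neq0 P n x : x != 0 -> order_ge P n x <-> n <= P x.
Proof.
by move=> x0; split=> [[e|//]|h]; [rewrite e eqxx in x0|right].
Qed.
Lemma not_order_ge P n x : ~ order_ge P n x -> x != 0 /\ P x < n.
Proof.
move=> h; split; first by apply/eqP => e; apply: h; left.
by rewrite ltNge; apply/negP => le; apply: h; right.
Qed.
(** The equality case of the ultrametric inequality. Relations are refuted below by exhibiting a
    term that dominates all the others at some place. *)
Lemma val_at_dominant P x y : x != 0 -> order_ge P (P x + 1) y ->
  x + y != 0 /\ P (x + y) = P x.
Proof.
move=> x0 hy.
have n1 : ~ order_ge P (P x + 1) x by rewrite order_ge_neq0 //; lia.
have n2 : ~ order_ge P (P x + 1) (x + y).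
  by move=> h; apply: n1; have := order_geB h hy; rewrite addrK.
have [s0 lt] := not_order_ge n2; split=> //.
have /(order_ge_neq0 _ _ s0) : order_ge P (P x) (x + y).
  apply: order_geD; first by right.
  by apply: order_geS hy; lia.
by lia.
Qed.

Lemma order_ge_ev P t (p : {poly k}) :
  order_ge P 0 t -> order_ge P 0 (ev iF t p).
Proof.
move=> ht; rewrite (evE _ _ (leqnn _)); apply: order_ge_sum => i _.
rewrite -[0]addr0; apply: order_geM; first exact: order_ge_const.
by have := order_geX i ht; rewrite mul0rn.
Qed.
Lemma order_ge_ev_pole P t (p : {poly k}) m : P t < 0 -> (size p <= m)%N ->
  order_ge P (P t *+ m) (ev iF t p).
Proof.
move=> ht le; rewrite (evE _ _ le); apply: order_ge_sum => i _.
rewrite -[_ *+ m]add0r; apply: order_geM; first exact: order_ge_const.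
by right; rewrite val_atX !int_mulrn; have := ltn_ord i; nia.
Qed.

(** When t has positive order, the constant term of a polynomial vanishing at t is a multiple of t,
    hence has positive order and is 0; then divide by t. A pole reduces to this case by passing to
    1/t. *)
Lemma val_at_transcendental P t : t != 0 -> P t != 0 -> transcendental iF t.
Proof.
wlog ht : t / 0 < P t.
  move=> H t0 Pt; case: (ltgtP (P t) 0) => [lt|gt|e]; last by rewrite e in Pt.
    have tr : transcendental iF t^-1.
      by apply: H; rewrite ?invr_eq0 // val_atV ?oppr_eq0 // oppr_gt0.
    move=> p e; have [r [rp er]] := ev_rev iF t0 (leqSpred (size p)).
    by apply/rp/tr; rewrite er e mul0r.
  exact: H.
move=> t0 _ p; elim/poly_ind: p => [//|p c IH].
rewrite evD evM evX evC => e.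
have [c0|c0] := eqVneq c 0.
  move: e; rewrite c0 rmorph0 addr0 => /eqP.
  by rewrite mulf_eq0 (negPf t0) orbF => /eqP /IH ->; rewrite mul0r addr0.
have : order_ge P 1 (iF c).
  have -> : iF c = 0 - ev iF t p * t by rewrite -e; ring.
  apply: order_geB; first exact: order_ge0.
  rewrite -[1]add0r; apply: order_geM; first by apply: order_ge_ev; right; lia.
  by right; lia.
by rewrite order_ge_neq0 ?fmorph_eq0 // val_at_const.
Qed.

Definition integral_over (t w : F) : Prop := exists m (q : nat -> {poly k}),
  w ^+ m = \sum_(i < m) ev iF t (q i) * w ^+ i.

(** Take a relation between powers of f, with g its leading coefficient and i its degree.
    Multiplying it by g^(i-1) gives a monic equation for g f. *)
Lemma integral_multiple t n : transcendental iF t -> dependent iF t n ->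
  forall f, exists g, ev iF t g != 0 /\ integral_over t (ev iF t g * f).
Proof.
move=> ttr dep f; have [p [[i0 hi0] e]] := dep (fun i => f ^+ i).
have [i hi himax] := @arg_maxnP _ i0 (fun i => p i != 0) val hi0.
pose r j := oapp p 0 (insub j).
have rE (j : 'I_n) : r j = p j by rewrite /r valK.
have {}e : \sum_(j < i.+1) ev iF t (r j) * f ^+ j = 0.
  rewrite -[RHS]e (big_ord_widen n (fun j => ev iF t (r j) * f ^+ j)) //.
  rewrite big_mkcond /=; apply: eq_bigr => j _; rewrite rE.
  case: ifP => // /negbT lt; rewrite -leqNgt in lt.
  have [->|/himax le] := eqVneq (p j) 0; first by rewrite ev0 mul0r.
  by have := leq_trans lt le; rewrite ltnn.
have g0 : ev iF t (p i) != 0 by apply: contra_neq hi; exact: ttr.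
exists (p i); split=> //; set g := p i in g0 *.
exists i, (fun j => - (r j * g ^+ (i.-1 - j))).
move: e; rewrite big_ord_recr /= rE -/g.
case: {himax}(nat_of_ord i) => [|m].
  by rewrite big_ord0 add0r expr0 mulr1 => /eqP; rewrite (negPf g0).
rewrite addrC => /eqP; rewrite addr_eq0 => /eqP e.
transitivity (ev iF t g ^+ m * (ev iF t g * f ^+ m.+1)).
  by rewrite exprMn mulrA -exprSr.
rewrite e mulrN mulr_sumr -sumrN; apply: eq_bigr => j _.
move: (leq_ord j); move: (nat_of_ord j) => {}j le.
by rewrite evN evM ev_exp exprMn -[in LHS](subnK le) exprD; ring.
Qed.

(** If w had order less than n, then w^m would have a worse pole than every term on the right. *)
Lemma integral_order_ge P t w n m (q : nat -> {poly k}) : n <= 0 ->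
  w ^+ m = \sum_(i < m) ev iF t (q i) * w ^+ i ->
  (forall i, (i < m)%N -> order_ge P n (ev iF t (q i))) -> order_ge P n w.
Proof.
move=> n0 e hq; apply: contrapT => /not_order_ge [w0 lt].
case: m e hq => [|m] e hq.
  by move/eqP: e; rewrite expr0 big_ord0 oner_eq0.
have : order_ge P (n + P w *+ m) (w ^+ m.+1).
  rewrite e; apply: order_ge_sum => i _.
  apply: (@order_geS _ _ _ _ _ (n + P w *+ i)).
    by rewrite !int_mulrn; have := ltn_ord i; nia.
  apply: order_geM; first exact: hq.
  by right; rewrite val_atX.
rewrite order_ge_neq0 ?expf_neq0 // val_atX mulrS; lia.
Qed.

Lemma integral_regular P t w :
  integral_over t w -> order_ge P 0 t -> order_ge P 0 w.
Proof.
move=> [m [q e]] ht; apply: (integral_order_ge (lexx _) e) => i _.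
exact: order_ge_ev.
Qed.

(** The point is that C is the same for all poles of t: the sizes of the coefficients of the
    equation bound it. *)
Lemma integral_pole_bound t w : integral_over t w ->
  exists C, forall P, P t < 0 -> order_ge P (P t *+ C) w.
Proof.
move=> [m [q e]]; exists (\max_(i < m) size (q i)) => P ht.
apply: (integral_order_ge _ e) => [|i lt]; first by rewrite int_mulrn; nia.
apply: order_ge_ev_pole => //.
exact: (leq_bigmax (F := fun i : 'I_m => size (q i)) (Ordinal lt)).
Qed.
End Places.

(** * Existence of places *)

(* A maximal subring containing k[t] but not 1/t is a valuation ring. As F is *)
(* finite over k(t), a power f^N with N > 0 fixed is a unit of it times t^j,  *)
(* which defines the valuation of f up to normalisation.                      *)
Section ExistencePlace.
Variables (k : finFieldType) (F : fieldType) (iF : {rmorphism k -> F}).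
Variables (t : F) (ttr : transcendental iF t).

Lemma transcendental_neq0 : t != 0.
Proof.
apply/eqP => t0; have : ev iF t 'X = 0 by rewrite evX.
by move/ttr/eqP; rewrite polyX_eq0.
Qed.
Let t0 := transcendental_neq0.

Let good (S : set F) : Prop :=
  [/\ forall c, S (iF c), S t, forall x y, S x -> S y -> S (x + y),
      forall x y, S x -> S y -> S (x * y) & ~ S t^-1].

Let good_poly : good [set x | exists p, x = ev iF t p]%classic.
Proof.
split=> [c||x y [p ->] [r ->]|x y [p ->] [r ->]|].
- by exists c%:P; rewrite evC.
- by exists 'X; rewrite evX.
- by exists (p + r); rewrite evD.
- by exists (p * r); rewrite evM.
move=> [p e].
have /ttr /eqP : ev iF t (p * 'X - 1) = 0.
  by rewrite evB evM evX ev1 -e mulVf ?subrr.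
rewrite subr_eq0 => /eqP /(congr1 (fun r : {poly k} => size r)).
rewrite size_poly1; have [->|p0] := eqVneq p 0; first by rewrite mul0r size_poly0.
by rewrite size_mulX // => -[] /eqP; rewrite size_poly_eq0 (negPf p0).
Qed.

Let maximal_good : exists S, good S /\
  forall S' : set F, good S' -> (S `<=` S')%classic -> (S' `<=` S)%classic.
Proof.
have [C hC tot|S [hS smax]] := @Zorn_bigcup F (fun S => S = set0 \/ good S).
  have [[S0 [CS0 gS0]]|hn] := pselect (exists S, C S /\ good S); last first.
    left; apply/seteqP; split=> // x [S CS Sx].
    case: (hC S CS) => [e|g]; first by rewrite e in Sx.
    by apply: hn; exists S.
  have gd S x : C S -> S x -> good S.
    by move=> /hC [->|].
  have common x y : (\bigcup_(X in C) X)%classic x ->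
      (\bigcup_(X in C) X)%classic y -> exists S, [/\ C S, S x & S y].
    move=> [S CS Sx] [S' CS' Sy]; have [le|le] := tot _ _ CS CS'.
      by exists S'; split=> //; exact: le.
    by exists S; split=> //; exact: le.
  case: (gS0) => h1 h2 _ _ _; right; split=> [c||x y hx hy|x y hx hy|[S CS Sx]].
  - by exists S0.
  - by exists S0.
  - have [S [CS Sx Sy]] := common _ _ hx hy; exists S => //.
    by case: (gd _ _ CS Sx) => _ _ h _ _; exact: h.
  - have [S [CS Sx Sy]] := common _ _ hx hy; exists S => //.
    by case: (gd _ _ CS Sx) => _ _ _ h _; exact: h.
  by case: (gd _ _ CS Sx).
have gS : good S.
  case: hS => // S0; exfalso.
  apply: (smax [set x | exists p, x = ev iF t p]%classic); last by right.
  rewrite S0; split=> // h; have := h (ev iF t 0); apply.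
  by exists 0.
exists S; split=> // S' gS' le; apply: contrapT => nle.
by apply: (smax S'); [split|right].
Qed.

Section Maximal.
Variable S : set F.
Hypothesis gS : good S.
Hypothesis Smax :
  forall S' : set F, good S' -> (S `<=` S')%classic -> (S' `<=` S)%classic.

Let Sc c : S (iF c). Proof. by case: gS. Qed.
Let St : S t. Proof. by case: gS. Qed.
Let SD x y : S x -> S y -> S (x + y). Proof. by case: gS => _ _ h _ _; exact: h. Qed.
Let SM x y : S x -> S y -> S (x * y). Proof. by case: gS => _ _ _ h _; exact: h. Qed.
Let StV : ~ S t^-1. Proof. by case: gS. Qed.
Let S1 : S 1. Proof. by rewrite -(rmorph1 iF). Qed.
Let S0 : S 0. Proof. by rewrite -(rmorph0 iF). Qed.
Let SN x : S x -> S (- x).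
Proof. by move=> hx; rewrite -mulN1r; apply: SM => //; rewrite -(rmorphN1 iF). Qed.
Let SB x y : S x -> S y -> S (x - y).
Proof. by move=> hx hy; apply: SD => //; exact: SN. Qed.
Let SX x n : S x -> S (x ^+ n).
Proof.
by move=> hx; elim: n => [|n IH]; rewrite ?expr0 // exprS; exact: SM.
Qed.
Let S_sum (I : Type) (r : seq I) (Q : pred I) (G : I -> F) :
  (forall i, Q i -> S (G i)) -> S (\sum_(i <- r | Q i) G i).
Proof. by move=> h; apply: big_ind. Qed.

(** Every power of u = 1 + t s has the form 1 + t s'. If 1/t = a / u^m then t a = 1 + t s', so 1/t =
    a - s' would lie in S. Inverting u thus keeps 1/t out, and maximality puts the inverse of u in
    S. *)
Let unit_near1 s : S s -> 1 + t * s != 0 /\ S (1 + t * s)^-1.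
Proof.
move=> hs; set u := 1 + t * s.
have u0 : u != 0.
  apply/eqP => e; apply: StV.
  have -> : t^-1 = - s; last exact: SN.
  apply: (mulfI t0); rewrite mulfV //.
  by apply/eqP; rewrite -subr_eq0 mulrN opprK -/u e.
have Su : S u by apply: SD => //; exact: SM.
split=> //.
have upow m : exists2 s', S s' & u ^+ m = 1 + t * s'.
  elim: m => [|m [s' hs' e]]; first by exists 0; rewrite ?mulr0 ?addr0.
  exists (s + s' * u); first by apply: SD => //; exact: SM.
  by rewrite exprSr e /u; ring.
apply: (Smax (S' := [set x | exists2 a, S a & exists m, x = a / u ^+ m]%classic)).
- split=> [c||x y [a ha [m ->]] [b hb [m' ->]]|x y [a ha [m ->]] [b hb [m' ->]]|].
  + by exists (iF c) => //; exists 0; rewrite expr0 divr1.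
  + by exists t => //; exists 0; rewrite expr0 divr1.
  + exists (a * u ^+ m' + b * u ^+ m).
      by apply: SD; apply: SM => //; exact: SX.
    by exists (m + m')%N; rewrite exprD; field; rewrite !expf_neq0.
  + exists (a * b); first exact: SM.
    by exists (m + m')%N; rewrite exprD; field; rewrite !expf_neq0.
  move=> [a ha [m e]]; have [s' hs' e'] := upow m; apply: StV.
  have -> : t^-1 = a - s'; last exact: SB.
  apply: (mulfI t0); rewrite mulfV // mulrBr.
  have -> : t * a = u ^+ m.
    by rewrite -[a](divfK (expf_neq0 m u0)) -e mulrA mulfV // mul1r.
  by rewrite e'; ring.
- by move=> x hx; exists x => //; exists 0; rewrite expr0 divr1.
by exists 1 => //; exists 1; rewrite expr1 mul1r.
Qed.

Let rel (x : F) (n : nat) : Prop := exists p : {poly F},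
  [/\ (size p <= n)%N, forall i, S p`_i & p.[x] = t^-1].

(** Otherwise S[x] would still avoid 1/t, against maximality. *)
Let rel_outside x : ~ S x -> exists n, rel x n.
Proof.
move=> nSx; apply: contrapT => /forallNP hn; apply: nSx.
apply: (Smax (S' := [set y | exists2 p : {poly F}, (forall i, S p`_i) & y = p.[x]]%classic)).
- split=> [c||y z [p hp ->] [r hr ->]|y z [p hp ->] [r hr ->]|].
  + exists (iF c)%:P => [i|]; last by rewrite hornerC.
    by rewrite coefC; case: ifP.
  + exists t%:P => [i|]; last by rewrite hornerC.
    by rewrite coefC; case: ifP.
  + exists (p + r) => [i|]; last by rewrite hornerD.
    by rewrite coefD; exact: SD.
  + exists (p * r) => [i|]; last by rewrite hornerM.
    by rewrite coefM; apply: S_sum => j _; exact: SM.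
  by move=> [p hp e]; apply: (hn (size p)); exists p.
- move=> y hy; exists y%:P => [i|]; last by rewrite hornerC.
  by rewrite coefC; case: ifP.
exists 'X => [i|]; last by rewrite hornerX.
by rewrite coefX; case: eqP.
Qed.

(** The key step of Chevalley's theorem. The relation for 1/x reads u = t (b_1 x^-1 + ... + b_m
    x^-m) with u = 1 - t b_0 a unit of S, so the top term p_n x^n of the relation for x can be
    rewritten with smaller powers of x. *)
Let rel_descent x n m : x != 0 -> (m <= n)%N ->
  rel x n.+1 -> rel x^-1 m.+1 -> rel x n.
Proof.
move=> x0 le [p [szp Sp ep]] [b [szb Sb eb]].
have [u0 SuV] := unit_near1 (SN (Sb 0)); set u := 1 + _ in u0 SuV.
have eu : u = t * \sum_(j < m) b`_j.+1 * x^-1 ^+ j.+1.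
  have : t * t^-1 = 1 by rewrite mulfV.
  rewrite -eb (horner_coef_wide _ szb) big_ord_recl /= expr0 mulr1 mulrDr.
  by rewrite /u => <-; rewrite mulrN addrAC addrN add0r; congr (t * _).
pose c := p`_n * t / u.
have Sc' : S c by apply: SM => //; apply: SM.
exists (\poly_(i < n) p`_i + \sum_(j < m) (c * b`_j.+1) *: 'X^(n - j.+1)).
split=> [|i|].
- apply: leq_trans (size_polyD _ _) _; rewrite geq_max size_poly /=.
  apply: leq_trans (size_sum _ _ _) _; apply/bigmax_leqP => j _.
  apply: leq_trans (size_scale_leq _ _) _; rewrite size_polyXn.
  by have := ltn_ord j; lia.
- rewrite coefD coef_poly coef_sum; apply: SD; first by case: ifP.
  apply: S_sum => j _; rewrite coefZ coefXn; apply: SM; first exact: SM.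
  by case: eqP.
rewrite hornerD -ep (horner_coef_wide _ szp) big_ord_recr /=.
rewrite (@horner_coef_wide _ n) ?size_poly //; congr (_ + _).
  by apply: eq_bigr => i _; rewrite coef_poly ltn_ord.
rewrite horner_sum.
transitivity (c * x ^+ n * \sum_(j < m) b`_j.+1 * x^-1 ^+ j.+1).
  rewrite mulr_sumr; apply: eq_bigr => j _; rewrite hornerZ hornerXn.
  have lej : (j.+1 <= n)%N by exact: leq_trans (ltn_ord j) le.
  rewrite -[in RHS](subnK lej) exprD exprVn; field.
  by rewrite expf_neq0.
move: (\sum_(j < m) _) eu => w eu.
have -> : c * x ^+ n * w = p`_n * x ^+ n * (t * w / u) by rewrite /c; ring.
by rewrite -eu mulfV // mulr1.
Qed.

(** If neither lies in S, both satisfy a relation; the descent lowers the longer of the two until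
    one is empty, which would give 1/t = 0. *)
Let valuation_ring x : S x \/ S x^-1.
Proof.
apply: contrapT => /not_orP [nx nxV].
have x0 : x != 0 by apply/eqP => e; apply: nx; rewrite e.
have [n hn] := rel_outside nx; have [m hm] := rel_outside nxV.
have n0 y : rel y 0 -> False.
  move=> [p [+ _]]; rewrite leqn0 size_poly_eq0 => /eqP ->.
  by rewrite horner0 => e; move/eqP: t0; apply; rewrite -[t]invrK -e invr0.
move: {-1}(n + m)%N (leqnn (n + m)) => N.
elim: N n m hn hm => [|N IH] [|n] [|m] hn hm le //;
  try by [exact: n0 hn|exact: n0 hm].
case: (leqP m n) => lt.
  have le' : (n + m.+1 <= N)%N by move: le; rewrite addSn.
  exact: (IH n m.+1 (rel_descent x0 lt hn hm) hm le').
have le' : (n.+1 + m <= N)%N by move: le; rewrite addnS.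
apply: (IH n.+1 m hn _ le'); apply: (rel_descent (m := n)) => //.
- by rewrite invr_eq0.
- exact: ltnW.
- by rewrite invrK.
Qed.

Let U (x : F) : Prop := [/\ x != 0, S x & S x^-1].
Let U1 : U 1. Proof. by split; rewrite ?oner_eq0 ?invr1. Qed.
Let UM x y : U x -> U y -> U (x * y).
Proof.
by move=> [x0 h h'] [y0 i i']; split; rewrite ?mulf_neq0 // ?invfM; exact: SM.
Qed.
Let UV x : U x -> U x^-1.
Proof. by move=> [x0 h h']; split; rewrite ?invr_eq0 ?invrK. Qed.
Let UX x n : U x -> U (x ^+ n).
Proof.
by move=> h; elim: n => [|n IH]; rewrite ?expr0 // exprS; exact: UM.
Qed.

Let nonunitD x y : S x -> S y -> ~ U x -> ~ U y -> ~ U (x + y).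
Proof.
have aux a b : S a -> S b -> a != 0 -> S (b / a) -> ~ U a -> ~ U (a + b).
  move=> ha hb a0 hba nU [ab0 hab habV]; apply: nU; split=> //.
  have -> : a^-1 = (1 + b / a) / (a + b) by field; rewrite ?a0 ?ab0.
  by apply: SM => //; apply: SD.
move=> hx hy nx ny; have [->|x0] := eqVneq x 0; first by rewrite add0r.
have [->|y0] := eqVneq y 0; first by rewrite addr0.
have [h|h] := valuation_ring (y / x); first exact: aux.
by rewrite addrC; apply: aux => //; move: h; rewrite invfM invrK mulrC.
Qed.

Let dominant_term (I : finType) (f : I -> F) i0 : f i0 != 0 ->
  exists i, f i != 0 /\ forall j, S (f j / f i).
Proof.
move=> h0.
have [i [hi hmax]] : exists i, f i != 0 /\
    forall j, j \in enum I -> S (f j / f i).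
  elim: (enum I) => [|a s [i [hi hmax]]]; first by exists i0.
  have [h|h] := valuation_ring (f a / f i).
    exists i; split=> // j; rewrite inE => /orP[/eqP ->//|]; exact: hmax.
  have [fa|fa] := eqVneq (f a) 0.
    exists i; split=> // j; rewrite inE => /orP[/eqP ->|]; last exact: hmax.
    by rewrite fa mul0r.
  exists a; split=> // j; rewrite inE => /orP[/eqP ->|hj].
    by rewrite mulfV.
  have -> : f j / f a = (f j / f i) * (f a / f i)^-1 by field; rewrite hi fa.
  by apply: SM => //; exact: hmax.
by exists i; split=> // j; apply: hmax; rewrite mem_enum.
Qed.

(** Divide by a term that divides all the others in S. If no other quotient were a unit, their sum
    would be a non-unit, S being local, whereas it equals -1. *)
Let two_dominant_terms (I : finType) (f : I -> F) i0 : f i0 != 0 ->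
  \sum_i f i = 0 -> exists i j, i != j /\ U (f j / f i) /\ f i != 0.
Proof.
move=> h0 e; have [i [hi hmax]] := dominant_term h0.
apply: contrapT => hn.
have nU : ~ U (\sum_(j | j != i) f j / f i) /\ S (\sum_(j | j != i) f j / f i).
  apply: (big_ind (fun x => ~ U x /\ S x)) => [|x y [nx sx] [ny sy]|j nij].
  - by split=> // -[]; rewrite eqxx.
  - by split; [exact: nonunitD|exact: SD].
  by split=> // Uj; apply: hn; exists i, j; rewrite eq_sym.
case: nU => + _; apply.
have -> : \sum_(j | j != i) f j / f i = -1.
  rewrite -mulr_suml; apply: (mulIf hi); rewrite divfK // mulN1r.
  by move: e; rewrite (bigD1 i) //= addrC => /eqP; rewrite addr_eq0 => /eqP.
by split; rewrite ?oppr_eq0 ?oner_eq0 // ?invrN ?invr1; exact: SN.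
Qed.

(** Once the powers of t are stripped, the constant term c is nonzero and the value is c (1 + t s)
    with s in S. *)
Let unit_ev (p : {poly k}) : p != 0 -> exists a, U (ev iF t p / t ^+ a).
Proof.
elim/poly_ind: p => [|p c IH]; first by rewrite eqxx.
have [->|c0] := eqVneq c 0.
  rewrite addr0 mulf_eq0 polyX_eq0 orbF => /IH [a Ua]; exists a.+1.
  by rewrite evM evX exprSr invfM mulrACA mulfV ?mulr1.
move=> _; exists 0; rewrite expr0 divr1 evD evM evX evC.
have c0' : iF c != 0 by rewrite fmorph_eq0.
have -> : ev iF t p * t + iF c = iF c * (1 + t * (iF c^-1 * ev iF t p)).
  by rewrite fmorphV; field.
have Sp : S (ev iF t p).
  rewrite (evE _ _ (leqnn _)); apply: S_sum => i _.
  by apply: SM => //; exact: SX.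
have Ss : S (iF c^-1 * ev iF t p) by apply: SM.
have [u0 uV] := unit_near1 Ss.
apply: UM; split=> //; first by rewrite -fmorphV.
by apply: SD => //; apply: SM.
Qed.

Section Value.
Variables (n : nat) (dep : dependent iF t n).


(** In a relation between 1, f, ..., f^(n-1) over k[t], two terms have a unit ratio. As each nonzero
    p(t) is a unit times a power of t, some f^(m-l) with l < m < n is a unit times a power of t, and
    m - l divides n!. *)
Let value_exists f : f != 0 -> exists j : int, U (f ^+ n`! * t ^ (- j)).
Proof.
move=> f0; have [p [[i0 hi0] e]] := dep (fun i => f ^+ i).
have g0 i : (ev iF t (p i) * f ^+ i != 0) = (p i != 0).
  rewrite mulf_eq0 negb_or expf_neq0 // andbT; apply/idP/idP.
    by apply: contra_neq => ->; rewrite ev0.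
  by apply: contra_neq; exact: ttr.
have h0 : ev iF t (p i0) * f ^+ i0 != 0 by rewrite g0.
have [i [j [nij [Uij fi]]]] := two_dominant_terms h0 e.
have fj : ev iF t (p j) * f ^+ j != 0.
  by case: Uij => + _ _; rewrite mulf_eq0 => /norP[].
have [a Ua] := unit_ev (etrans (esym (g0 i)) fi).
have [b Ub] := unit_ev (etrans (esym (g0 j)) fj).
have main (l m : nat) (z : int) : (l < m)%N -> (m < n)%N ->
    U (f ^+ m / f ^+ l * t ^ z) -> exists j : int, U (f ^+ n`! * t ^ (- j)).
  move=> lm mn h; have /dvdnP [c ec] : (m - l %| n`!)%N.
    by apply: dvdn_fact; lia.
  exists (- (z * c%:Z)); rewrite opprK ec mulnC exprM -exprz_exp.
  rewrite -exprnP -exprMn; apply: UX.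
  have -> : f ^+ (m - l) = f ^+ m / f ^+ l; last by [].
  by apply: (mulIf (expf_neq0 l f0)); rewrite divfK ?expf_neq0 // -exprD subnK // ltnW.
have key : U (f ^+ j / f ^+ i * t ^ (b%:Z - a%:Z)).
  have -> : f ^+ j / f ^+ i * t ^ (b%:Z - a%:Z) =
      (ev iF t (p j) * f ^+ j / (ev iF t (p i) * f ^+ i)) *
      (ev iF t (p i) / t ^+ a) * (ev iF t (p j) / t ^+ b)^-1.
    rewrite expfzDr // -invr_expz -!exprnP; field.
    move: fi fj; rewrite !mulf_eq0 !negb_or => /andP[hi hi'] /andP[hj hj'].
    by rewrite ?hi ?hj ?hi' ?hj' ?expf_neq0.
  by apply: UM; [apply: UM|apply: UV].
case: (ltngtP i j) nij => [lt _|lt _|/val_inj ->]; last by rewrite eqxx.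
  exact: main lt (ltn_ord _) key.
apply: (main _ _ (- (b%:Z - a%:Z)) lt (ltn_ord _)).
have := UV key; rewrite invfM invr_expz; congr U; congr (_ * _).
by rewrite invfM invrK mulrC.
Qed.

Let w (f : F) : int :=
  if pselect (f != 0) is left h then projT1 (cid (value_exists h)) else 0.
Let wP f : f != 0 -> U (f ^+ n`! * t ^ (- w f)).
Proof.
move=> h; rewrite /w; case: pselect => // h'.
exact: (projT2 (cid (value_exists h'))).
Qed.
Let tXz0 (j : int) : t ^ j != 0. Proof. exact: expfz_neq0. Qed.

Let S_tX (j : int) : S (t ^ j) -> 0 <= j.
Proof.
case: j => // j; rewrite NegzE -exprnN => h; exfalso; apply: StV.
have -> : t^-1 = t ^+ j * t ^- j.+1.
  by rewrite exprSr invfM mulrA mulfV ?mul1r ?expf_neq0.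
by apply: SM => //; exact: SX.
Qed.
Let U_tX (j : int) : U (t ^ j) -> j = 0.
Proof.
move=> [_ h]; rewrite invr_expz => h'; have := S_tX h; have := S_tX h'; lia.
Qed.
Let wE f j : f != 0 -> U (f ^+ n`! * t ^ (- j)) -> w f = j.
Proof.
move=> f0 h; apply/eqP; rewrite -subr_eq0; apply/eqP; apply: U_tX.
have -> : t ^ (w f - j) = (f ^+ n`! * t ^ (- j)) * (f ^+ n`! * t ^ (- w f))^-1.
  rewrite expfzDr // -!invr_expz; field; by rewrite expf_neq0 // !tXz0.
by apply: UM => //; apply: UV; exact: wP.
Qed.
Let wM x y : x != 0 -> y != 0 -> w (x * y) = w x + w y.
Proof.
move=> x0 y0; apply: wE; first exact: mulf_neq0.
rewrite opprD expfzDr // exprMn mulrACA; exact: UM (wP x0) (wP y0).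
Qed.
Let w_ge0 x : x != 0 -> S x -> 0 <= w x.
Proof.
move=> x0 hx; apply: S_tX.
have -> : t ^ w x = x ^+ n`! * (x ^+ n`! * t ^ (- w x))^-1.
  by rewrite -invr_expz; field; rewrite expf_neq0 // tXz0.
by apply: SM; [exact: SX|case: (wP x0)].
Qed.
Let wV x : x != 0 -> w x^-1 = - w x.
Proof.
move=> x0; apply/eqP; rewrite -addr_eq0 -wM ?invr_eq0 // mulVf //.
by apply/eqP; apply: wE; rewrite ?oner_eq0 // oppr0 expr0z expr1n mulr1.
Qed.
Let w_const c : w (iF c) = 0.
Proof.
have [->|c0] := eqVneq c 0.
  by rewrite rmorph0 /w; case: pselect => // h; exfalso; rewrite eqxx in h.
have c0' : iF c != 0 by rewrite fmorph_eq0.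
apply: wE => //; rewrite oppr0 expr0z mulr1; apply: UX.
by split=> //; rewrite -fmorphV.
Qed.
Let w_t : w t = n`!.
Proof. by apply: wE => //; rewrite -invr_expz -exprnP mulfV ?expf_neq0. Qed.
Let wD x y : x != 0 -> y != 0 -> x + y != 0 -> Num.min (w x) (w y) <= w (x + y).
Proof.
wlog h : x y / S (x / y).
  move=> H x0 y0 xy0; have [h|h] := valuation_ring (x / y); first exact: H.
  by rewrite minC addrC; apply: H; rewrite // ?(addrC y) //;
    move: h; rewrite invfM invrK mulrC.
move=> x0 y0 xy0.
have e : x + y = y * (1 + x / y) by field.
have n0 : 1 + x / y != 0 by apply: contra_neq xy0; rewrite e => ->; rewrite mulr0.
rewrite e wM // ge_min; apply/orP; right; rewrite lerDl.
by apply: w_ge0 => //; exact: SD.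
Qed.

(** The function w is a valuation scaled by an unknown factor. Its least positive value e divides
    all its values, by division with remainder, and w / e is the normalized valuation. *)
Let e_exists : exists m, (0 < m)%N && `[< exists2 x, x != 0 & w x = m%:Z >].
Proof.
by exists n`!; rewrite fact_gt0; apply/asboolP; exists t; rewrite ?w_t.
Qed.
Let e : nat := ex_minn e_exists.
Let eP : [/\ (0 < e)%N, exists2 x, x != 0 & w x = e%:Z &
  forall x, x != 0 -> w x = (w x %/ e)%Z * e%:Z].
Proof.
rewrite /e; case: ex_minnP => m /andP[m0 /asboolP [x x0 hx]] hmin.
split=> //; first by exists x.
have wXz y (j : int) : y != 0 -> w (y ^ j) = j * w y.
  move=> y0; have hX i : w (y ^+ i) = i%:Z * w y.
    elim: i => [|i IH]; first by rewrite expr0 mul0r -(rmorph1 iF) w_const.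
    by rewrite exprS wM ?expf_neq0 // IH intS mulrDl mul1r.
  case: j => j; first exact: hX.
  by rewrite NegzE -exprnN wV ?expf_neq0 // hX mulNr.
move=> y y0; rewrite [LHS](divz_eq _ m%:Z).
suff -> : (w y %% m)%Z = 0 by rewrite addr0.
apply/eqP; apply: contraT => r0.
have m0' : m%:Z != 0 by lia.
have r_ge0 := modz_ge0 (w y) m0'; have r_lt := ltz_mod (w y) m0'.
have : (m <= `|(w y %% m)%Z|)%N.
  apply: hmin; rewrite absz_gt0 r0; apply/asboolP.
  exists (y * x ^ (- (w y %/ m)%Z)); first by rewrite mulf_neq0 ?expfz_neq0.
  rewrite wM ?expfz_neq0 // wXz // hx gez0_abs //.
  by rewrite {1}(divz_eq (w y) m); ring.
by lia.
Qed.

Let val x : int := (w x %/ e)%Z.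
Let valE x : x != 0 -> w x = val x * e%:Z.
Proof. by move=> h; case: eP => _ _ H; exact: H. Qed.
Let e_gt0 : 0 < e%:Z. Proof. by case: eP. Qed.
Let e_neq0 : e%:Z != 0. Proof. by rewrite gt_eqF. Qed.

Let val0 : val 0 = 0.
Proof. by rewrite /val -(rmorph0 iF) w_const div0z. Qed.
Let valM x y : x != 0 -> y != 0 -> val (x * y) = val x + val y.
Proof.
move=> x0 y0; apply: (mulIf e_neq0).
by rewrite -valE ?mulf_neq0 // wM // !valE // mulrDl.
Qed.
Let valD x y : x != 0 -> y != 0 -> x + y != 0 ->
  Num.min (val x) (val y) <= val (x + y).
Proof.
move=> x0 y0 xy0; have := wD x0 y0 xy0.
by rewrite !ge_min (valE x0) (valE y0) (valE xy0) !(ler_pM2r e_gt0).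
Qed.
Let val_const c : val (iF c) = 0.
Proof. by rewrite /val w_const div0z. Qed.
Let val_onto : exists x, x != 0 /\ val x = 1.
Proof.
case: eP => _ [x x0 hx] _; exists x; split=> //; apply: (mulIf e_neq0).
by rewrite -valE // hx mul1r.
Qed.

Lemma place_of_maximal : exists P : place iF, 0 < P t.
Proof.
exists (Place val0 valM valD val_const val_onto) => /=.
by rewrite -(ltr_pM2r e_gt0) mul0r -valE // w_t ltz_nat fact_gt0.
Qed.
End Value.
End Maximal.

Lemma place_exists n : dependent iF t n -> exists P : place iF, 0 < P t.
Proof.
move=> dep; have [S [gS Smax]] := maximal_good.
exact: (place_of_maximal gS Smax dep).
Qed.
End ExistencePlace.

(** * Dimensions of quotients *)

Section QuotientDimension.
Variables (k : finFieldType) (B : pzRingType) (i : {rmorphism k -> B}).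
Implicit Types V W U : B -> Prop.

Definition subspace V : Prop :=
  [/\ V 0, forall x y, V x -> V y -> V (x + y) & forall c x, V x -> V (i c * x)].

Lemma subspaceN V x : subspace V -> V x -> V (- x).
Proof. by move=> [_ _ h] hx; rewrite -mulN1r -(rmorphN1 i); exact: h. Qed.
Lemma subspaceB V x y : subspace V -> V x -> V y -> V (x - y).
Proof.
by move=> hV hx hy; case: (hV) => _ h _; apply: h => //; exact: subspaceN.
Qed.
Lemma subspace_comb V n (c : 'I_n -> k) (e : 'I_n -> B) : subspace V ->
  (forall j, V (e j)) -> V (\sum_j i (c j) * e j).
Proof.
by move=> [h0 hD hZ] he; apply: big_ind => // j _; exact: hZ.
Qed.

Definition independent_mod W n (f : 'I_n -> B) : Prop :=
  forall c : 'I_n -> k, W (\sum_j i (c j) * f j) -> forall j, c j = 0.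

(** An independent family of maximal length is a basis modulo W. *)
Lemma has_quotient_dim_bounded V W n : subspace W ->
  (forall f : 'I_n -> B, (forall j, V (f j)) -> ~ independent_mod W f) ->
  exists2 d, (d < n)%N & has_quotient_dim i V W d.
Proof.
move=> hW hn.
pose Q m := (m <= n)%N && `[< exists e : 'I_m -> B,
  (forall j, V (e j)) /\ independent_mod W e >].
have Q0 : exists m, Q m.
  exists 0; apply/asboolP; exists (fun=> 0).
  by split=> [[]|c _ []].
have Qbound m : Q m -> (m <= n)%N by case/andP.
case: (ex_maxnP Q0 Qbound) => m /andP[lemn /asboolP [e [he ind]]] mmax.
have ltmn : (m < n)%N.
  rewrite ltn_neqAle lemn andbT; apply/eqP => emn.
  by move: e he ind; rewrite emn => e he; exact: hn.
exists m => //; exists e; split=> // x hx.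
have [hW0 hWD hWZ] := hW.
pose f (j : 'I_m.+1) := oapp e x (unlift ord0 j).
have f0 : f ord0 = x by rewrite /f unlift_none.
have fS j : f (lift ord0 j) = e j by rewrite /f liftK.
have nind : ~ independent_mod W f.
  move=> indf; have : (m.+1 <= m)%N.
    apply: mmax; rewrite /Q ltmn; apply/asboolP; exists f; split=> // j.
    by rewrite /f; case: unliftP => [j0 _|_] /=; [exact: he|exact: hx].
  by rewrite ltnn.
have [c hc c0] : exists2 c : 'I_m.+1 -> k,
    W (\sum_j i (c j) * f j) & c ord0 != 0.
  apply: contrapT => hno; apply: nind => c hc.
  have c0 : c ord0 = 0.
    by apply/eqP; apply: contrapT => /negP c0; apply: hno; exists c.
  move=> j; case: (unliftP ord0 j) => [j' ->|-> //].
  apply: (ind (fun j => c (lift ord0 j))).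
  move: hc; rewrite big_ord_recl c0 rmorph0 mul0r add0r; congr W.
  by apply: eq_bigr => l _; rewrite fS.
pose b : {ffun 'I_m -> k} := [ffun j => - (c ord0)^-1 * c (lift ord0 j)].
have hb : W (x - \sum_j i (b j) * e j).
  have := hWZ (c ord0)^-1 _ hc; congr W.
  rewrite big_ord_recl f0 mulrDr mulrA -rmorphM mulVf // rmorph1 mul1r.
  congr (_ + _); rewrite mulr_sumr -sumrN; apply: eq_bigr => j _.
  by rewrite fS ffunE mulNr rmorphN rmorphM mulNr opprK mulrA.
exists b; split=> // b' hb'; apply/ffunP => j.
apply/eqP; rewrite -subr_eq0; apply/eqP.
apply: (ind (fun j => b j - b' j)).
have := subspaceB hW hb' hb; congr W.
rewrite opprB addrC addrA subrK.
by rewrite -sumrB; apply: eq_bigr => l _; rewrite rmorphB mulrBl.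
Qed.

(** By counting, k being finite: the q^(d+1) combinations of the f_j have only q^d coordinate
    vectors, so two of them agree modulo W. *)
Lemma quotient_dim_dependent V W d (f : 'I_d.+1 -> B) : subspace V -> subspace W ->
  has_quotient_dim i V W d -> (forall j, V (f j)) -> ~ independent_mod W f.
Proof.
move=> hV hW [e [he hc]] hf ind.
pose x (c : {ffun 'I_d.+1 -> k}) := \sum_j i (c j) * f j.
have hx c : V (x c) by exact: subspace_comb.
pose code c : {ffun 'I_d -> k} := projT1 (cid (hc _ (hx c))).
have codeP c : W (x c - \sum_j i (code c j) * e j).
  by case: (projT2 (cid (hc _ (hx c)))).
have [|c [c' [neq eqc]]] := @pigeonhole _ _ code.
  by rewrite !card_ffun !card_ord ltn_exp2l ?card_finField_gt1.
move/eqP: neq; apply; apply/ffunP => j; apply/eqP; rewrite -subr_eq0; apply/eqP.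
apply: (ind (fun j => c j - c' j)).
have := subspaceB hW (codeP c) (codeP c'); rewrite eqc; congr W.
rewrite opprB addrA subrK /x -sumrB.
by apply: eq_bigr => l _; rewrite rmorphB mulrBl.
Qed.

Lemma has_quotient_dim_unique V W d d' : subspace V -> subspace W ->
  has_quotient_dim i V W d -> has_quotient_dim i V W d' -> d = d'.
Proof.
move=> hV hW; wlog le : d d' / (d < d')%N.
  move=> H h h'; case: (ltngtP d d') => // lt.
    exact: (H _ _ lt h h').
  by apply/esym; exact: (H _ _ lt h' h).
move=> h [e [he hc]]; exfalso.
apply: (@quotient_dim_dependent V W d (fun j => e (widen_ord le j))) => //.
move=> c hcW j.
pose c' := [ffun l : 'I_d' => oapp c 0 (insub (val l) : option 'I_d.+1)].
have sumc' : \sum_l i (c' l) * e l = \sum_j i (c j) * e (widen_ord le j).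
  rewrite (bigID (fun l : 'I_d' => (l < d.+1)%N)) /= [X in _ + X]big1 ?addr0.
    by rewrite (big_ord_narrow le); apply: eq_bigr => l _; rewrite ffunE /= valK.
  move=> l /negbTE lt; by rewrite ffunE insubF //= rmorph0 mul0r.
have [hW0 hWD _] := hW.
have hV0 : V 0 by case: hV.
have [b [hb buniq]] := hc 0 hV0.
have e1 : b = c'.
  by apply: buniq; rewrite sumc' sub0r; apply: subspaceN.
have e2 : b = [ffun=> 0].
  apply: buniq; rewrite big1 ?subr0 // => l _.
  by rewrite ffunE rmorph0 mul0r.
have : c' (widen_ord le j) = 0 by rewrite -e1 e2 ffunE.
by rewrite ffunE /= valK.
Qed.

Lemma quotient_dimE V W d : subspace V -> subspace W ->
  has_quotient_dim i V W d -> quotient_dim i V W = d.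
Proof.
move=> hV hW h; rewrite /quotient_dim; case: pselect => [h'|[]]; last by exists d.
exact: (has_quotient_dim_unique hV hW (projT2 (cid h')) h).
Qed.

Lemma has_quotient_dim_add V W U d d' : subspace V -> subspace W -> subspace U ->
  (forall x, W x -> V x) -> (forall x, U x -> W x) ->
  has_quotient_dim i V W d -> has_quotient_dim i W U d' ->
  has_quotient_dim i V U (d + d').
Proof.
move=> hV hW hU WV UW [e [he hc]] [e' [he' hc']].
pose f (j : 'I_(d + d')) := match fintype.split j with inl l => e l | inr l => e' l end.
have fl l : f (lshift d' l) = e l by rewrite /f (unsplitK (inl l)).
have fr l : f (rshift d l) = e' l by rewrite /f (unsplitK (inr l)).
have fsum (c : 'I_(d + d') -> k) : \sum_j i (c j) * f j =
    (\sum_j i (c (lshift d' j)) * e j) + \sum_j i (c (rshift d j)) * e' j.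
  by rewrite big_split_ord; congr (_ + _); apply: eq_bigr => l _; rewrite ?fl ?fr.
exists f; split=> [j|x hx].
  by rewrite /f; case: splitP => l _; [exact: he|apply: WV; exact: he'].
have [b [hb bu]] := hc x hx; have [b' [hb' bu']] := hc' _ hb.
exists [ffun j => match fintype.split j with inl l => b l | inr l => b' l end].
split.
  rewrite fsum opprD addrA; move: hb'; congr (U (_ - _ - _)).
    by apply: eq_bigr => l _; rewrite ffunE (unsplitK (inl l)).
  by apply: eq_bigr => l _; rewrite ffunE (unsplitK (inr l)).
move=> c; rewrite fsum opprD addrA => hcU.
pose cl : {ffun 'I_d -> k} := [ffun l => c (lshift d' l)].
pose cr : {ffun 'I_d' -> k} := [ffun l => c (rshift d l)].
have hcl : \sum_j i (c (lshift d' j)) * e j = \sum_j i (cl j) * e j.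
  by apply: eq_bigr => l _; rewrite ffunE.
have hcr : \sum_j i (c (rshift d j)) * e' j = \sum_j i (cr j) * e' j.
  by apply: eq_bigr => l _; rewrite ffunE.
rewrite hcl hcr in hcU.
have ebl : b = cl.
  apply: bu; rewrite -[_ - _](subrK (\sum_j i (cr j) * e' j)).
  case: (hW) => _ hD _; apply: hD; first exact: UW.
  exact: subspace_comb.
have ebr : b' = cr by apply: bu'; rewrite ebl.
apply/ffunP => j; rewrite ffunE ebl ebr; case: splitP => l e0; rewrite ffunE.
  by congr (c _); apply: val_inj.
by congr (c _); apply: val_inj.
Qed.

Lemma has_quotient_dim_sub V W U d : subspace V -> subspace W -> subspace U ->
  (forall x, W x -> V x) -> (forall x, U x -> W x) -> has_quotient_dim i V U d ->
  exists d1 d2, [/\ has_quotient_dim i V W d1, has_quotient_dim i W U d2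
    & d = (d1 + d2)%N].
Proof.
move=> hV hW hU WV UW h.
have [d1 _ h1] : exists2 d1, (d1 < d.+1)%N & has_quotient_dim i V W d1.
  apply: has_quotient_dim_bounded => // f hf ind.
  by apply: (quotient_dim_dependent hV hU h hf) => c /UW; exact: ind.
have [d2 _ h2] : exists2 d2, (d2 < d.+1)%N & has_quotient_dim i W U d2.
  apply: has_quotient_dim_bounded => // f hf ind.
  by apply: (quotient_dim_dependent hV hU h _ ind) => j; exact: WV.
exists d1, d2; split=> //.
by apply: (has_quotient_dim_unique hV hU h); exact: has_quotient_dim_add h1 h2.
Qed.

End QuotientDimension.

Lemma has_quotient_dim_scale (k : finFieldType) (B : comPzRingType)
    (i : {rmorphism k -> B}) (V W V' W' : B -> Prop) (a : B) d :
  (forall x, V' x <-> exists2 y, V y & x = a * y) ->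
  (forall y, V y -> W' (a * y) -> W y) -> (forall y, W y -> W' (a * y)) ->
  subspace i V -> has_quotient_dim i V W d -> has_quotient_dim i V' W' d.
Proof.
move=> hV' hWl hWr hV [e [he hc]]; exists (fun j => a * e j).
have suma c (y : B) : a * y - \sum_j i (c j) * (a * e j) =
    a * (y - \sum_j i (c j) * e j).
  rewrite mulrBr mulr_sumr; congr (_ - _).
  by apply: eq_bigr => j _; rewrite mulrCA.
split=> [j|x /hV' [y hy ->]]; first by apply/hV'; exists (e j).
have [c [hcW cu]] := hc y hy; exists c; split; first by rewrite suma; exact: hWr.
move=> c'; rewrite suma => h; apply: cu.
have h2 : V (y - \sum_j i (c' j) * e j).
  by apply: (subspaceB hV) => //; exact: (subspace_comb _ hV).
exact: hWl h2 h.
Qed.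

(** * Independence modulo multiples of t *)

Section Residual.
Variables (k : finFieldType) (F : fieldType) (iF : {rmorphism k -> F}).
Variables (t : F) (V W : F -> Prop).
Hypotheses (hV : subspace iF V) (Vt : forall x, V x -> V (t * x)).
Hypotheses (hW : subspace iF W) (Wt : forall x, V x -> W (t * x)).

(** In a relation over k[t], the constant coefficients give a combination lying in tV, hence in W,
    so they vanish. Divide by t and repeat. This bounds residual dimensions by the degree over
    k(t). *)
Lemma dependent_independent_mod n (f : 'I_n -> F) : t != 0 -> dependent iF t n ->
  (forall j, V (f j)) -> ~ independent_mod iF W f.
Proof.
move=> t0 dep hf ind; have [p [[j0 hj0] e]] := dep f.
suff H N : forall p : 'I_n -> {poly k}, (forall j, size (p j) <= N)%N ->
    \sum_j ev iF t (p j) * f j = 0 -> forall j, p j = 0.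
  have szp j : (size (p j) <= \max_j size (p j))%N.
    exact: (leq_bigmax (F := fun j => size (p j)) j).
  by move/eqP: hj0; apply; exact: (H _ p szp e j0).
elim: N => [|N IH] {j0 hj0 e}p szp e j.
  by apply/eqP; rewrite -size_poly_eq0 -leqn0.
have Vev (r : {poly k}) x : V x -> V (ev iF t r * x).
  have [V0 VD VZ] := hV; move=> hx; elim/poly_ind: r => [|r c IHr].
    by rewrite ev0 mul0r.
  rewrite evD evM evX evC mulrDl; apply: VD; last exact: VZ.
  by rewrite mulrAC mulrC; exact: Vt.
pose r j := (\poly_(l < N) (p j)`_l.+1 : {poly k}).
have pE j' : p j' = r j' * 'X + ((p j')`_0)%:P.
  apply/polyP => -[|l]; rewrite coefD coefMX coefC /= ?add0r ?addr0 // coef_poly.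
  by case: ltnP => // le; rewrite nth_default // (leq_trans (szp j')).
have {}e : \sum_j iF ((p j)`_0) * f j = - (t * \sum_j ev iF t (r j) * f j).
  apply/eqP; rewrite -addr_eq0 mulr_sumr -big_split /= -[X in _ == X]e.
  apply/eqP; apply: eq_bigr => l _.
  by rewrite [in RHS](pE l) evD evM evX evC; ring.
have c0 : forall j, (p j)`_0 = 0.
  apply: (ind (fun j => (p j)`_0)); rewrite e; apply: (subspaceN hW).
  by apply: Wt; case: (hV) => V0 VD _; apply: big_ind => // l _; exact: Vev.
rewrite pE c0 addr0 (IH r) ?mul0r // => [l|]; first exact: size_poly.
move: e; rewrite big1 => [/esym/eqP|l _]; last by rewrite c0 rmorph0 mul0r.
by rewrite oppr_eq0 mulf_eq0 (negPf t0) => /eqP.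
Qed.
End Residual.

(** * Weak approximation *)

Section WeakApproximation.
Variables (k : finFieldType) (F : fieldType) (iF : {rmorphism k -> F}).
Implicit Types (P Q : place iF) (x y t : F).

Lemma val_atXz P x (m : int) : P (x ^ m) = m * P x.
Proof.
case: m => m; first by rewrite -exprnP val_atX int_mulrn mulrC.
by rewrite NegzE -exprnN val_atV val_atX int_mulrn mulNr mulrC.
Qed.

(** If the valuation ring of Q were contained in that of P, every Q-unit would be a P-unit. Then P
    would be a multiple of Q, and normalization would make them equal. *)
Lemma places_incomparable P Q : P <> Q :> (F -> int) ->
  exists a, [/\ a != 0, P a < 0 & 0 <= Q a].
Proof.
move=> neq; apply: contrapT => hn.
have QP a : a != 0 -> 0 <= Q a -> 0 <= P a.
  by move=> a0 Qa; rewrite leNgt; apply/negP => Pa; apply: hn; exists a.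
have QP0 u : u != 0 -> Q u = 0 -> P u = 0.
  move=> u0 Qu; have h1 : 0 <= P u by apply: QP; rewrite ?Qu.
  have : 0 <= P u^-1 by apply: QP; rewrite ?invr_eq0 // val_atV Qu.
  by rewrite val_atV; lia.
have [pi [pi0 Qpi]] := val_at_onto Q.
have [rho [rho0 Prho]] := val_at_onto P.
have PE x : x != 0 -> P x = Q x * P pi.
  move=> x0; have u0 : x / pi ^ (Q x) != 0.
    by rewrite mulf_neq0 ?invr_eq0 ?expfz_neq0.
  have := QP0 _ u0; rewrite !val_atF ?expfz_neq0 // !val_atXz Qpi mulr1 subrr.
  by move=> /(_ erefl) /eqP; rewrite subr_eq0 => /eqP.
have Ppi : P pi = 1.
  have h := PE _ rho0; rewrite Prho in h.
  have h0 : 0 <= P pi by apply: QP => //; rewrite Qpi.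
  have := congr1 absz h; rewrite abszM => /esym/eqP.
  by rewrite muln_eq1 => /andP[_ /eqP]; lia.
apply: neq; apply/funext => x; have [->|x0] := eqVneq x 0; first by rewrite !val_at0.
by rewrite PE // Ppi mulr1.
Qed.

(** By induction on the number of places: z works for the first m of them, w has a pole at P and a
    zero at the last one. A power z^N outweighs the behaviour of w at the first m, unless z has a
    pole at the last place. *)
Lemma weak_approximation (P : place iF) (Q : nat -> place iF) m :
  (forall i, (i < m)%N -> P <> Q i :> (F -> int)) ->
  exists z, [/\ z != 0, P z < 0 & forall i, (i < m)%N -> 0 < Q i z].
Proof.
elim: m => [|m IH] neq.
  have [pi [pi0 h]] := val_at_onto P; exists pi^-1.
  by split; rewrite ?invr_eq0 // val_atV h.
have [|z [z0 Pz Qz]] := IH; first by move=> i lt; apply: neq; exact: leqW.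
have [w [w0 Pw Qw]] : exists w, [/\ w != 0, P w < 0 & 0 < Q m w].
  have [a [a0 Pa Qa]] := places_incomparable (neq _ (ltnSn m)).
  have [b [b0 Qb Pb]] := places_incomparable (nesym (neq _ (ltnSn m))).
  exists (a / b); rewrite !val_atF // mulf_neq0 ?invr_eq0 //; split=> //; lia.
pose N := (\sum_(i < m) `|Q i w|%N).+1.
have hN i : (i < m)%N -> 0 < Q i z *+ N + Q i w.
  move=> lt; have := Qz i lt; rewrite int_mulrn.
  have : (`|Q i w| < N)%N.
    by rewrite ltnS (bigD1 (Ordinal lt)) //= leq_addr.
  nia.
have caseS (zz : F) : zz != 0 -> P zz < 0 -> (forall i, (i < m)%N -> 0 < Q i zz) ->
    0 < Q m zz -> exists z, [/\ z != 0, P z < 0 & forall i, (i < m.+1)%N -> 0 < Q i z].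
  move=> z1 z2 z3 z4; exists zz; split=> // i.
  by rewrite ltnS leq_eqVlt => /orP[/eqP ->|/z3].
case: (ltgtP 0 (Q m z)) => [gt|lt|e]; first exact: (caseS z).
  (* When z has a pole at the last place, u / (u + 1) has order 0 there and at P, and high order at
     the other places. It therefore corrects w at the latter only. *)
  pose u := z ^+ N; have u0 : u != 0 by rewrite expf_neq0.
  have neg (R : place iF) : R z < 0 -> u + 1 != 0 /\ R (u + 1) = R u.
    move=> Rz; apply: val_at_dominant => //; right.
    by rewrite val_at1 val_atX int_mulrn /N; nia.
  have pos (R : place iF) : 0 < R z -> R (u + 1) = 0.
    move=> Rz; have h : order_ge R (R 1 + 1) u.
      by right; rewrite val_at1 add0r val_atX int_mulrn /N; nia.
    by have [_] := val_at_dominant (oner_neq0 F) h; rewrite addrC val_at1.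
  have [s0 Ps] := neg _ Pz; have [_ Qs] := neg _ lt.
  have q0 : u / (u + 1) != 0 by rewrite mulf_neq0 ?invr_eq0.
  apply: (caseS (u / (u + 1) * w)).
  - by rewrite mulf_neq0.
  - by rewrite val_atM // val_atF // Ps subrr add0r.
  - move=> i lti; rewrite val_atM // val_atF // (pos _ (Qz i lti)) subr0 val_atX.
    exact: hN.
  by rewrite val_atM // val_atF // Qs subrr add0r.
apply: (caseS (z ^+ N * w)).
- by rewrite mulf_neq0 ?expf_neq0.
- by rewrite val_atM ?expf_neq0 // val_atX int_mulrn; nia.
- by move=> i lti; rewrite val_atM ?expf_neq0 // val_atX; exact: hN.
by rewrite val_atM ?expf_neq0 // val_atX -e mul0rn add0r.
Qed.

Lemma val_at_ev_pole P t (p : {poly k}) : t != 0 -> P t < 0 -> p != 0 ->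
  ev iF t p != 0 /\ P (ev iF t p) = P t *+ (size p).-1.
Proof.
move=> t0 Pt p0; pose n := (size p).-1.
have szp : size p = n.+1 by rewrite /n prednK // lt0n size_poly_eq0.
have lc : iF p`_n != 0 by rewrite fmorph_eq0 -[n]/(n.+1.-1) -szp -lead_coefE lead_coef_eq0.
have x0 : iF p`_n * t ^+ n != 0 by rewrite mulf_neq0 ?expf_neq0.
have Px : P (iF p`_n * t ^+ n) = P t *+ n.
  by rewrite val_atM ?expf_neq0 // val_at_const add0r val_atX.
rewrite (@evE _ _ _ _ n.+1) ?szp // big_ord_recr /= addrC -Px.
apply: val_at_dominant => //; rewrite Px; apply: order_ge_sum => i _.
rewrite -[_ + 1]add0r; apply: order_geM; first exact: order_ge_const.
by right; rewrite val_atX !int_mulrn; have := ltn_ord i; nia.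
Qed.

(** Choose z_i with a pole at Q_i and zeros at the other Q_j. In a relation between the z_i over
    k[t], take a coefficient p_i of largest degree: at Q_i its term strictly dominates the
    others. *)
Lemma pole_family_bound t n (Q : 'I_n -> place iF) : t != 0 ->
  dependent iF t n -> (forall i, Q i t < 0) ->
  ~ (forall i j, i != j -> Q i <> Q j :> (F -> int)).
Proof.
move=> t0 dep Qt Qneq.
case: n Q dep Qt Qneq => [|n] Q dep Qt Qneq; first by have [p [[[]]]] := dep (fun=> 0).
have hz i : exists z, [/\ z != 0, Q i z < 0 & forall j, j != i -> 0 < Q j z].
  have [l lt|z [z0 Qz hz]] := @weak_approximation (Q i)
      (fun l => oapp (fun j : 'I_n => Q (lift i j)) (Q i) (insub l)) n.
    by rewrite insubT /=; apply: Qneq; exact: neq_lift.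
  exists z; split=> // j; case: (unliftP i j) => [j' ->|-> /eqP //] _.
  by have := hz j' (ltn_ord j'); rewrite valK.
pose z i := projT1 (cid (hz i)).
have zP i : [/\ z i != 0, Q i (z i) < 0 & forall j, j != i -> 0 < Q j (z i)].
  exact: (projT2 (cid (hz i))).
have [p [[i0 hi0] e]] := dep z.
have [i hi imax] := @arg_maxnP _ i0 (fun i => p i != 0) (fun i => size (p i)) hi0.
have [ev0' Pev] := val_at_ev_pole t0 (Qt i) hi.
have [z0 Qz _] := zP i.
have x0 : ev iF t (p i) * z i != 0 by rewrite mulf_neq0.
have := e; rewrite (bigD1 i) //= => e'.
suff : order_ge (Q i) (Q i (ev iF t (p i) * z i) + 1)
    (\sum_(j | j != i) ev iF t (p j) * z j).
  by move=> /(val_at_dominant x0) [+ _]; rewrite e' eqxx.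
apply: order_ge_sum => j nji.
have [->|pj] := eqVneq (p j) 0; first by rewrite ev0 mul0r; left.
have [evj Pevj] := val_at_ev_pole t0 (Qt i) pj.
have [zj0 _ Qzj] := zP j; right.
rewrite !val_atM // Pev Pevj !int_mulrn.
have := Qzj i; rewrite eq_sym => /(_ nji); have := Qt i; have := imax j pj.
have : (0 < size (p j))%N by rewrite lt0n size_poly_eq0.
nia.
Qed.

Lemma poles_finite (oo : place iF) t n : t != 0 -> dependent iF t n ->
  exists m (Q : nat -> place iF), forall P,
    P t < 0 /\ P <> oo :> (F -> int) ->
    exists2 i, (i < m)%N & P = Q i :> (F -> int).
Proof.
move=> t0 dep.
pose G m := `[< exists Q : 'I_m -> place iF,
  (forall i, Q i t < 0 /\ Q i <> oo :> (F -> int)) /\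
  forall i j, i != j -> Q i <> Q j :> (F -> int) >].
have G0 : exists m, G m by exists 0; apply/asboolP; exists (fun=> oo); split=> [[]|[]].
have Gb m : G m -> (m <= n)%N.
  move=> /asboolP [Q [hQ Qn]]; rewrite leqNgt; apply/negP => lt.
  apply: (@pole_family_bound t n (fun i => Q (widen_ord (ltnW lt) i))) => //.
    by move=> i; case: (hQ (widen_ord (ltnW lt) i)).
  by move=> i j nij; apply: Qn.
case: (ex_maxnP G0 Gb) => m /asboolP [Q [hQ Qn]] mmax.
exists m, (fun l => oapp Q oo (insub l)) => P hP.
apply: contrapT => hn; suff : (m.+1 <= m)%N by rewrite ltnn.
apply: mmax; apply/asboolP; exists (fun i => oapp Q P (unlift ord0 i)); split.
  by move=> i; case: unliftP => [j _|_] /=; [exact: hQ|exact: hP].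
have nP i : P <> Q i :> (F -> int).
  by move=> e; apply: hn; exists i => //; rewrite valK.
move=> i j; case: (unliftP ord0 i) => [i' ->|->]; case: (unliftP ord0 j) => [j' ->|->];
  rewrite ?liftK ?unlift_none //=.
- by move=> nij; apply: Qn; apply: contra_neq nij => ->.
- by move=> _; exact: nesym.
Qed.

(** Large powers of y serve to modify functions at oo while hardly changing them at the other poles
    of t. *)
Lemma separating_function (oo : place iF) t n : t != 0 -> dependent iF t n ->
  exists y, [/\ y != 0, oo y < 0 & forall P, P t < 0 -> P <> oo :> (F -> int) ->
    0 < P y + P t].
Proof.
move=> t0 dep; have [m [Q hQ]] := poles_finite oo t0 dep.
(* The list supplied by [poles_finite] may contain oo, which has to be filtered out before weak
   approximation. *)
pose Q' := fix filt l := if l is l'.+1 then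
  if pselect (Q l' <> oo :> (F -> int)) is left _ then l' :: filt l' else filt l'
  else [::].
have Q'P l i : (i < l)%N -> Q i <> oo :> (F -> int) -> i \in Q' l.
  elim: l => // l IH; rewrite ltnS leq_eqVlt => /orP[/eqP ->|lt] ne /=.
    by case: pselect => // _; rewrite mem_head.
  by case: pselect => _; rewrite ?inE IH // orbT.
have Q'N l i : i \in Q' l -> Q i <> oo :> (F -> int).
  elim: l => //= l IH; case: pselect => // h; rewrite inE => /orP[/eqP -> //|]; exact: IH.
have [i lt|y [y0 ooy Qy]] :=
    @weak_approximation oo (fun l => Q (nth 0%N (Q' m) l)) (size (Q' m)).
  by apply: nesym; apply: Q'N; apply: mem_nth lt.
pose M := (\sum_(i < m) `|Q i t|%N).+1.
exists (y ^+ M); split; first by rewrite expf_neq0.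
  by rewrite val_atX int_mulrn /M; nia.
move=> P Pt Poo; have [i lti e] := hQ P (conj Pt Poo); rewrite e.
have hi : i \in Q' m by apply: Q'P => //; rewrite -e.
have := Qy (index i (Q' m)); rewrite index_mem => /(_ hi); rewrite nth_index //.
rewrite val_atX int_mulrn => Qpos.
have : (`|Q i t| < M)%N by rewrite ltnS (bigD1 (Ordinal lti)) //= leq_addr.
nia.
Qed.
End WeakApproximation.

(** * Regular functions *)

Section RegularFunctions.
Variables (k : finFieldType) (F : fieldType) (iF : {rmorphism k -> F}).
Hypothesis hF : function_field iF.
Variable oo : place iF.
Implicit Types (P Q : place iF) (x y t f : F).

Definition regular f : Prop :=
  forall P, P <> oo :> (F -> int) -> order_ge P 0 f.

Lemma regularD f g : regular f -> regular g -> regular (f + g).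
Proof. by move=> hf hg P hP; apply: order_geD; [exact: hf|exact: hg]. Qed.
Lemma regularM f g : regular f -> regular g -> regular (f * g).
Proof. by move=> hf hg P hP; apply: (@order_geM _ _ _ P 0 0); [exact: hf|exact: hg]. Qed.
Lemma regular_const c : regular (iF c).
Proof. by move=> P _; exact: order_ge_const. Qed.
Lemma regular_ev t p : regular t -> regular (ev iF t p).
Proof. by move=> ht P hP; apply: order_ge_ev; exact: ht. Qed.
Lemma regular0 : regular 0. Proof. by move=> P _; left. Qed.
Lemma regular1 : regular 1. Proof. by move=> P _; exact: order_ge1. Qed.
Lemma subspace_order_ge P n : subspace iF (order_ge P n).
Proof.
split=> [|x y|c x hx]; [exact: order_ge0|exact: order_geD|].
by rewrite -[n]add0r; apply: order_geM => //; exact: order_ge_const.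
Qed.

(** Some place has 1/f in its maximal ideal. It is a pole of f, and the only pole allowed is oo. *)
Lemma regular_pole f : regular f -> transcendental iF f -> oo f < 0.
Proof.
move=> hf ftr; have f0 := transcendental_neq0 ftr.
have fVtr : transcendental iF f^-1.
  move=> p e; have [r [rp er]] := ev_rev iF (transcendental_neq0 ftr) (leqSpred (size p)).
  have fV0 : f^-1 != 0 by rewrite invr_eq0.
  have [r' [rp' er']] := ev_rev iF fV0 (leqSpred (size p)).
  by apply/rp'/ftr; move: er'; rewrite invrK e mul0r.
have [n dep] := function_field_dependent hF f^-1.
have [P] := place_exists fVtr dep; rewrite val_atV => Pf.
rewrite ltNge; apply/negP => oof.
have /hf : P <> oo :> (F -> int) by move=> e; move: Pf; rewrite e; lia.
by rewrite order_ge_neq0 //; lia.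
Qed.

Lemma regular_val_le0 f : regular f -> f != 0 -> oo f <= 0.
Proof.
move=> hf f0; rewrite leNgt; apply/negP => h.
have ftr : transcendental iF f by apply: (@val_at_transcendental _ _ _ oo); rewrite ?gt_eqF.
by have := regular_pole hf ftr; lia.
Qed.

Section Existence.
Variables (t : F) (n : nat) (oot : oo t < 0).
Hypothesis dep : dependent iF t n.+1.
Hypothesis nodep : ~ dependent iF t n.

Let t0 : t != 0.
Proof. by apply/eqP => e; move: oot; rewrite e val_at0. Qed.
Let s := t^-1.
Let s0 : s != 0. Proof. by rewrite invr_eq0. Qed.
Let ttr : transcendental iF t.
Proof. by apply: (@val_at_transcendental _ _ _ oo); rewrite ?lt_eqF. Qed.

(** The semi-local ring of the poles of t other than oo. Its quotient by s = 1/t has dimension less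
    than n = [F : k(t)], because oo takes up at least one of the n dimensions. This deficit is what
    leaves room for a function whose only pole is oo. *)
Let O f : Prop :=
  forall P, P t < 0 -> P <> oo :> (F -> int) -> order_ge P 0 f.
Let sO m f : Prop := exists2 g, O g & f = s ^+ m * g.

Let O_subspace : subspace iF O.
Proof.
split=> [P _ _|x y hx hy P h h'|c x hx P h h'].
- by left.
- by apply: order_geD; [exact: hx|exact: hy].
by case: (subspace_order_ge P 0) => _ _; apply; exact: hx.
Qed.
Let Os x m : O x -> O (s ^+ m * x).
Proof.
move=> hx P h h'; rewrite -[0]addr0; apply: order_geM; last exact: hx.
by right; rewrite val_atX val_atV int_mulrn; nia.
Qed.
Let sO_subspace m : subspace iF (sO m).
Proof.
have [h0 hD hZ] := O_subspace.
split=> [|x y [g hg ->] [g' hg' ->]|c x [g hg ->]].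
- by exists 0; rewrite ?mulr0.
- by exists (g + g'); rewrite ?mulrDr //; exact: hD.
by exists (iF c * g); [exact: hZ|rewrite mulrCA].
Qed.

(* If u_1, ..., u_n in O were independent modulo sO, then multiplying them by *)
(* some w close to 1 at the other poles and to 0 at oo, and adding 1 - w,     *)
(* would give n + 1 independent functions regular at all the poles of t.      *)
Let O_dependent (u : 'I_n -> F) :
  (forall j, O (u j)) -> ~ independent_mod iF (sO 1) u.
Proof.
move=> hu ind.
have [y [y0 ooy hy]] := separating_function oo t0 dep.
(* M makes w = 1 / (1 + y^M) vanish at oo to an order exceeding the pole of every u_j by at least
   that of t. *)
pose M := (\sum_j `|oo (u j)| + `|oo t|)%N.+1.
pose v := 1 + y ^+ M.
have [v0 oov] : v != 0 /\ oo v = oo (y ^+ M).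
  rewrite /v addrC; apply: val_at_dominant; first by rewrite expf_neq0.
  by right; rewrite val_at1 val_atX int_mulrn /M; nia.
have Pv P : P t < 0 -> P <> oo :> (F -> int) -> P v = 0.
  move=> Pt hP; rewrite -(val_at1 P); have := hy P Pt hP => h.
  apply: (val_at_dominant (oner_neq0 F) _).2.
  by right; rewrite val_at1 val_atX int_mulrn /M; nia.
pose w := v^-1; pose h := y ^+ M / v.
have wh : w + h = 1 by rewrite /w /h -{1}[v^-1]mul1r -mulrDl mulfV.
pose V f := O f /\ order_ge oo 0 f.
pose W f := exists2 g, V g & f = s * g.
have hV : subspace iF V.
  have [h1 h2 h3] := O_subspace; have [i1 i2 i3] := subspace_order_ge oo 0.
  split=> [//|x x' [? ?] [? ?]|c x [? ?]]; first by split; [exact: h2|exact: i2].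
  by split; [exact: h3|exact: i3].
have hW : subspace iF W.
  have [h0 hD hZ] := hV.
  split=> [|x x' [g hg ->] [g' hg' ->]|c x [g hg ->]].
  - by exists 0; rewrite ?mulr0.
  - by exists (g + g'); rewrite ?mulrDr //; exact: hD.
  by exists (iF c * g); [exact: hZ|rewrite mulrCA].
have Vs x : V x -> V (s * x).
  move=> [h1 h2]; split; first by have := Os 1 h1; rewrite expr1.
  rewrite -[0]addr0; apply: order_geM => //; right.
  by rewrite val_atV; lia.
have hs : order_ge oo (oo s) (s * 1) by rewrite mulr1; right.
have hwO P : P t < 0 -> P <> oo :> (F -> int) -> P w = 0.
  by move=> h1 h2; rewrite val_atV Pv ?oppr0.
have hhP P : P t < 0 -> P <> oo :> (F -> int) -> order_ge P (P s) h.
  move=> h1 h2; right; rewrite val_atF ?expf_neq0 // Pv // subr0 val_atV val_atX.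
  by rewrite int_mulrn; have := hy P h1 h2; rewrite /M; nia.
have oowu j : order_ge oo (oo s) (w * u j).
  have [->|u0] := eqVneq (u j) 0; first by left; rewrite mulr0.
  right; rewrite val_atM ?invr_eq0 // !val_atV oov val_atX int_mulrn.
  have : (`|oo (u j)| + `|oo t| < M)%N.
    by rewrite ltnS leq_add2r (bigD1 j) //= leq_addr.
  nia.
have ooh : oo h = 0 by rewrite val_atF ?expf_neq0 // oov subrr.
have h0 : h != 0 by rewrite mulf_neq0 ?invr_eq0 ?expf_neq0.
pose f (j : 'I_n.+1) := oapp (fun j => w * u j) h (unlift ord0 j).
have f0 : f ord0 = h by rewrite /f unlift_none.
have fS j : f (lift ord0 j) = w * u j by rewrite /f liftK.
(* The n + 1 elements h and w u_j of V are independent modulo sV: the order at oo isolates the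
   coefficient of h, and then w + h = 1 turns a relation between the w u_j into one between the u_j
   modulo sO. *)
apply: (dependent_independent_mod (W := W) hV Vs hW _ s0 (dependentV t0 dep) (f := f)).
- by move=> x hx; exists x.
- move=> j; case: (unliftP ord0 j) => [j' ->|->].
    rewrite fS; split; last first.
      by apply: order_geS (oowu j'); rewrite val_atV; lia.
    move=> P h1 h2; rewrite -[0]addr0; apply: order_geM; last exact: hu.
    by right; rewrite hwO.
  rewrite f0; split=> [P h1 h2|]; last by right; rewrite ooh.
  by apply: order_geS (hhP P h1 h2); rewrite val_atV; lia.
move=> c [g [Og oog]]; rewrite big_ord_recl f0.
under eq_bigr => j _ do rewrite fS mulrCA.
rewrite -mulr_sumr => e.
have c0 : c ord0 = 0.
  apply/eqP; apply: contraT => c0.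
  have : order_ge oo (oo s) (iF (c ord0) * h).
    have -> : iF (c ord0) * h = s * g - w * \sum_j iF (c (lift ord0 j)) * u j.
      by rewrite -e addrK.
    apply: order_geB.
      by rewrite -[oo s]addr0; apply: order_geM => //; right.
    rewrite mulr_sumr; apply: order_ge_sum => j _; rewrite mulrCA.
    rewrite -[oo s]add0r; apply: order_geM => //; exact: order_ge_const.
  have ic0 : iF (c ord0) != 0 by rewrite fmorph_eq0.
  move=> /(order_ge_neq0 _ _ (mulf_neq0 ic0 h0)).
  by rewrite val_atM // val_at_const ooh val_atV; lia.
move=> j; case: (unliftP ord0 j) => [j' ->|-> //].
apply: (ind (fun j => c (lift ord0 j))).
set S := \sum_j _ in e *.
have eS : S = s ^+ 1 * (g + h / s * S).
  move: e; rewrite c0 rmorph0 mul0r add0r => e; rewrite expr1 mulrDr -e.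
  have -> : s * (h / s * S) = h * S by rewrite -mulrA mulrCA mulVKf.
  by rewrite -mulrDl wh mul1r.
rewrite eS; eexists; last by [].
case: O_subspace => _ hD _; apply: hD => // P h1 h2.
have -> : 0 = (P s - P s) + 0 by ring.
apply: order_geM; last first.
  by have := subspace_comb (fun j => c (lift ord0 j)) O_subspace hu; apply.
by apply: order_geM; [exact: hhP|right; rewrite val_atV].
Qed.

Let O_dim m : exists2 d, (d < n)%N & has_quotient_dim iF O (sO m) (d * m).
Proof.
have [d lt hd] := has_quotient_dim_bounded (sO_subspace 1) O_dependent.
exists d => //; elim: m => [|m IH].
  rewrite muln0; exists (fun=> 0); split=> [[]|x hx]; first by [].
  exists [ffun=> 0]; split; last by move=> c _; apply/ffunP => -[].
  by rewrite big_ord0 subr0; exists x; rewrite ?expr0 ?mul1r.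
rewrite mulnS; apply: (has_quotient_dim_add (W := sO 1)) => //.
- by move=> x [g hg ->]; exact: Os.
- by move=> x [g hg ->]; exists (s ^+ m * g); [exact: Os|rewrite exprS expr1 mulrA].
apply: (has_quotient_dim_scale (V := O) (W := sO m) (a := s)) => //.
- by move=> y _ [g hg]; rewrite exprS -mulrA => /(mulfI s0) ->; exists g.
by move=> y [g hg ->]; exists g; rewrite // exprS mulrA.
Qed.

(** If oo is the only pole of t, take t itself. Otherwise count the combinations with coefficients
    in k[t] of a basis e' integral over k[t]. Their poles at places other than oo lie among those of
    t, and the conditions for vanishing at the latter are fewer than the coefficients, by the
    deficit d < n. A nonzero combination satisfying them is regular and vanishes at Q, so it is
    transcendental and has a pole at oo. *)
Lemma regular_pole_exists : exists f, regular f /\ oo f < 0.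
Proof.
have [[Q [Qt Qoo]]|noQ] := pselect (exists Q, Q t < 0 /\ Q <> oo :> (F -> int)); last first.
  exists t; split=> // P hP; right; rewrite leNgt; apply/negP => Pt.
  by apply: noQ; exists P.
have [e eind] : exists e : 'I_n -> F, forall p : 'I_n -> {poly k},
    \sum_j ev iF t (p j) * e j = 0 -> forall j, p j = 0.
  apply: contrapT => /forallNP hn; apply: nodep => f.
  have /existsNP [p hp] := hn f.
  have [hp1 hp2] : \sum_j ev iF t (p j) * f j = 0 /\ ~ forall j, p j = 0.
    by split; [apply: contrapT => h; apply: hp => /h|move=> h; apply: hp].
  have /existsNP [j /eqP hj] := hp2.
  by exists p; split=> //; exists j.
have im f : exists g, ev iF t g != 0 /\ integral_over iF t (ev iF t g * f).
  exact: (integral_multiple ttr dep).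
pose g j := projT1 (cid (im (e j))).
have gP j : ev iF t (g j) != 0 /\ integral_over iF t (ev iF t (g j) * e j).
  exact: (projT2 (cid (im (e j)))).
pose e' j := ev iF t (g j) * e j.
have e'int j : integral_over iF t (e' j) by case: (gP j).
pose Cj j := projT1 (cid (integral_pole_bound (e'int j))).
have CjP j P : P t < 0 -> order_ge P (P t *+ Cj j) (e' j).
  exact: (projT2 (cid (integral_pole_bound (e'int j)))).
pose C := (\max_j Cj j)%N.
have CP j P : P t < 0 -> order_ge P (P t *+ C) (e' j).
  move=> Pt; apply: order_geS (CjP j P Pt); rewrite !int_mulrn.
  have : (Cj j <= C)%N by exact: (leq_bigmax j).
  nia.
(* With M = N + 1 + C every s^M [val A] lies in O. N is large enough for n (N + 1) to exceed (n -
   1)(M + 1), which bounds the dimension of O modulo s^(M+1) O. *)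
pose N := (n * (C + 2))%N; pose M := (N.+1 + C)%N.
pose val (A : 'M[k]_(n, N.+1)) := \sum_j ev iF t (rVpoly (row j A)) * e' j.
have val_reg A P : 0 <= P t -> order_ge P 0 (val A).
  move=> Pt; apply: order_ge_sum => j _; apply: (@order_geM _ _ _ P 0 0).
    by apply: order_ge_ev; right.
  by apply: (integral_regular (e'int j)); right.
have val_O A : O (s ^+ M * val A).
  move=> P Pt _; have -> : 0 = P s *+ M + (P t *+ N.+1 + P t *+ C).
    by rewrite -mulrnDr val_atV mulNrn addNr.
  apply: order_geM; first by right; rewrite val_atX.
  apply: order_ge_sum => j _; apply: order_geM; last exact: CP.
  by apply: order_ge_ev_pole => //; exact: size_poly.
have [d ltd [b [hb hc]]] := O_dim M.+1.
pose code A : {ffun 'I_(d * M.+1) -> k} := projT1 (cid (hc _ (val_O A))).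
have codeP A : sO M.+1 (s ^+ M * val A - \sum_j iF (code A j) * b j).
  by case: (projT2 (cid (hc _ (val_O A)))).
have [|A [A' [neq eqc]]] := @pigeonhole _ _ code.
  by rewrite card_ffun card_ord card_mx ltn_exp2l ?card_finField_gt1 // /M /N; nia.
have [g0 Og0 eg0] : sO 1 (val A - val A').
  have := subspaceB (sO_subspace M.+1) (codeP A) (codeP A').
  rewrite eqc opprB addrA subrK -mulrBr => -[g0 Og0].
  rewrite exprSr -mulrA => /(mulfI (expf_neq0 M s0)) ->.
  by exists g0; rewrite ?expr1.
have f0 : val A - val A' != 0.
  apply/eqP => ef; move/eqP: neq; apply; apply/row_matrixP => j.
  apply: (can_inj rVpolyK); apply/eqP; rewrite -subr_eq0; apply/eqP.
  have gj0 : g j != 0 by have [+ _] := gP j; apply: contra_neq => ->; rewrite ev0.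
  apply: (mulIf gj0); rewrite mul0r.
  apply: (eind (fun j => (rVpoly (row j A) - rVpoly (row j A')) * g j)).
  rewrite -[RHS]ef /val -sumrB; apply: eq_bigr => l _.
  by rewrite evM evB /e'; ring.
exists (val A - val A'); have reg : regular (val A - val A').
  move=> P hP; case: (ltP (P t) 0) => Pt; last by apply: order_geB; exact: val_reg.
  rewrite eg0; apply: (@order_geM _ _ _ P 0 0); last exact: Og0.
  by right; rewrite expr1 val_atV; lia.
split=> //; apply: regular_pole => //.
apply: (@val_at_transcendental _ _ _ Q) => //.
have : order_ge Q 1 (val A - val A').
  rewrite eg0 -[1]addr0; apply: order_geM; last exact: Og0.
  by right; rewrite expr1 val_atV; lia.
by rewrite order_ge_neq0 //; lia.
Qed.
End Existence.

Lemma pole_at_infinity : exists f, regular f /\ oo f < 0.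
Proof.
have [pi [pi0 h]] := val_at_onto oo.
have oot : oo pi^-1 < 0 by rewrite val_atV h.
have [n0 dep0] := function_field_dependent hF pi^-1.
have ex : exists n, `[< dependent iF pi^-1 n >] by exists n0; apply/asboolP.
case: (ex_minnP ex) => -[|n] /asboolP dep nmin.
  by have [p [[[]]]] := dep (fun=> 0).
apply: (regular_pole_exists oot dep) => /asboolP /nmin.
by rewrite ltnn.
Qed.

(** Let t be regular with a pole at oo. Some nonzero g(t) makes g(t) f integral over k[t], and
    functions integral over k[t] are regular because t is. *)
Lemma regular_fraction f : exists a b, [/\ regular a, regular b, b != 0 & f = a / b].
Proof.
have [t [treg oot]] := pole_at_infinity.
have t0 : t != 0 by apply/eqP => e; move: oot; rewrite e val_at0.
have ttr : transcendental iF t.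
  by apply: (@val_at_transcendental _ _ _ oo); rewrite ?lt_eqF.
have [n dep] := function_field_dependent hF t.
have [g [g0 gint]] := integral_multiple ttr dep f.
exists (ev iF t g * f), (ev iF t g); split=> //.
- by move=> P hP; apply: (integral_regular gint); exact: treg.
- exact: regular_ev.
by rewrite mulrAC mulfV ?mul1r.
Qed.
End RegularFunctions.

(** * Completion and degree *)

Section CompletionTheory.
Variables (B : comPzRingType) (Fl : filtration B).
Local Notation BB := (completion Fl).
Local Notation cfl := (completed_filtration Fl).

Lemma cfil_to_completion n b : cfil n (to_completion Fl b) <-> Fl n b.
Proof.
rewrite cfil_limit; split=> [[N hN]|h]; first exact: (hN N).
by exists 0%N.
Qed.

Lemma completion_dense (x : BB) n : exists b, cfl n (x - to_completion Fl b).
Proof.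
elim/completion_ind: x => u hu; have [N hN] := hu n.
exists (u N); rewrite /to_completion limitN limitD; apply/cfil_limit.
by exists N => i hi; exact: hN.
Qed.

Lemma completion_separated (x : BB) : (forall n, cfl n x) -> x = 0.
Proof.
elim/completion_ind: x => u hu h; apply/limit_eq => n.
by have /cfil_limit [N hN] := h n; exists N => i /hN; rewrite subr0.
Qed.

Lemma completion_complete (U : nat -> BB) : cauchy cfl U ->
  exists x, forall n, exists N, forall i, (N <= i)%N -> cfl n (x - U i).
Proof.
move=> hU.
pose u i := projT1 (cid (completion_dense (U i) i%:Z)).
have uP i : cfl i%:Z (U i - to_completion Fl (u i)).
  exact: (projT2 (cid (completion_dense (U i) i%:Z))).
have uP' n i : (`|n| <= i)%N -> cfl n (U i - to_completion Fl (u i)).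
  by move=> le; apply: filS (uP i); lia.
have hu : cauchy Fl u.
  move=> n; have [N hN] := hU n; exists (maxn N `|n|) => i j.
  rewrite !geq_max => /andP[h1 h2] /andP[h3 h4].
  apply/cfil_to_completion; rewrite rmorphB /=.
  have -> : to_completion Fl (u i) - to_completion Fl (u j) =
    (U i - U j) - (U i - to_completion Fl (u i)) + (U j - to_completion Fl (u j)).
    by ring.
  apply: (@filD _ cfl); last exact: uP'.
  by apply: (@filB _ cfl); [exact: hN|exact: uP'].
exists (limit hu) => n; have [N hN] := hu n; exists (maxn N `|n|) => i.
rewrite geq_max => /andP[h1 h2].
have -> : limit hu - U i = (limit hu - to_completion Fl (u i)) -
    (U i - to_completion Fl (u i)) by ring.
apply: (@filB _ cfl); last exact: uP'.
rewrite /to_completion limitN limitD; apply/cfil_limit.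
by exists N => j hj; exact: hN.
Qed.
End CompletionTheory.

(** * Second isomorphism theorem: V/W and V'/(V' meet W) when V = V' + W *)

Section SecondIsomorphism.
Variables (k : finFieldType) (B : pzRingType) (i : {rmorphism k -> B}).
Variables (V W V' : B -> Prop) (d : nat).
Hypotheses (hV' : subspace i V') (hW : subspace i W).
Hypothesis V'V : forall x, V' x -> V x.
Hypothesis VW : forall x, V x -> exists2 y, V' y & W (x - y).

Lemma has_quotient_dim_restrict :
  has_quotient_dim i V W d -> has_quotient_dim i V' (fun x => V' x /\ W x) d.
Proof.
move=> [e [he hc]].
pose f j := projT1 (cid2 (VW (he j))).
have fP j : V' (f j) /\ W (e j - f j).
  by rewrite /f; case: cid2.
have sumW (c : 'I_d -> k) : W (\sum_j i (c j) * e j - \sum_j i (c j) * f j).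
  case: (hW) => h0 hD hZ; rewrite -sumrB; apply: big_ind => // j _.
  by rewrite -mulrBr; apply: hZ; case: (fP j).
exists f; split=> [j|x hx]; first by case: (fP j).
have [c [hcW cu]] := hc x (V'V hx); exists c; split=> [|c' [_ hc']].
  split; first by apply: (subspaceB hV') => //; apply: subspace_comb => // j; case: (fP j).
  case: (hW) => _ hD _; have := hD _ _ hcW (sumW c).
  by rewrite addrA subrK.
apply: cu; have := subspaceB hW hc' (sumW c').
by rewrite opprB addrA subrK.
Qed.

Lemma has_quotient_dim_extend :
  has_quotient_dim i V' (fun x => V' x /\ W x) d -> has_quotient_dim i V W d.
Proof.
move=> [e [he hc]]; exists e; split=> [j|x hx]; first exact: V'V.
have [y hy hxy] := VW hx; have [c [[_ hcW] cu]] := hc y hy; exists c; split.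
  case: (hW) => _ hD _; have := hD _ _ hxy hcW.
  by rewrite addrA subrK.
move=> c' hc'; apply: cu; split.
  by apply: (subspaceB hV') => //; exact: subspace_comb.
have := subspaceB hW hc' hxy.
by rewrite opprB addrC addrA subrK.
Qed.
End SecondIsomorphism.

(** * Approximation at oo by elements of A, and the formula for [deg_A] *)

Section Infinity.
Variables (k : finFieldType) (F : fieldType) (iF : {rmorphism k -> F}).
Hypothesis hF : function_field iF.
Variable oo : place iF.
Local Notation fl := (F_oo_fil oo).
Local Notation emb := (F_to_F_oo oo).
Local Notation reg := (regular oo).
Local Notation d := (d_oo oo).

Lemma fil_emb n x : fl n (emb x) <-> order_ge oo n x.
Proof. exact: cfil_to_completion. Qed.

Lemma fil_emb_near n f x : fl n (f - emb x) -> fl n f -> order_ge oo n x.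
Proof.
by move=> h1 h2; apply/fil_emb; have := filB h2 h1; rewrite subKr.
Qed.

Lemma fil_val x : x != 0 -> fl (oo x) (emb x).
Proof. by move=> x0; apply/fil_emb; right. Qed.
Lemma fil_valV x : x != 0 -> fl (- oo x) (emb x^-1).
Proof. by move=> x0; rewrite -val_atV; apply: fil_val; rewrite invr_eq0. Qed.

Lemma subspace_fil n : subspace (const_F_oo oo) (fl n).
Proof.
split=> [|x y|c x hx]; [exact: fil0|exact: filD|].
rewrite -[n]add0r; apply: filM => //; apply/fil_emb; exact: order_ge_const.
Qed.

(** The residue field is finite over k, so that [d_oo] is its true degree and not the default value
    of [quotient_dim]. Lifts of independent residues are independent over k[pi]. *)
Lemma residue_dim : has_quotient_dim (const_F_oo oo) (in_A_oo (oo := oo)) (in_m_oo (oo := oo)) d.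
Proof.
have [pi [pi0 hpi]] := val_at_onto oo.
have [n dep] := function_field_dependent hF pi.
have [|e _ he] := @has_quotient_dim_bounded _ _ (const_F_oo oo)
    (in_A_oo (oo := oo)) _ n (subspace_fil 1); last first.
  by rewrite /d_oo (quotient_dimE (subspace_fil 0) (subspace_fil 1) he).
move=> f hf ind.
have hx j : exists x, fl 1 (f j - emb x) by exact: completion_dense.
pose x j := projT1 (cid (hx j)).
have xP j : fl 1 (f j - emb (x j)) by exact: (projT2 (cid (hx j))).
apply: (@dependent_independent_mod _ _ iF pi (order_ge oo 0) (order_ge oo 1) _ _ _ _
  n x) => //.
- exact: subspace_order_ge.
- move=> y hy; apply: (order_geS (m := 0) (n := 1 + 0)) => //.
  by apply: order_geM => //; right; rewrite hpi.
- exact: subspace_order_ge.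
- move=> y hy; rewrite -[1]addr0; apply: order_geM => //; right; rewrite hpi //.
- move=> j; apply: (fil_emb_near _ (hf j)); exact: filS (xP j).
move=> c hc; apply: ind.
have h : fl 1 (\sum_j const_F_oo oo (c j) * (f j - emb (x j))).
  by apply: subspace_comb => //; exact: subspace_fil.
move/fil_emb: hc => hc; have := filD h hc; congr (fl 1 _).
rewrite rmorph_sum -big_split; apply: eq_bigr => j _ /=.
by rewrite rmorphM mulrBr subrK.
Qed.

Lemma residue_dim_F : has_quotient_dim iF (order_ge oo 0) (order_ge oo 1) d.
Proof.
have [e [he hc]] := residue_dim.
have hx j : exists x, fl 1 (e j - emb x) by exact: completion_dense.
pose x j := projT1 (cid (hx j)).
have xP j : fl 1 (e j - emb (x j)) by exact: (projT2 (cid (hx j))).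
have sum1 (c : 'I_d -> k) : fl 1 (\sum_j const_F_oo oo (c j) * e j -
    emb (\sum_j iF (c j) * x j)).
  rewrite rmorph_sum -sumrB.
  have := subspace_comb c (subspace_fil 1) xP; congr (fl 1 _).
  by apply: eq_bigr => j _; rewrite rmorphM mulrBr.
exists x; split=> [j|y hy].
  by apply: (fil_emb_near _ (he j)); exact: filS (xP j).
have /hc [c [hcW cu]] : in_A_oo (emb y) by apply/fil_emb.
exists c; split=> [|c' hc'].
  apply/fil_emb; rewrite rmorphB; have := filD hcW (sum1 c).
  by rewrite addrA subrK.
apply: cu; move/fil_emb: hc'; rewrite rmorphB => hc'.
by have := filB hc' (sum1 c'); rewrite opprB addrA subrK.
Qed.

(* Every leading term of order -n is the leading term of some element of A. *)
Let full (n : int) : Prop := forall f : F_oo oo, fl (- n) f ->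
  exists a, [/\ reg a, order_ge oo (- n) a & fl (1 - n) (f - emb a)].

Let full_shift a n : reg a -> a != 0 -> full n -> full (n - oo a).
Proof.
move=> ha a0 fn f hf.
have [|b [hb ob hfb]] := fn (f * emb a^-1).
  have -> : - n = - (n - oo a) + - oo a by ring.
  by apply: filM => //; exact: fil_valV.
exists (a * b); split; first exact: regularM.
  have -> : - (n - oo a) = oo a + - n by ring.
  by apply: order_geM => //; right.
have -> : 1 - (n - oo a) = oo a + (1 - n) by ring.
have -> : f - emb (a * b) = emb a * (f * emb a^-1 - emb b).
  by rewrite mulrBr mulrCA -!rmorphM mulfV // rmorph1 mulr1.
by apply: filM => //; exact: fil_val.
Qed.

(** Clear the denominators of lifts u_j of a residue basis by a common b in A: the b u_j lie in A
    and provide all leading terms of order [oo b]. *)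
Let full_exists : exists n, full n.
Proof.
have [u [hu hc]] := residue_dim_F.
pose den j := projT1 (cid (projT2 (cid (regular_fraction hF oo (u j))))).
have denP j : [/\ reg (den j), den j != 0 & reg (den j * u j)].
  have [h1 h2 h3 h4] := projT2 (cid (projT2 (cid (regular_fraction hF oo (u j))))).
  by split=> //; rewrite h4 mulrCA mulfV // mulr1.
pose b := \prod_j den j.
have reg_prod (r : seq 'I_d) (Q : pred 'I_d) : reg (\prod_(j <- r | Q j) den j).
  apply: big_ind => [|x y|j _]; [exact: regular1|exact: regularM|by case: (denP j)].
have b0 : b != 0 by apply/prodf_neq0 => j _; case: (denP j).
have hbu j : reg (b * u j).
  rewrite /b (bigD1 j) //= mulrAC; apply: regularM; last exact: reg_prod.
  by case: (denP j).
exists (- oo b) => f; rewrite opprK => hf.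
have [x hx] := completion_dense (f * emb b^-1) 1.
have ox : order_ge oo 0 x.
  apply: (@fil_emb_near _ (f * emb b^-1)); first exact: filS hx.
  by rewrite -(subrr (oo b)); apply: filM => //; exact: fil_valV.
have [c [hcW _]] := hc x ox.
exists (\sum_j iF (c j) * (b * u j)).
have e : \sum_j iF (c j) * (b * u j) = b * \sum_j iF (c j) * u j.
  by rewrite mulr_sumr; apply: eq_bigr => j _; rewrite mulrCA.
split.
- apply: big_ind => [|y y'|j _]; [exact: regular0|exact: regularD|].
  by apply: regularM => //; exact: regular_const.
- rewrite e -[X in order_ge _ X]addr0; apply: order_geM; first by right.
  by apply: subspace_comb => //; exact: subspace_order_ge.
have -> : f - emb (\sum_j iF (c j) * (b * u j)) =
  emb b * ((f * emb b^-1 - emb x) + emb (x - \sum_j iF (c j) * u j)).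
  rewrite e rmorphB addrA subrK mulrBr mulrCA -!rmorphM mulfV //.
  by rewrite rmorph1 mulr1.
rewrite addrC; apply: filM; first exact: fil_val.
by apply: filD => //; apply/fil_emb.
Qed.

(** Writing 1/pi = a / b with a and b in A gives elements with consecutive pole orders m + 1 and m.
    Every r >= m^2 is q m + rho with rho <= q, that is (q - rho) m + rho (m + 1), so shifting one
    full order by a and b reaches all large ones. *)
Let full_eventually : exists N : nat, forall n : nat, (N <= n)%N -> full n.
Proof.
have [n0 f0] := full_exists.
have [pi [pi0 hpi]] := val_at_onto oo.
have [a [b [ha hb b0 e]]] := regular_fraction hF oo pi^-1.
have a0 : a != 0 by apply: contra_neq pi0 => a0; rewrite -[pi]invrK e a0 mul0r invr0.
have ea : oo a = oo b - 1.
  by have := congr1 oo e; rewrite val_atV val_atF // hpi; lia.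
have ob := regular_val_le0 hF hb b0.
have [m em] : exists m : nat, oo b = - m%:Z by exists `|oo b|%N; lia.
have iter_full i j n : full n -> full (n + m%:Z *+ i + (m%:Z + 1) *+ j).
  move=> fn; have h1 : full (n + m%:Z *+ i).
    elim: i => [|i IH]; first by rewrite addr0.
    by have := full_shift hb b0 IH; rewrite em opprK mulrSr addrA.
  elim: j => [|j IH]; first by rewrite addr0.
  have := full_shift ha a0 IH; rewrite ea em mulrSr addrA.
  by congr full; ring.
exists (`|n0| + m * m)%N => n le.
have [r er] : exists r : nat, n%:Z = n0 + r%:Z /\ (m * m <= r)%N.
  by exists `|n%:Z - n0|%N; lia.
have [q [rho [e1 [e2 e3]]]] : exists q rho : nat, r = (q * m + rho)%N /\
    ((rho <= q)%N /\ True).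
  case: (posnP m) => [m0|mpos].
    exists r, r; rewrite m0; lia.
  exists (r %/ m)%N, (r %% m)%N; split; first exact: divn_eq.
  split=> //; apply: (@leq_trans m); first by rewrite ltnW // ltn_mod.
  by rewrite leq_divRL //; case: er.
have := iter_full (q - rho)%N rho n0 f0.
case: er => -> _; congr full; rewrite e1 !int_mulrn.
by rewrite -subzn //; nia.
Qed.

(** Leading terms are cancelled one after the other by elements of A, as long as the pole order is
    at least B. Consequently F_oo is the sum of A and the elements of order at least -B. *)
Lemma regular_approximation : exists B : nat, forall (n : nat) (f : F_oo oo),
  (B <= n)%N -> fl (- n%:Z) f ->
  exists a, [/\ reg a, order_ge oo (- n%:Z) a & fl (- B%:Z) (f - emb a)].
Proof.
have [B hB] := full_eventually; exists B => n f le.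
rewrite -(subnK le); move: (n - B)%N => m {n le}.
elim: m f => [|m IH] f hf.
  exists 0; split; [exact: regular0|exact: order_ge0|].
  by rewrite rmorph0 subr0.
have [|a [ra oa fa]] := hB (m.+1 + B)%N _ f hf; first by lia.
have [|b [rb ob fb]] := IH (f - emb a).
  by apply: filS fa; lia.
exists (a + b); split; first exact: regularD.
  by apply: order_geD => //; apply: order_geS ob; lia.
by rewrite rmorphD opprD addrA.
Qed.

(** The Riemann-Roch space of the divisor n oo. *)
Let L (n : nat) : F -> Prop := fun x => reg x /\ order_ge oo (- n%:Z) x.

Let L_subspace n : subspace iF (L n).
Proof.
have [h1 h2 h3] := subspace_order_ge oo (- n%:Z).
split=> [|x y [? ?] [? ?]|c x [? ?]].
- by split=> //; exact: regular0.
- by split; [exact: regularD|exact: h2].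
- by split; [apply: regularM => //; exact: regular_const|exact: h3].
Qed.

Let order_dim (m : int) (j : nat) :
  has_quotient_dim iF (order_ge oo m) (order_ge oo (m + j%:Z)) (d * j).
Proof.
elim: j => [|j IH].
  rewrite muln0 addr0; exists (fun=> 0); split=> [[]|x hx]; first by [].
  exists [ffun=> 0]; split; last by move=> c _; apply/ffunP => -[].
  by rewrite big_ord0 subr0.
rewrite mulnS addnC; apply: (has_quotient_dim_add (W := order_ge oo (m + j%:Z))) => //;
  try exact: subspace_order_ge.
- by move=> x; apply: order_geS; lia.
- by move=> x; apply: order_geS; lia.
have [pi [pi0 hpi]] := val_at_onto oo.
have u0 z : pi ^ z != 0 by exact: expfz_neq0.
have opi (z : int) n x : order_ge oo n x -> order_ge oo (z + n) (pi ^ z * x).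
  by apply: order_geM; right; rewrite val_atXz hpi mulr1.
have opiV (z : int) n x : order_ge oo (z + n) (pi ^ z * x) -> order_ge oo n x.
  move=> /(opi (- z)); rewrite addrA addNr add0r mulrA -invr_expz.
  by rewrite mulVf // mul1r.
apply: (has_quotient_dim_scale (V := order_ge oo 0) (W := order_ge oo 1)
  (a := pi ^ (m + j%:Z))) => //; last exact: residue_dim_F.
- move=> x; split=> [h|[y hy ->]]; last by have := opi (m + j%:Z) _ _ hy; rewrite addr0.
  exists (pi ^ (- (m + j%:Z)) * x).
    by have := opi (- (m + j%:Z)) _ _ h; rewrite addNr.
  by rewrite mulrA -invr_expz mulfV // mul1r.
- move=> y _ h; apply: (opiV (m + j%:Z)); move: h; congr (order_ge oo _ _); lia.
- move=> y /(opi (m + j%:Z)); congr (order_ge oo _ _); lia.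
exact: subspace_order_ge.
Qed.

Let zero_subspace : subspace iF (fun x => x = 0).
Proof.
split=> // [x y -> ->|c x ->]; [exact: addr0|exact: mulr0].
Qed.

Let L_dim n : exists e, has_quotient_dim iF (L n) (fun x => x = 0) e.
Proof.
have [e _ he] : exists2 e, (e < (d * n.+1).+1)%N &
    has_quotient_dim iF (L n) (fun x => x = 0) e; last by exists e.
apply: has_quotient_dim_bounded => // f hf ind.
have := order_dim (- n%:Z) n.+1.
have -> : - n%:Z + n.+1%:Z = 1 by lia.
move=> hd; apply: (quotient_dim_dependent _ _ hd (f := f)).
- exact: subspace_order_ge.
- exact: subspace_order_ge.
- by move=> j; case: (hf j).
move=> c hc; apply: ind.
have [hr _] := subspace_comb c (L_subspace n) hf.
apply/eqP; apply: contraT => s0.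
have := regular_val_le0 hF hr s0; have := (order_ge_neq0 oo 1 s0).1 hc; lia.
Qed.

(** Let n be the pole order of a. By approximation L(B+n)/L(B) has dimension d n. As a L(B) has the
    finite dimension of L(B), also L(B+n)/aL(B) has dimension d n. This is A/aA, because A = L(B+n)
    + aA and L(B+n) meets aA in a L(B). *)
Lemma quotient_dim_regular a : reg a -> a != 0 -> has_quotient_dim iF reg
  (fun x => exists2 b, reg b & x = a * b) (d * `|oo a|).
Proof.
move=> ra a0; have [B hB] := regular_approximation.
have oa := regular_val_le0 hF ra a0.
set n := `|oo a|%N; have en : oo a = - n%:Z by rewrite /n; lia.
pose aL m x := exists2 b, L m b & x = a * b.
have aL_subspace m : subspace iF (aL m).
  have [h1 h2 h3] := L_subspace m.
  split=> [|x y [g hg ->] [g' hg' ->]|c x [g hg ->]].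
  - by exists 0; rewrite ?mulr0.
  - by exists (g + g'); rewrite ?mulrDr //; exact: h2.
  by exists (iF c * g); [exact: h3|rewrite mulrCA].
have areg_subspace : subspace iF (fun x => exists2 b, reg b & x = a * b).
  split=> [|x y [g hg ->] [g' hg' ->]|c x [g hg ->]].
  - by exists 0; rewrite ?mulr0 //; exact: regular0.
  - by exists (g + g'); rewrite ?mulrDr //; exact: regularD.
  exists (iF c * g); last by rewrite mulrCA.
  by apply: regularM => //; exact: regular_const.
have hdn : has_quotient_dim iF (L (B + n)) (L B) (d * n).
  have := order_dim (- (B + n)%:Z) n.
  have -> : - (B + n)%:Z + n%:Z = - B%:Z by lia.
  move=> /(has_quotient_dim_restrict (L_subspace (B + n)) (subspace_order_ge oo (- B%:Z))).
  have -> : (fun x => L (B + n) x /\ order_ge oo (- B%:Z) x) = L B.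
    apply/funext => x; apply/propext; split=> [[[h _] h']|[h h']] //.
    by split=> //; split=> //; apply: order_geS h'; lia.
  apply=> [x []|x hx] //.
  have [||b [rb ob hb]] := hB (B + n)%N (emb x); [lia|by apply/fil_emb|].
  by exists b; [|apply/fil_emb; rewrite rmorphB].
have [e he] := L_dim B.
have haL : has_quotient_dim iF (aL B) (fun x => x = 0) e.
  apply: (has_quotient_dim_scale (V := L B) (W := fun x => x = 0) (a := a)) => //.
  - by move=> y _ /eqP; rewrite mulf_eq0 (negPf a0) => /eqP.
  - by move=> y ->; rewrite mulr0.
have aL_L x : aL B x -> L (B + n) x.
  move=> [b [rb ob] ->]; split; first exact: regularM.
  by apply: order_geS (order_geM (or_intror (lexx (oo a))) ob); rewrite en; lia.
have hL : has_quotient_dim iF (L (B + n)) (fun x => x = 0) (d * n + e).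
  apply: has_quotient_dim_add hdn he => //.
    by move=> x [h1 h2]; split=> //; apply: order_geS h2; lia.
  by move=> x ->; case: (L_subspace B).
have zero_aL x : x = 0 -> aL B x by move=> ->; case: (aL_subspace B).
have [d1 [d2 [h1 h2 h3]]] :=
  has_quotient_dim_sub (L_subspace _) (aL_subspace _) zero_subspace aL_L zero_aL hL.
have ed2 := has_quotient_dim_unique (aL_subspace _) zero_subspace haL h2.
have ed1 : d1 = (d * n)%N by lia.
move: h1; rewrite ed1.
have -> : aL B = (fun x => L (B + n) x /\ exists2 b, reg b & x = a * b).
  apply/funext => x; apply/propext; split=> [h|[[rx ox] [b rb e']]].
    by split; [exact: aL_L|case: h => b [? _] ->; exists b].
  exists b => //; split=> //.
  have [b0|b0] := eqVneq b 0; first by left.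
  have : order_ge oo (- (B + n)%:Z) (a * b) by rewrite -e'.
  by rewrite order_ge_neq0 ?mulf_neq0 // val_atM // en => h; right; lia.
apply: has_quotient_dim_extend => // [x []//|x hx].
pose N := (B + `|oo x|)%N.
have [||b [rb ob hb]] := hB N (emb (x / a)); first by rewrite /N; lia.
  apply/fil_emb; have [->|x0] := eqVneq x 0; first by left; rewrite mul0r.
  by right; rewrite val_atF // /N en; lia.
have oxa : order_ge oo (- B%:Z) (x / a - b) by apply/fil_emb; rewrite rmorphB.
exists (x - a * b); last by exists b; rewrite ?subKr.
split.
  move=> P hP; apply: order_geB; first exact: hx.
  exact: (regularM ra rb hP).
have -> : x - a * b = a * (x / a - b) by rewrite mulrBr mulrCA mulfV // mulr1.
by apply: order_geS (order_geM (or_intror (lexx (oo a))) oxa); rewrite en; lia.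
Qed.

Lemma regular_ringP (a : regular_ring oo) : reg (val a).
Proof. by case: a => x hx; apply: asboolW hx. Qed.

Lemma regular_ring_exists x : reg x -> exists a : regular_ring oo, val a = x.
Proof.
move=> hx; have h : regular_pred oo x by apply/asboolP.
by exists (exist _ x h).
Qed.

Lemma deg_AE (a : regular_ring oo) : a != 0 -> deg_A a = (d * `|oo (val a)|)%N.
Proof.
move=> a0; have va0 : val a != 0 by rewrite -(rmorph0 (regular_incl oo)) (inj_eq val_inj).
have [e [he hc]] := quotient_dim_regular (regular_ringP a) va0.
pose e' j := projT1 (cid (regular_ring_exists (he j))).
have e'P j : val (e' j) = e j by exact: (projT2 (cid (regular_ring_exists (he j)))).
have sumE (c : 'I_(d * `|oo (val a)|) -> k) (x : regular_ring oo) :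
    val (x - \sum_j const_regular_ring oo (c j) * e' j) =
    val x - \sum_j iF (c j) * e j.
  rewrite -[LHS]/(regular_incl oo _) rmorphB rmorph_sum /=; congr (_ - _).
  by apply: eq_bigr => j _; rewrite -e'P.
have WE (x : regular_ring oo) :
    (exists b, x = b * a) <-> exists2 b, reg b & val x = val a * b.
  split=> [[b ->]|[b /regular_ring_exists [b' <-] h]].
    exists (val b); first exact: regular_ringP.
    exact: (mulrC (val b)).
  by exists b'; apply: val_inj; rewrite /= h mulrC.
apply: quotient_dimE => //.
- split=> [|x y [b ->] [b' ->]|c x [b ->]].
  + by exists 0; rewrite mul0r.
  + by exists (b + b'); rewrite mulrDl.
  by exists (const_regular_ring oo c * b); rewrite mulrA.
exists e'; split=> // x _.
have [c [hcW cu]] := hc _ (regular_ringP x); exists c; split.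
  by apply/WE; rewrite sumE.
by move=> c' /WE; rewrite sumE => /cu.
Qed.
End Infinity.

(** * Teichmuller representatives *)

Section Teichmuller.
Variables (k : finFieldType) (F : fieldType) (iF : {rmorphism k -> F}).
Hypothesis hF : function_field iF.
Variable oo : place iF.
Local Notation fl := (F_oo_fil oo).
Local Notation emb := (F_to_F_oo oo).
Local Notation d := (d_oo oo).
Local Notation q := #|k|.
Implicit Types x y : F_oo oo.

Lemma F_oo_val x : x != 0 -> exists v, fl v x /\ fl (- v) x^-1.
Proof.
move=> x0; have [n hn] : exists n, ~ fl n x.
  apply: contrapT => /forallNP h; move/eqP: x0; apply.
  by apply: completion_separated => n; apply: contrapT; exact: h.
have [m hm] := fil_exhaustive fl x^-1.
have [y hy] := completion_dense x (Order.max n (1 - m)).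
have ny : ~ order_ge oo n y.
  move=> /fil_emb h; apply: hn; rewrite -[x](subrK (emb y)).
  by apply: filD h; apply: filS hy; rewrite le_max lexx.
have [y0 lt] := not_order_ge ny; exists (oo y); split.
  rewrite -[x](subrK (emb y)); apply: filD; last exact: fil_val.
  by apply: filS hy; rewrite le_max ltW.
have -> : x^-1 = emb y^-1 * (1 - (x - emb y) * x^-1).
  rewrite mulrBl mulfV // opprB addrC subrK mulrA -rmorphM mulVf //.
  by rewrite rmorph1 mul1r.
rewrite -[- oo y]addr0; apply: filM; first exact: fil_valV.
apply: filB; first exact: fil1.
have : fl (1 - m + m) ((x - emb y) * x^-1).
  by apply: filM => //; apply: filS hy; rewrite le_max lexx orbT.
by rewrite subrK; apply: filS.
Qed.

Lemma F_oo_unit x : fl 0 x -> ~ fl 1 x -> x != 0 /\ fl 0 x^-1.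
Proof.
move=> h0 h1; have x0 : x != 0 by apply/eqP => e; apply: h1; rewrite e; exact: fil0.
split=> //; have [v [hv hv']] := F_oo_val x0; apply: filS hv'.
rewrite oppr_ge0 leNgt; apply/negP => lt; apply: h1; apply: filS hv; lia.
Qed.

Lemma fil_cancel x y : fl 0 x -> ~ fl 1 x -> fl 1 (x * y) -> fl 1 y.
Proof.
move=> h0 h1 hxy; have [x0 hV] := F_oo_unit h0 h1.
by rewrite -[y](mulKf x0) -[1]add0r; exact: filM.
Qed.

Lemma fil_one : ~ fl 1 1.
Proof.
rewrite -(rmorph1 emb) => /fil_emb; rewrite order_ge_neq0 ?oner_neq0 //.
by rewrite val_at1.
Qed.

Lemma filX n x m : fl n x -> fl (n *+ m) (x ^+ m).
Proof.
move=> h; elim: m => [|m IH]; first by rewrite expr0; exact: fil1.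
by rewrite exprS mulrS; exact: filM.
Qed.

Local Notation code := {ffun 'I_d -> k}.
Let e := projT1 (cid (residue_dim hF oo)).
Let eA j : fl 0 (e j).
Proof. by have [+ _] := projT2 (cid (residue_dim hF oo)); apply. Qed.
Let rep (c : code) : F_oo oo := \sum_j const_F_oo oo (c j) * e j.
Let repA c : fl 0 (rep c).
Proof. by apply: subspace_comb => //; exact: subspace_fil. Qed.
Let res_exists x : fl 0 x -> exists! c : code, fl 1 (x - rep c).
Proof. by have [_] := projT2 (cid (residue_dim hF oo)); apply. Qed.
Let res_inj (c c' : code) : fl 1 (rep c - rep c') -> c = c'.
Proof.
move=> h; have [b [_ bu]] := res_exists (repA c).
by rewrite -(bu c' h); apply/esym/bu; rewrite subrr; exact: fil0.
Qed.
Let rep0 : rep 0 = 0.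
Proof. by rewrite /rep big1 // => j _; rewrite ffunE rmorph0 mul0r. Qed.
Let rep_unit c : c != 0 -> ~ fl 1 (rep c).
Proof. by move=> c0 h; move/eqP: c0; apply; apply: res_inj; rewrite rep0 subr0. Qed.

Lemma d_oo_gt0 : (0 < d)%N.
Proof.
rewrite lt0n; apply/eqP => d0; apply: fil_one.
have [c [hc _]] := res_exists (fil1 fl); move: hc.
rewrite /rep big1 ?subr0 // => j _; by have := ltn_ord j; rewrite {2}d0.
Qed.

Let Q := #|{: code}|.
Let QE : Q = (q ^ d)%N. Proof. by rewrite /Q card_ffun card_ord. Qed.
Let Q_gt1 : (1 < Q)%N.
Proof.
by rewrite QE -{1}(expn0 q) ltn_exp2l ?card_finField_gt1 // d_oo_gt0.
Qed.

Section Multiplication.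
Variables (x : F_oo oo) (x0 : fl 0 x) (x1 : ~ fl 1 x).
Let mulA c : fl 0 (x * rep c).
Proof. by rewrite -[0]addr0; exact: filM. Qed.
(** The permutation of residue classes, coded by their coordinates over k, given by multiplication
    by the unit x. *)
Definition mulcode (c : code) : code := projT1 (cid (res_exists (mulA c))).
Lemma mulcodeP c : fl 1 (x * rep c - rep (mulcode c)).
Proof. by have [] := projT2 (cid (res_exists (mulA c))). Qed.
Lemma mulcode_inj : injective mulcode.
Proof.
move=> c c' ec; apply: res_inj; apply: (fil_cancel x0 x1).
have := filB (mulcodeP c) (mulcodeP c'); rewrite ec opprB addrA subrK.
by rewrite mulrBr.
Qed.
Lemma mulcode0 : mulcode 0 = 0.
Proof.
apply: res_inj; have := mulcodeP 0; rewrite rep0 mulr0 => h.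
by rewrite subr0 -[rep _]opprK; apply: filN; rewrite -sub0r.
Qed.
Lemma mulcode_neq0 c : (mulcode c != 0) = (c != 0).
Proof. by rewrite -{1}mulcode0 (inj_eq mulcode_inj). Qed.
End Multiplication.

(** Fermat's argument in the residue field, of order Q: multiplying all nonzero classes by a unit x
    permutes them, so x^(Q-1) fixes their product, which is a unit. *)
Lemma residue_fermat x : fl 0 x -> fl 1 (x ^+ Q - x).
Proof.
move=> x0; have [x1|x1] := pselect (fl 1 x).
  apply: filB => //; apply: filS (filX Q x1); rewrite int_mulrn mul1r.
  by have := Q_gt1; lia.
have cong (I : finType) (R : pred I) (f g : I -> F_oo oo) :
    (forall i, fl 0 (f i)) -> (forall i, fl 1 (f i - g i)) ->
    fl 0 (\prod_(i | R i) f i) /\ fl 1 (\prod_(i | R i) f i - \prod_(i | R i) g i).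
  move=> hf hfg; apply: (big_rec2 (fun a b => fl 0 a /\ fl 1 (a - b))).
    by split; [exact: fil1|rewrite subrr; exact: fil0].
  move=> i a b _ [ha hab]; split; first by rewrite -[0]addr0; exact: filM.
  have -> : f i * a - g i * b = f i * (a - b) + (f i - g i) * (a - (a - b)) by ring.
  apply: filD; first by rewrite -[1]add0r; exact: filM.
  rewrite -[1]addr0; apply: filM => //; apply: filB => //; exact: filS hab.
pose P := \prod_(c : code | c != 0) rep c.
have P1 : fl 0 P /\ ~ fl 1 P.
  apply: (big_ind (fun a => fl 0 a /\ ~ fl 1 a)) => [|a b [a0 a1] [b0 b1]|c c0].
  - by split; [exact: fil1|exact: fil_one].
  - split; first by rewrite -[0]addr0; exact: filM.
    by move=> /(fil_cancel a0 a1).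
  - by split; [exact: repA|exact: rep_unit].
have hmul c : fl 0 (x * rep c) by rewrite -[0]addr0; exact: filM.
have [_ h] := cong _ (fun c : code => c != 0) _ _ hmul (mulcodeP x0).
have e1 : \prod_(c : code | c != 0) (x * rep c) = x ^+ Q.-1 * P.
  rewrite big_split /= prodr_const; congr (x ^+ _ * _).
  by rewrite -(cardC1 (0 : code)); apply: eq_card => c; rewrite !inE.
have e2 : \prod_(c : code | c != 0) rep (mulcode x0 c) = P.
  rewrite [RHS](reindex_inj (@mulcode_inj x x0 x1)) /=.
  by apply: eq_bigl => c; rewrite mulcode_neq0.
have {h} : fl 1 (P * (x ^+ Q.-1 - 1)).
  by move: h; rewrite e1 e2 mulrBr mulr1 mulrC.
case: P1 => p0 p1 /(fil_cancel p0 p1) h.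
have -> : x ^+ Q - x = x * (x ^+ Q.-1 - 1).
  by rewrite mulrBr mulr1 -exprS prednK // ltnW.
by rewrite -[1]add0r; exact: filM.
Qed.

Let pow n x : F_oo oo := x ^+ (Q ^ n).
(** Q being a power of q, [pow n] is an iterate of the Frobenius and hence additive. *)
Let powE n x : pow n x = iter (d * n) (frob (const_F_oo oo)) x.
Proof.
have h m : iter m (frob (const_F_oo oo)) x = x ^+ (q ^ m).
  elim: m => [|m IH]; first by rewrite expr1.
  by rewrite iterS IH /frob -exprM -expnSr.
by rewrite h /pow QE expnM.
Qed.
Let powD n x y : pow n (x + y) = pow n x + pow n y.
Proof.
rewrite !powE; elim: (d * n)%N => //= m ->; exact: frobD.
Qed.
Let powM n x y : pow n (x * y) = pow n x * pow n y.
Proof. by rewrite /pow exprMn. Qed.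
Let powN n x : pow n (- x) = - pow n x.
Proof.
have p0 : pow n 0 = 0 by rewrite /pow expr0n gtn_eqF // expn_gt0 ltnW.
by apply/eqP; rewrite -addr_eq0 -powD addNr p0.
Qed.
Let pow_fil n x : fl 1 x -> fl (n%:Z + 1) (pow n x).
Proof.
move=> h; apply: filS (filX (Q ^ n) h); rewrite int_mulrn mul1r.
have : (n < Q ^ n)%N by exact: ltn_expl.
lia.
Qed.

Definition is_teichmuller x y : Prop :=
  forall n, exists N, forall i, (N <= i)%N -> fl n (y - pow i x).

(** The sequence of the x^(Q^i) is Cauchy: by additivity two consecutive terms differ by the Q^i-th
    power of x^Q - x, which has positive order. *)
Lemma teichmuller_exists x : fl 0 x -> exists y, is_teichmuller x y.
Proof.
move=> x0; apply: completion_complete.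
have step i j : fl (i%:Z + 1) (pow (i + j) x - pow i x).
  elim: j => [|j IH]; first by rewrite addn0 subrr; exact: fil0.
  rewrite -[_ - _](subrKA (pow (i + j) x)); apply: filD => //.
  have -> : pow (i + j.+1) x - pow (i + j) x = pow (i + j) (pow 1 x - x).
    by rewrite powD powN /pow -exprM expn1 addnS expnS.
  have h1 : fl 1 (pow 1 x - x) by rewrite /pow expn1; exact: residue_fermat.
  by apply: filS (pow_fil (i + j) h1); lia.
have step' n i j : (`|n| <= i)%N -> (i <= j)%N -> fl n (pow i x - pow j x).
  move=> le le'; rewrite -opprB; apply: filN.
  by rewrite -(subnKC le'); apply: filS (step i (j - i)%N); lia.
move=> n; exists `|n|%N => i j hi hj; case: (leqP i j) => le; first exact: step'.
by rewrite -opprB; apply: filN; apply: step' => //; exact: ltnW.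
Qed.

Lemma teichmuller_unique x x' y y' : is_teichmuller x y -> is_teichmuller x' y' ->
  fl 1 (x - x') -> y = y'.
Proof.
move=> h h' hx; apply/eqP; rewrite -subr_eq0; apply/eqP.
apply: completion_separated => n.
have [N hN] := h n; have [N' hN'] := h' n.
pose i := maxn (maxn N N') `|n|.
have le : [/\ (N <= i)%N, (N' <= i)%N & (`|n| <= i)%N].
  by split; rewrite /i !leq_max leqnn ?orbT.
case: le => le1 le2 le3.
have -> : y - y' = (y - pow i x) - (y' - pow i x') + pow i (x - x').
  by rewrite powD powN; ring.
apply: filD; first by apply: filB; [exact: hN|exact: hN'].
by apply: filS (pow_fil i hx); lia.
Qed.

Lemma teichmullerM x x' y y' : is_teichmuller x y -> is_teichmuller x' y' ->
  fl 0 x -> fl 0 y' -> is_teichmuller (x * x') (y * y').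
Proof.
move=> h h' hx hy' n.
have [N hN] := h n; have [N' hN'] := h' n.
exists (maxn N N') => i; rewrite geq_max => /andP[le le'].
have -> : y * y' - pow i (x * x') = (y - pow i x) * y' + pow i x * (y' - pow i x').
  by rewrite powM; ring.
apply: filD; first by rewrite -[n]addr0; apply: filM => //; exact: hN.
rewrite -[n]add0r; apply: filM; last exact: hN'.
by have := filX (Q ^ i) hx; rewrite mul0rn.
Qed.

Lemma teichmuller_residue x y : fl 0 x -> is_teichmuller x y -> fl 1 (y - x).
Proof.
move=> x0 h; have [N hN] := h 1.
have : fl 1 (pow N x - x).
  elim: N {hN} => [|N IH]; first by rewrite /pow expr1 subrr; exact: fil0.
  have -> : pow N.+1 x - x = pow N (pow 1 x - x) + (pow N x - x).
    by rewrite powD powN /pow -exprM expn1 -expnS addrA subrK.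
  apply: filD => //; have h1 : fl 1 (pow 1 x - x).
    by rewrite /pow expn1; exact: residue_fermat.
  by apply: filS (pow_fil N h1); lia.
move=> h1; rewrite -[_ - _](subrKA (pow N x)); apply: filD => //.
exact: hN.
Qed.

Definition teichmuller (c : code) : F_oo oo :=
  projT1 (cid (teichmuller_exists (repA c))).
Let teichmullerP c : is_teichmuller (rep c) (teichmuller c).
Proof. exact: (projT2 (cid (teichmuller_exists (repA c)))). Qed.

Lemma teichmuller_integral c : fl 0 (teichmuller c).
Proof.
rewrite -[teichmuller c](subrK (rep c)); apply: filD; last exact: repA.
by apply: filS (teichmuller_residue (repA c) (teichmullerP c)).
Qed.

Lemma teichmuller_neq0 c : c != 0 -> teichmuller c != 0.
Proof.
move=> /rep_unit h; apply/eqP => e0; apply: h.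
have := teichmuller_residue (repA c) (teichmullerP c).
by rewrite e0 sub0r => /filN; rewrite opprK.
Qed.

Lemma teichmullerV_integral c : c != 0 -> fl 0 (teichmuller c)^-1.
Proof.
move=> /rep_unit h.
have h1 : ~ fl 1 (teichmuller c).
  move=> h1; apply: h; have := filB h1 (teichmuller_residue (repA c) (teichmullerP c)).
  by rewrite subKr.
by have [] := F_oo_unit (teichmuller_integral c) h1.
Qed.

Lemma teichmuller_shift b : b != 0 -> exists f : code -> code,
  [/\ injective f, forall c, (f c != 0) = (c != 0) &
      forall c, teichmuller b * teichmuller c = teichmuller (f c)].
Proof.
move=> b0; exists (mulcode (repA b)); split.
- by apply: mulcode_inj; exact: rep_unit.
- by move=> c; apply: mulcode_neq0; exact: rep_unit.
move=> c; apply: (teichmuller_unique _ (teichmullerP _) (mulcodeP (repA b) c)).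
exact: (teichmullerM (teichmullerP b) (teichmullerP c) (repA b) (teichmuller_integral c)).
Qed.

Lemma teichmuller_span : exists g : 'I_d -> code, (forall j, g j != 0) /\
  forall x, fl 0 x -> exists c : 'I_d -> k,
    fl 1 (x - \sum_j const_F_oo oo (c j) * teichmuller (g j)).
Proof.
pose g (j : 'I_d) : code := [ffun l => if l == j then 1 else 0].
have repg j : rep (g j) = e j.
  rewrite /rep (bigD1 j) //= big1 ?addr0 => [|l /negbTE lj].
    by rewrite ffunE eqxx rmorph1 mul1r.
  by rewrite ffunE lj rmorph0 mul0r.
exists g; split=> [j|x hx].
  by apply/eqP => /ffunP /(_ j); rewrite !ffunE eqxx => /eqP; rewrite oner_eq0.
have [c [hc _]] := res_exists hx; exists c.
rewrite -[_ - _](subrKA (rep c)); apply: filD => //.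
rewrite /rep -sumrB.
have := subspace_comb c (subspace_fil oo 1)
  (fun j => filN (teichmuller_residue (repA (g j)) (teichmullerP (g j)))).
congr (fl 1 _); apply: eq_bigr => j _.
by rewrite opprB repg mulrBr.
Qed.

(** There are Q - 1 nonzero codes and Q = 0 in characteristic p. The sign is compensated in
    [average]. *)
Lemma card_teichmuller : \sum_(c : code | c != 0) (1 : F_oo oo) = -1.
Proof.
have k0 : (q%:R : k) = 0.
  have : \sum_(x : k) x = \sum_(x : k) (x + 1) by exact: (reindex_inj (addIr 1)).
  rewrite big_split /= -[LHS]addr0 => /addrI /esym.
  by rewrite sumr_const.
have Q0 : Q%:R = 0 :> F_oo oo.
  rewrite QE -(rmorph_nat (const_F_oo oo)) natrX k0 expr0n.
  by rewrite eqn0Ngt d_oo_gt0 rmorph0.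
rewrite sumr_const; apply/eqP; rewrite -addr_eq0 -mulrSr; apply/eqP.
rewrite -[RHS]Q0; congr (_ *+ _); rewrite -(prednK (ltnW Q_gt1)) /Q.
congr (_.+1); rewrite -(cardC1 (0 : code)).
by apply: eq_card => c; rewrite !inE.
Qed.
End Teichmuller.

(** * The ring E_F *)

Section TwistedDegree.
Variables (k : finFieldType) (R : idomainType) (iR : {rmorphism k -> R}).

Lemma frob_iter n (x : R) : iter n (frob iR) x = x ^+ (#|k| ^ n).
Proof.
elim: n => [|n IH]; first by rewrite expr1.
by rewrite iterS IH /frob -exprM -expnSr.
Qed.

Lemma size_twist n (s : {poly R}) : size (twist iR n s) = size s.
Proof.
elim: n => //= n IH; rewrite size_map_inj_poly //; last exact: rmorph0.
move=> x y /eqP; rewrite -subr_eq0 -rmorphB /frob expf_eq0 => /andP[_].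
by rewrite subr_eq0 => /eqP.
Qed.

Lemma coef_twist n (s : {poly R}) j : (twist iR n s)`_j = s`_j ^+ (#|k| ^ n).
Proof.
rewrite -frob_iter; elim: n => //= n IH.
by rewrite coef_map_id0 ?rmorph0 // IH.
Qed.

Lemma size_tp_mul_leq (p s : {poly R}) :
  (size (@tp_mul k R iR p s : {poly R}) <= (size p + size s).-1)%N.
Proof.
rewrite /tp_mul; apply: leq_trans (size_sum _ _ _) _; apply/bigmax_leqP => i _.
apply: leq_trans (size_scale_leq _ _) _; have [->|s0] := eqVneq s 0.
  by rewrite twist0 mul0r size_poly0.
rewrite size_mulXn -?size_poly_eq0 ?size_twist ?size_poly_eq0 //.
move: (ltn_ord i); move: (nat_of_ord i) => j; case: (size p) => // n.
by rewrite ltnS addSn leq_add2r.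
Qed.

Lemma tp_mul_lead (p s : {poly R}) n m : size p = n.+1 -> size s = m.+1 ->
  (@tp_mul k R iR p s : {poly R})`_(n + m) = p`_n * s`_m ^+ (#|k| ^ n).
Proof.
move=> szp szs; rewrite (@tp_mulE k R iR n.+1) ?szp // coef_sum big_ord_recr /=.
rewrite big1 ?add0r => [|i _].
  by rewrite coefZ coefMXn ltnNge leq_addr /= addKn coef_twist.
rewrite coefZ coefMXn; case: ltnP => _; first by rewrite mulr0.
rewrite [(twist _ _ _)`__]nth_default ?mulr0 // size_twist szs.
by have := ltn_ord i; lia.
Qed.

Lemma size_tp_mul (p s : {poly R}) : p != 0 -> s != 0 ->
  size (@tp_mul k R iR p s : {poly R}) = (size p + size s).-1.
Proof.
move=> p0 s0; apply/eqP; rewrite eqn_leq size_tp_mul_leq /=.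
have szp : size p = (size p).-1.+1 by rewrite prednK // lt0n size_poly_eq0.
have szs : size s = (size s).-1.+1 by rewrite prednK // lt0n size_poly_eq0.
rewrite [in X in (X <= _)%N]szp [in X in (X <= _)%N]szs addSn addnS /=.
rewrite ltnNge; apply/negP => /leq_sizeP /(_ _ (leqnn _)) /eqP.
rewrite (tp_mul_lead szp szs) mulf_eq0 -!lead_coefE lead_coef_eq0 (negPf p0) /=.
by rewrite expf_eq0 lead_coef_eq0 (negPf s0) andbF.
Qed.
End TwistedDegree.

(** * The embeddings of F_oo and R in E_F, and approximation by finite sums *)

Section FormalCoefficients.
Variables (k : finFieldType) (F : fieldType) (iF : {rmorphism k -> F}).
Variables (oo : place iF) (R : idomainType) (iR : {rmorphism k -> R}).
Local Notation fl := (F_oo_fil oo).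
Local Notation E := (E_F oo iR).
Local Notation Ef := (completed_filtration (FR_filtration oo iR)).
Local Notation em := (F_oo_to_E iR).
Local Notation pt := (ptensor (const_F_oo oo) iR).

Definition cst (xi : R) : E := to_completion (FR_filtration oo iR) (pt 1 xi).

Lemma em_zmod : zmod_morphism (em : F_oo oo -> E).
Proof.
have [h1 _ _] := ptensor_balanced (const_F_oo oo) iR.
move=> x y; rewrite /F_oo_to_E -rmorphB; congr (to_completion _ _).
by rewrite -ptensorN -h1.
Qed.
Lemma em_monoid : monoid_morphism (em : F_oo oo -> E).
Proof.
split; first by rewrite /F_oo_to_E ptensor11 rmorph1.
by move=> x y; rewrite /F_oo_to_E -rmorphM ptensorM mulr1.
Qed.
HB.instance Definition _ := GRing.isZmodMorphism.Build _ _ (em : F_oo oo -> E) em_zmod.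
HB.instance Definition _ := GRing.isMonoidMorphism.Build _ _ (em : F_oo oo -> E) em_monoid.

Lemma cst_zmod : zmod_morphism cst.
Proof.
have [_ h2 _] := ptensor_balanced (const_F_oo oo) iR.
move=> x y; apply: (addIr (cst y)); rewrite subrK /cst -rmorphD; congr (to_completion _ _).
by rewrite -h2 subrK.
Qed.
Lemma cst_monoid : monoid_morphism cst.
Proof.
split; first by rewrite /cst ptensor11 rmorph1.
by move=> x y; rewrite /cst -rmorphM ptensorM mulr1.
Qed.
HB.instance Definition _ := GRing.isZmodMorphism.Build _ _ cst cst_zmod.
HB.instance Definition _ := GRing.isMonoidMorphism.Build _ _ cst cst_monoid.

Lemma em_const c : em (const_F_oo oo c) = cst (iR c).
Proof.
have [_ _ h3] := ptensor_balanced (const_F_oo oo) iR.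
rewrite /F_oo_to_E /cst; congr (to_completion _ _).
by have := h3 1 c 1; rewrite mul1r mulr1.
Qed.
Lemma to_E_pt a xi : to_completion (FR_filtration oo iR) (pt a xi) = em a * cst xi.
Proof. by rewrite /F_oo_to_E /cst -rmorphM ptensorM mulr1 mul1r. Qed.
Lemma Ef_em n a : fl n a -> Ef n (em a).
Proof. by move=> h; apply/cfil_to_completion; exact: FR_order_ge_pure. Qed.
Lemma Ef_cst xi : Ef 0 (cst xi).
Proof. by apply/cfil_to_completion; apply: FR_order_ge_pure; exact: fil1. Qed.

Lemma Ef_expand n m e : Ef n e -> exists s : seq (F_oo oo * R),
  (forall p, p \in s -> fl n p.1) /\ Ef m (e - \sum_(p <- s) em p.1 * cst p.2).
Proof.
move=> he; have [b hb] := completion_dense e (Order.max n m).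
have : Ef n (to_completion (FR_filtration oo iR) b).
  have := filB he (filS (m := n) _ hb).
  by rewrite subKr; apply; rewrite le_max lexx.
move/cfil_to_completion => [s [hs eb]]; exists s; split=> //.
have -> : \sum_(p <- s) em p.1 * cst p.2 = to_completion (FR_filtration oo iR) b.
  by rewrite eb rmorph_sum; apply: eq_bigr => p _ /=; rewrite to_E_pt.
by apply: filS hb; rewrite le_max lexx orbT.
Qed.

Lemma Ef_sum n (I : Type) (s : seq I) (P : pred I) (G : I -> E) :
  (forall i, P i -> Ef n (G i)) -> Ef n (\sum_(i <- s | P i) G i).
Proof.
by move=> h; apply: big_ind => //; [exact: fil0|move=> x y; exact: filD].
Qed.

Lemma sigma_em a : sigma oo iR (em a) = em a.
Proof. by rewrite /F_oo_to_E sigma_cst FR_sigma_pure expr1n. Qed.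
Lemma sigma_cstE xi : sigma oo iR (cst xi) = cst (xi ^+ #|k|).
Proof. by rewrite /cst sigma_cst FR_sigma_pure. Qed.
Lemma Ef_sigma n e : Ef n e -> Ef n (sigma oo iR e).
Proof.
elim/completion_ind: e => u hu /cfil_limit [N hN].
rewrite [sigma oo iR _]completion_mapE; apply/cfil_limit.
by exists N => i /hN; exact: FR_sigma_filtered.
Qed.

Lemma AR_to_E_ptensor a xi : AR_to_E oo iR (ptensor _ _ a xi) =
  em (regular_F_oo oo a) * cst xi.
Proof. by rewrite AR_to_E_pure to_E_pt. Qed.
End FormalCoefficients.

(** * Degrees in the motive *)

(* Germs receive balanced maps out of the isocrystal: an element of E_F acts  *)
(* on a twisted polynomial only up to bounded degree, once multiplied by a^N  *)
(* and approximated in A (x) R, and large N magnify the differences of degree.*)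
Section BoundedSequences.
Variable R : nzRingType.

Definition bounded_seq : {pred nat -> {poly R}} :=
  fun u => `[< exists K, forall N, (size (u N) <= K)%N >].

Fact bounded_seq_closed : zmod_closed bounded_seq.
Proof.
split=> [|u v /asboolP [K hK] /asboolP [K' hK']]; apply/asboolP.
  by exists 0%N => N; rewrite size_poly0.
exists (maxn K K') => N; apply: leq_trans (size_polyD _ _) _.
by rewrite size_polyN geq_max !leq_max hK hK' orbT.
Qed.
HB.instance Definition _ := GRing.isZmodClosed.Build (nat -> {poly R})
  bounded_seq bounded_seq_closed.

Lemma bounded_seqP (u : nat -> {poly R}) :
  reflect (exists K, forall N, (size (u N) <= K)%N) (u \in bounded_seq).
Proof. exact: asboolP. Qed.

Local Notation germs := (Quotient.quot (bounded_seq : zmodClosed _)).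
Definition germ (u : nat -> {poly R}) : germs := \pi_germs u.

Lemma germD u v : germ (fun N => u N + v N) = germ u + germ v.
Proof. exact: (Quotient.pi_add (bounded_seq : zmodClosed _) u v). Qed.
Lemma germ_sum (I : Type) (s : seq I) (u : I -> nat -> {poly R}) :
  \sum_(i <- s) germ (u i) = germ (fun N => \sum_(i <- s) u i N).
Proof.
elim: s => [|i s IH].
  rewrite big_nil; apply: (addrI (germ 0)); rewrite -germD addr0.
  by congr germ; apply/funext => N; rewrite big_nil addr0.
rewrite big_cons IH -germD; congr germ.
by apply/funext => N; rewrite big_cons.
Qed.
Lemma germ_eq u v : germ u = germ v <->
  exists K, forall N, (size (u N - v N)%R <= K)%N.
Proof.
rewrite /germ; split=> [/eqP|h].
  by rewrite -Quotient.idealrBE => /bounded_seqP.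
by apply/eqP; rewrite -Quotient.idealrBE; apply/bounded_seqP.
Qed.
End BoundedSequences.

(** * Degree bounds for the action of A tensor R on the motive *)

Section MotiveDegree.
Variables (k : finFieldType) (F : fieldType) (iF : {rmorphism k -> F}).
Hypothesis hF : function_field iF.
Variables (oo : place iF) (R : idomainType) (iR : {rmorphism k -> R}).
Variables (r : nat) (phi : drinfeld_module oo iR r).
Local Notation fl := (F_oo_fil oo).
Local Notation E := (E_F oo iR).
Local Notation Ef := (completed_filtration (FR_filtration oo iR)).
Local Notation em := (F_oo_to_E iR).
Local Notation M := (A_motive phi).
Local Notation AR := (AR oo iR).
Local Notation D := (r * d_oo oo)%N.
Local Notation toE := (AR_to_E oo iR).
Local Notation pair := (ptensor (const_regular_ring oo) iR).

Definition act (m : {poly R}) (a : regular_ring oo) : {poly R} :=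
  @tp_mul k R iR m (phi a).

Lemma motive_scaleE a xi (m : M) :
  ((pair a xi : AR) *: m : {poly R}) = xi *: act m a.
Proof.
rewrite [LHS](motive_scale_pure a xi m).
by rewrite -mulrA tp_constE.
Qed.

Lemma actDr m a b : act m (a + b) = act m a + act m b.
Proof. by rewrite /act rmorphD tp_mulDr. Qed.
Lemma actBr m a b : act m (a - b) = act m a - act m b.
Proof. by apply: (addIr (act m b)); rewrite -actDr !subrK. Qed.
Lemma act0r m : act m 0 = 0.
Proof. by rewrite -[X in act m X](subrr 0) actBr subrr. Qed.
Lemma act0l a : act 0 a = 0.
Proof. exact: tp_mul0l. Qed.
Lemma act_const m a c : act m (a * const_regular_ring oo c) = iR c *: act m a.
Proof.
rewrite /act rmorphM dm_const -[tp_mul _ _]/((m : twisted_poly iR) * _).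
by rewrite mulrA -tp_const_central tp_constE.
Qed.

Lemma size_phi a : a != 0 -> size (phi a : {poly R}) = (D * `|oo (val a)|).+1.
Proof.
by move=> a0; have [-> _] := dm_degree phi a0; rewrite deg_AE // mulnA.
Qed.

Lemma size_act m a : m != 0 -> a != 0 ->
  size (act m a) = (size m + D * `|oo (val a)|)%N.
Proof.
move=> m0 a0; rewrite size_tp_mul ?size_phi ?addnS // -size_poly_eq0.
by rewrite size_phi.
Qed.

Lemma size_act_leq m a (c : nat) : order_ge oo (- c%:Z) (val a) ->
  (size (act m a) <= size m + D * c)%N.
Proof.
have [->|a0] := eqVneq a 0; first by rewrite act0r size_poly0.
have [->|m0] := eqVneq m 0; first by rewrite act0l size_poly0.
have va0 : val a != 0 by rewrite -(rmorph0 (regular_incl oo)) (inj_eq val_inj).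
move=> /(order_ge_neq0 _ _ va0) h; rewrite size_act // leq_add2l leq_mul2l.
have := regular_val_le0 hF (regular_ringP a) va0.
by move=> h2; apply/orP; right; rewrite -lez_nat abszE ler0_norm // lerNl.
Qed.

(** The constant B such that A meets every class of F_oo modulo elements of order at least -B. It
    bounds all errors of approximation below. *)
Definition precision : nat := projT1 (cid (regular_approximation hF oo)).
Local Notation B := precision.

Lemma precision_approximation (n : nat) f : (B <= n)%N -> fl (- n%:Z) f ->
  exists a : regular_ring oo,
    order_ge oo (- n%:Z) (val a) /\ fl (- B%:Z) (f - regular_F_oo oo a).
Proof.
move=> le hf.
have [x [hx ox fx]] := projT2 (cid (regular_approximation hF oo)) n f le hf.
by have [a ea] := regular_ring_exists hx; exists a; rewrite /= ea.
Qed.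

Lemma precision_approximation_exists f :
  exists a : regular_ring oo, fl (- B%:Z) (f - regular_F_oo oo a).
Proof.
have [n hn] := fil_exhaustive fl f.
have [||a [_ h]] := @precision_approximation (B + `|n|)%N f; first exact: leq_addr.
  by apply: filS hn; lia.
by exists a.
Qed.

(* Modulo degree size m + D c, an element of A acts on m through its class    *)
(* modulo the elements of order >= -c, and F_oo = A + m_oo^(-c).              *)
Lemma motive_scale_size (y : AR) (m : M) (c : nat) : (B <= c)%N ->
  Ef (- c%:Z) (toE y) -> (size (y *: m : {poly R}) <= size (m : {poly R}) + D * c)%N.
Proof.
move=> le /cfil_to_completion hy.
have approx f : exists a : regular_ring oo, fl (- c%:Z) (f - regular_F_oo oo a).
  have [a ha] := precision_approximation_exists f.
  by exists a; apply: filS ha; lia.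
pose al f := projT1 (cid (approx f)).
have alP f : fl (- c%:Z) (f - regular_F_oo oo (al f)).
  exact: (projT2 (cid (approx f))).
pose K := (size (m : {poly R}) + D * c)%N.
have drop0 (p : {poly R}) : (size p <= K)%N -> drop_poly K p = 0.
  exact: drop_poly_eq0.
have small a : fl (- c%:Z) (regular_F_oo oo a) -> drop_poly K (act m a) = 0.
  by move=> /fil_emb h; apply: drop0; exact: size_act_leq.
have near f a : fl (- c%:Z) (f - regular_F_oo oo a) ->
    drop_poly K (act m (al f)) = drop_poly K (act m a).
  move=> h; apply/eqP; rewrite -subr_eq0 -raddfB -actBr; apply/eqP/small.
  rewrite rmorphB; have := filB h (alP f).
  by rewrite opprB addrC addrA subrK.
pose b (f : F_oo oo) (xi : R) : {poly R} := drop_poly K (xi *: act m (al f)).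
have bE f xi : b f xi = xi *: drop_poly K (act m (al f)).
  exact: linearZ.
have hb : tr_balanced (const_F_oo oo) iR b.
  split=> [f g xi|f xi eta|f s xi]; rewrite !bE.
  - rewrite -scalerDr -raddfD -actDr; congr (_ *: _); apply: near.
    have := filD (alP f) (alP g); congr (fl _ _).
    by rewrite rmorphD opprD addrACA.
  - exact: scalerDl.
  rewrite (near _ (al f * const_regular_ring oo s)).
    by rewrite act_const linearZ scalerA mulrC.
  rewrite rmorphM -[X in fl _ (_ - _ * X)]/(const_F_oo oo s) -mulrBl.
  have := filM (alP f) (_ : fl 0 (const_F_oo oo s)); rewrite addr0; apply.
  by apply/fil_emb; exact: order_ge_const.
have kill (x : FR oo iR) : FR_order_ge (- c%:Z) x -> tr_lift b x = 0.
  move=> [s [hs ->]].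
  rewrite (big_morph (tr_lift b) (tr_liftD hb) (tr_lift0 hb)).
  rewrite big_seq big1 // => p ps; rewrite tr_lift_pure // bE (near _ 0).
    by rewrite act0r raddf0 scaler0.
  by rewrite rmorph0 subr0; exact: hs.
have : drop_poly K (y *: m : {poly R}) = tr_lift b (AR_to_FR oo iR y).
  elim/tr_ind: y {hy} => [x x' hx hx'||a xi].
  - rewrite rmorphD (tr_liftD hb) -hx -hx' -raddfD; congr (drop_poly K _).
    exact: (motive_scaleD (phi := phi) m x x').
  - rewrite rmorph0 (tr_lift0 hb) -[RHS](raddf0 (drop_poly K)).
    by congr (drop_poly K _); exact: (motive_scale0 (phi := phi) m).
  have -> : AR_to_FR oo iR (pair a xi) =
      ptensor (const_F_oo oo) iR (regular_F_oo oo a) xi.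
    exact: (tensor_map_pure (f := const_regular_ring oo) (f' := const_F_oo oo)
      (h1 := regular_F_oo oo) (h2 := idfun) (fun=> erefl) (fun=> erefl) a xi).
  rewrite (tr_lift_pure _ _ hb) bE motive_scaleE.
  rewrite linearZ (near _ a) // subrr; exact: fil0.
rewrite kill // => e; rewrite leqNgt; apply/negP => lt.
have := size_drop_poly K (y *: m : {poly R}); rewrite e size_poly0.
by move/esym/eqP; rewrite subn_eq0 leqNgt lt.
Qed.

Lemma toE_approximation (e : E) : exists y : AR, Ef (- B%:Z) (e - toE y).
Proof.
have [n hn] := fil_exhaustive Ef e.
have [s [_ hs]] := Ef_expand (- B%:Z) hn.
pose al f := projT1 (cid (precision_approximation_exists f)).
have alP f : fl (- B%:Z) (f - regular_F_oo oo (al f)).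
  exact: (projT2 (cid (precision_approximation_exists f))).
exists (\sum_(p <- s) pair (al p.1) p.2).
rewrite -[_ - _](subrKA (\sum_(p <- s) em p.1 * cst oo iR p.2)); apply: filD => //.
rewrite rmorph_sum -sumrB; apply: Ef_sum => p _.
rewrite AR_to_E_ptensor -mulrBl -rmorphB -[- B%:Z]addr0.
by apply: filM; [exact: Ef_em|exact: Ef_cst].
Qed.

Lemma motive_scale_bounded (y : AR) (c : int) : Ef c (toE y) ->
  forall m : M, (size (y *: m : {poly R}) <= size (m : {poly R}) + D * (B + `|c|))%N.
Proof.
move=> hy m; apply: motive_scale_size; first exact: leq_addr.
by apply: filS hy; lia.
Qed.

Section Detection.
Variables (a : regular_ring oo) (ha : oo (val a) < 0).
Let n := `|oo (val a)|%N.
Let a0 : a != 0.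
Proof. by apply/eqP => e; move: ha; rewrite e val_at0. Qed.
Let aE : toE (pair a 1) = em (regular_F_oo oo a).
Proof. by rewrite AR_to_E_ptensor rmorph1 mulr1. Qed.
Let A N : AR := (pair a 1 : AR) ^+ N.
Let AEf N : Ef (- (n * N)%:Z) (toE (A N)).
Proof.
rewrite rmorphXn aE; elim: N => [|N IH]; first by rewrite muln0 expr0; exact: fil1.
have -> : - (n * N.+1)%:Z = oo (val a) + - (n * N)%:Z by rewrite /n; lia.
rewrite exprS; apply: filM => //; apply: Ef_em; apply: fil_val.
by rewrite -(rmorph0 (regular_incl oo)) (inj_eq val_inj).
Qed.
Let A_scale N (m : M) : m != 0 ->
  size (A N *: m : {poly R}) = (size (m : {poly R}) + D * (n * N))%N.
Proof.
move=> m0; elim: N => [|N IH].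
  by rewrite /A expr0 !muln0 addn0 scale1r.
have AS : A N.+1 *: m = (pair a 1 : AR) *: (A N *: m) :> M.
  by rewrite /A exprS scalerA.
have s0 : (A N *: m : {poly R}) != 0.
  by rewrite -size_poly_eq0 IH addn_eq0 size_poly_eq0 negb_and m0.
by rewrite AS motive_scaleE scale1r size_act // IH -/n; lia.
Qed.

(** An element of A tensor R agreeing with a^N e up to order -B. It can act on the motive, whereas e
    itself cannot. *)
Let Y (e : E) N : AR := projT1 (cid (toE_approximation (toE (A N) * e))).
Let YP e N : Ef (- B%:Z) (toE (A N) * e - toE (Y e N)).
Proof. exact: (projT2 (cid (toE_approximation (toE (A N) * e)))). Qed.

Let W := Quotient.quot (@bounded_seq R : zmodClosed _).
Let b (e : E) (m : M) : W := germ (fun N => Y e N *: m : {poly R}).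

(** The identities hold for the approximations [Y] up to elements whose order is bounded below
    independently of N. Such elements act with bounded degree and vanish in the germs. *)
Let balancedY : balanced toE b.
Proof.
have diff (y : nat -> AR) (c : int) : (forall N, Ef c (toE (y N))) ->
    forall m : M, exists K, forall N, (size (y N *: m : {poly R}) <= K)%N.
  move=> h m; eexists => N; exact: motive_scale_bounded (h N) m.
split=> [e f m|e m m'|e s m]; rewrite /b -?germD; apply/germ_eq.
- have [N|K hK] := @diff (fun N => Y (e + f) N - (Y e N + Y f N)) (- B%:Z) _ m.
    have := filB (filD (YP e N) (YP f N)) (YP (e + f) N); congr (Ef _ _).
    by rewrite rmorphB rmorphD; ring.
  exists K => N; apply: leq_trans (hK N); rewrite eq_leq //; congr (size _).
  by rewrite scalerBl scalerDl.
- exists 0%N => N; rewrite scalerDr subrr size_poly0 //.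
have [c0 hc0] := fil_exhaustive Ef (toE s).
pose c := Order.min c0 0.
have hc : Ef c (toE s) by apply: filS hc0; rewrite ge_min lexx.
have [N|K hK] := @diff (fun N => Y (e * toE s) N - Y e N * s) (- B%:Z + c) _ m.
  have h1 := filM (YP e N) hc.
  have h2 : Ef (- B%:Z + c) (toE (A N) * (e * toE s) - toE (Y (e * toE s) N)).
    by apply: filS (YP _ N); rewrite /c; lia.
  have := filB h1 h2; congr (Ef _ _).
  by rewrite rmorphB rmorphM; ring.
exists K => N; apply: leq_trans (hK N); rewrite eq_leq //; congr (size _).
by rewrite scalerBl scalerA.
Qed.

Let Y_size e N (nu : int) (m : M) : Ef nu e -> (B + `|nu| <= N)%N ->
  (size (Y e N *: m : {poly R}))%:Z <=
  (size (m : {poly R}))%:Z + D%:Z * ((n * N)%:Z - nu).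
Proof.
move=> he leN; have n0 : (0 < n)%N by rewrite /n; lia.
have leN' : (N <= n * N)%N by rewrite leq_pmull.
have hc : (B%:Z <= (n * N)%:Z - nu) by lia.
have ec : (n * N)%:Z - nu = `|(n * N)%:Z - nu|%N by lia.
rewrite ec -PoszM -PoszD lez_nat; apply: motive_scale_size; first by lia.
have h1 := filM (AEf N) he.
have h2 : Ef (- (n * N)%:Z + nu) (toE (A N) * e - toE (Y e N)).
  by apply: filS (YP e N); lia.
by have := filB h1 h2; rewrite subKr; apply: filS; lia.
Qed.

(** Apply the balanced map e, m |-> germ of [Y e N *: m] to the relation. For m nonzero the left
    side has size [size m] + D n N up to a bounded error. On the right every term is strictly
    smaller for large N, and D n N outgrows the bounded error. *)
Lemma pure_detect (u : seq (E * M)) (m : M) : (0 < r)%N ->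
  (forall p, p \in u -> exists nu : int, Ef nu p.1 /\
     (size (p.2 : {poly R}))%:Z - D%:Z * nu < (size (m : {poly R}))%:Z) ->
  pure_tensor toE 1 m = \sum_(p <- u) pure_tensor toE p.1 p.2 -> m = 0.
Proof.
move=> r0 hu e; apply/eqP; apply: contraT => m0.
have D0 : (0 < D)%N by rewrite muln_gt0 r0 (d_oo_gt0 hF).
have n0 : (0 < n)%N by rewrite /n; lia.
pose S N : {poly R} := \sum_(p <- u) (Y p.1 N *: p.2 : {poly R}).
have [K1 hK1] : exists K, forall N, (size ((Y 1 N *: m : {poly R}) - S N)%R <= K)%N.
  apply/germ_eq; transitivity (\sum_(p <- u) b p.1 p.2); last exact: germ_sum.
  have e' := congr1 (tensor_lift b) e; rewrite (tensor_lift_pure balancedY) in e'.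
  rewrite (big_morph _ (tensor_liftD balancedY) (tensor_lift0 balancedY)) in e'.
  apply: etrans e' _; apply: eq_bigr => p _; exact: (tensor_lift_pure balancedY).
have hK2 N : (size ((A N *: m : {poly R}) - (Y 1 N *: m : {poly R}))%R <=
    size (m : {poly R}) + D * (B + `|- B%:Z|))%N.
  have := YP 1 N; rewrite mulr1 -rmorphB => /motive_scale_bounded /(_ m).
  by rewrite scalerBl.
have [N0 hN0] : exists N0, forall N, (N0 <= N)%N -> forall p, p \in u ->
    (size (Y p.1 N *: p.2 : {poly R}) < size (m : {poly R}) + D * (n * N))%N.
  elim: u hu {e S K1 hK1} => [|p u IH] hu; first by exists 0%N.
  have [|N1 hN1] := IH; first by move=> p' hp'; apply: hu; rewrite inE hp' orbT.
  have [nu [hnu lt]] := hu p (mem_head _ _).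
  exists (maxn N1 (B + `|nu|)) => N; rewrite geq_max => /andP[le1 le2] p'.
  rewrite inE => /orP[/eqP ->|]; last exact: hN1.
  rewrite -ltz_nat PoszD; apply: le_lt_trans (Y_size p.2 hnu le2) _.
  by rewrite mulrBr -PoszM addrA addrAC ltrD2r.
pose K2 := (size (m : {poly R}) + D * (B + `|- B%:Z|))%N.
(* Beyond N0 the right side is dominated; exceeding K1 and K2 makes D n N larger than both error
   bounds. *)
pose N := (N0 + K1 + K2).+1.
have leN : (N0 <= N)%N by rewrite /N; lia.
have sS : (size (S N) < size (A N *: m : {poly R}))%N.
  rewrite A_scale // /S; elim: (u) (hN0 N leN) => [|p v IH] hv.
    by rewrite big_nil size_poly0 addn_gt0 lt0n size_poly_eq0 m0.
  rewrite big_cons; apply: leq_ltn_trans (size_polyD _ _) _.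
  rewrite gtn_max hv ?mem_head //= IH // => p' hp'.
  by apply: hv; rewrite inE hp' orbT.
have big : size ((A N *: m : {poly R}) - S N) = size (A N *: m : {poly R}).
  by rewrite size_polyDl // size_polyN.
have : (size ((A N *: m : {poly R}) - S N)%R <= maxn K2 K1)%N.
  rewrite -(subrKA (Y 1 N *: m : {poly R})).
  apply: leq_trans (size_polyD _ _) _.
  by rewrite geq_max !leq_max hK2 hK1 orbT.
rewrite big A_scale // leq_max.
have : (N <= D * (n * N))%N by rewrite mulnA leq_pmull // muln_gt0 D0.
by rewrite /N; lia.
Qed.
End Detection.
End MotiveDegree.

(** * The degree filtration of the isocrystal *)

Section DegreeFiltration.
Variables (k : finFieldType) (F : fieldType) (iF : {rmorphism k -> F}).
Hypothesis hF : function_field iF.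
Variables (oo : place iF) (R : idomainType) (iR : {rmorphism k -> R}).
Variables (r : nat) (hr : (0 < r)%N) (phi : drinfeld_module oo iR r).
Local Notation fl := (F_oo_fil oo).
Local Notation E := (E_F oo iR).
Local Notation Ef := (completed_filtration (FR_filtration oo iR)).
Local Notation em := (F_oo_to_E iR).
Local Notation cs := (cst oo iR).
Local Notation M := (A_motive phi).
Local Notation N := (motive_isocrystal phi).
Local Notation AR := (AR oo iR).
Local Notation D := (r * d_oo oo)%N.
Local Notation toE := (AR_to_E oo iR).
Local Notation pair := (ptensor (const_regular_ring oo) iR).
Local Notation B := (precision hF oo).
Local Notation act := (@act _ _ _ _ _ _ _ phi).

Definition pt (e : E) (m : {poly R}) : N := pure_tensor toE e (m : M).
Definition taup (i : nat) : N := pt 1 'X^i.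

Lemma D_gt0 : (0 < D)%N.
Proof. by rewrite muln_gt0 hr (d_oo_gt0 hF). Qed.

Lemma ptDr e m m' : pt e (m + m') = pt e m + pt e m'.
Proof. by case: (pure_balanced toE M) => _ h _; exact: h. Qed.
Lemma pt_scale e f m : e *: pt f m = pt (e * f) m.
Proof. exact: scale_pure. Qed.
Lemma pt1 e m : pt e m = e *: pt 1 m.
Proof. by rewrite pt_scale mulr1. Qed.
Lemma pt_act e xi m a : pt e (xi *: act m a) = pt (e * (em (regular_F_oo oo a) * cs xi)) m.
Proof.
case: (pure_balanced toE M) => _ _ h; rewrite -AR_to_E_ptensor /pt h.
by congr (pure_tensor _ _ _); rewrite -[LHS]motive_scaleE.
Qed.
Lemma pt_act1 m a : pt 1 (act m a) = em (regular_F_oo oo a) *: pt 1 m.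
Proof. by rewrite -[act m a]scale1r pt_act pt_scale rmorph1 !mulr1 mul1r. Qed.
Lemma act1r m : act m 1 = m.
Proof. by rewrite -[act m 1]/(tp_mul m (phi 1)) rmorph1; exact: tp_mul1r. Qed.
Lemma pt_cst e xi m : pt e (xi *: m) = cs xi *: pt e m.
Proof.
by rewrite -{1}[m]act1r pt_act !rmorph1 mul1r pt_scale mulrC.
Qed.
Lemma ptBr e m m' : pt e (m - m') = pt e m - pt e m'.
Proof. by apply: (addIr (pt e m')); rewrite -ptDr !subrK. Qed.
Lemma pt0r e : pt e 0 = 0.
Proof. by rewrite -[X in pt e X](subrr 0) ptBr subrr. Qed.
Lemma pt_sum e (I : Type) (s : seq I) (P : pred I) (G : I -> {poly R}) :
  pt e (\sum_(i <- s | P i) G i) = \sum_(i <- s | P i) pt e (G i).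
Proof. exact: (big_morph (pt e) (ptDr e) (pt0r e)). Qed.
Lemma pt_taup e (m : {poly R}) n : (size m <= n)%N ->
  pt e m = \sum_(i < n) (e * cs m`_i) *: taup i.
Proof.
move=> le; rewrite pt1 -{1}(take_poly_id le) -[take_poly _ _]/(\poly_(i < n) m`_i) poly_def pt_sum scaler_sumr.
by apply: eq_bigr => i _; rewrite pt_cst scalerA.
Qed.

(* The span of the e tau^i of degree i - D ord(e) at most j. *)
Definition Lam (j : int) (x : N) : Prop := exists s : seq (E * nat),
  (forall p, p \in s -> exists nu : int, Ef nu p.1 /\ p.2%:Z - D%:Z * nu <= j) /\
  x = \sum_(p <- s) p.1 *: taup p.2.

Lemma Lam0 j : Lam j 0.
Proof. by exists [::]; rewrite big_nil. Qed.
Lemma LamD j x y : Lam j x -> Lam j y -> Lam j (x + y).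
Proof.
move=> [s [hs ->]] [u [hu ->]]; exists (s ++ u); rewrite big_cat; split=> // p.
by rewrite mem_cat => /orP[/hs|/hu].
Qed.
Lemma Lam_sum j (I : eqType) (s : seq I) (G : I -> N) :
  (forall i, i \in s -> Lam j (G i)) -> Lam j (\sum_(i <- s) G i).
Proof.
move=> h; rewrite big_seq; apply: big_ind => //; [exact: Lam0|exact: LamD].
Qed.
Lemma LamS i j x : i <= j -> Lam i x -> Lam j x.
Proof.
move=> le [s [hs ->]]; exists s; split=> // p /hs [nu [h1 h2]].
by exists nu; split=> //; exact: le_trans le.
Qed.
Lemma Lam_gen (nu : int) e i j : Ef nu e -> i%:Z - D%:Z * nu <= j -> Lam j (e *: taup i).
Proof.
move=> h1 h2; exists [:: (e, i)]; rewrite big_seq1; split=> // p.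
by rewrite inE => /eqP ->; exists nu.
Qed.
Lemma LamZ (nu : int) e j x : Ef nu e -> Lam j x -> Lam (j - D%:Z * nu) (e *: x).
Proof.
move=> he [s [hs ->]]; rewrite scaler_sumr; apply: Lam_sum => p /hs [mu [h1 h2]].
rewrite scalerA; apply: (Lam_gen (nu := nu + mu)); first exact: filM.
by rewrite mulrDr opprD addrCA [leRHS]addrC lerD2l.
Qed.
Lemma LamZ0 e j x : Ef 0 e -> Lam j x -> Lam j (e *: x).
Proof. by move=> h /(LamZ h); rewrite mulr0 subr0. Qed.
Lemma Lam_pt (nu : int) e (m : {poly R}) (j : int) : Ef nu e ->
  (size m)%:Z - 1 - D%:Z * nu <= j -> Lam j (pt e m).
Proof.
move=> he hj; rewrite (pt_taup _ (leqnn _)); apply: Lam_sum => i _.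
apply: (Lam_gen (nu := nu)); first by rewrite -[nu]addr0; apply: filM => //; exact: Ef_cst.
have := ltn_ord i; lia.
Qed.
Lemma Lam_exhaustive x : exists j, Lam j x.
Proof.
elim/tensor_ind: x => [x y [i hi] [j hj]||e m].
- exists (Order.max i j); apply: LamD; [apply: LamS hi|apply: LamS hj];
  by rewrite le_max lexx ?orbT.
- by exists 0; exact: Lam0.
have [nu he] := fil_exhaustive Ef e.
exists ((size (m : {poly R}))%:Z - 1 - D%:Z * nu); exact: (Lam_pt he).
Qed.

Section RegularElement.
Variables (a : regular_ring oo) (ha : oo (val a) < 0).
Let n := `|oo (val a)|%N.
Let n0 : (0 < n)%N. Proof. by rewrite /n; lia. Qed.
Let a0 : a != 0.
Proof. by apply/eqP => e; move: ha; rewrite e val_at0. Qed.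
Let va0 : val a != 0.
Proof. by rewrite -(rmorph0 (regular_incl oo)) (inj_eq val_inj). Qed.
Let oan : oo (val a) = - n%:Z. Proof. by rewrite /n; lia. Qed.

(** This is where the unit leading coefficients of phi enter, allowing division by the top
    coefficient in R. *)
Lemma act_lead l b : b != 0 ->
  [/\ size (act 'X^l b) = (l + D * `|oo (val b)|).+1 &
      (act 'X^l b)`_(l + D * `|oo (val b)|) \is a GRing.unit].
Proof.
move=> b0; split.
  by rewrite (size_act hF) ?size_polyXn ?addSn // -size_poly_eq0 size_polyXn.
have szb := size_phi hF phi b0; have [_ lu] := dm_degree phi b0.
rewrite (tp_mul_lead iR (size_polyXn R l) szb) coefXn eqxx mul1r.
by move: lu; rewrite lead_coefE szb /= => lu; apply: unitrX.
Qed.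

(** Multiply by b = a^t, of pole order K, and replace f b by a nearby a' in A. Then tau^i phi_a' has
    degree at most l + D K, while tau^l phi_b has exactly this degree and a unit leading
    coefficient. So xi is the quotient of the coefficients of degree l + D K, and dividing by b
    again shifts degrees by -D K. *)
Let top_em f (nu : int) (i l : nat) : fl nu f -> i%:Z = l%:Z + D%:Z * nu ->
  exists xi, Lam (l%:Z - 1) (em f *: taup i - cs xi *: taup l).
Proof.
(* With this t, the pole order c = n t - nu allowed for f b exceeds B. So a' exists, and the error
   (f b - a') / b has order at least nu + 1. *)
move=> hf ei; pose t := (B + `|nu|).+1; pose b := a ^+ t.
have vb : val b = val a ^+ t by exact: (rmorphXn (regular_incl oo)).
have vb0 : val b != 0 by rewrite vb expf_neq0.
have b0 : b != 0 by apply: contra_neq vb0 => ->.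
pose K := (n * t)%N.
have oob : oo (val b) = - K%:Z by rewrite vb val_atX int_mulrn oan /K; lia.
have absb : `|oo (val b)|%N = K by rewrite oob; lia.
have leK : (t <= K)%N by rewrite leq_pmull.
have Kpos : exists c : nat, K%:Z - nu = c%:Z /\ (B < c)%N.
  by exists `|K%:Z - nu|%N; rewrite /t in leK; lia.
case: Kpos => c [ec ltc].
have hfb : fl (- c%:Z) (f * regular_F_oo oo b).
  have := filM hf (fil_val oo vb0); rewrite oob.
  by have -> : - c%:Z = nu + - K%:Z by lia.
have [a' [oa' ha']] := precision_approximation (hF := hF) (ltnW ltc) hfb.
have [szb lub] := act_lead l b0; rewrite absb in szb lub.
pose m1 := act 'X^i a'; pose m2 := act 'X^l b.
have szm1 : (size m1 <= (l + D * K).+1)%N.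
  apply: leq_trans (size_act_leq hF phi _ oa') _; rewrite size_polyXn.
  by have : (i + D * c = l + D * K)%N; [nia|lia].
pose xi := m1`_(l + D * K) / m2`_(l + D * K).
have szm3 : (size (m1 - xi *: m2)%R <= l + D * K)%N.
  apply/leq_sizeP => j; rewrite leq_eqVlt => /orP[/eqP <-|lt].
    by rewrite coefB coefZ divrK // subrr.
  rewrite coefB coefZ !nth_default ?mulr0 ?subr0 //; first by rewrite szb.
  exact: leq_trans lt.
move: xi szm3 => xi szm3; exists xi.
have bV : em (regular_F_oo oo b)^-1 * em (regular_F_oo oo b) = 1.
  by rewrite -rmorphM mulVf ?rmorph1 // fmorph_eq0.
have -> : em f *: taup i - cs xi *: taup l =
    em (regular_F_oo oo b)^-1 *: pt 1 (m1 - xi *: m2) +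
    em ((regular_F_oo oo b)^-1 * (f * regular_F_oo oo b - regular_F_oo oo a')) *: taup i.
  have -> : em (regular_F_oo oo b)^-1 *: pt 1 (m1 - xi *: m2) =
      (em (regular_F_oo oo b)^-1 * em (regular_F_oo oo a')) *: taup i - cs xi *: taup l.
    by rewrite ptBr pt_cst !pt_act1 scalerBr !scalerA mulrCA bV mulr1.
  rewrite mulrBr mulrCA mulVf ?mulr1 ?fmorph_eq0 // rmorphB scalerBl rmorphM.
  by rewrite [RHS]addrC addrA subrK.
have flV : fl K%:Z (regular_F_oo oo b)^-1.
  have -> : (regular_F_oo oo b)^-1 = F_to_F_oo oo (val b)^-1 by rewrite fmorphV.
  have -> : K%:Z = - oo (val b) by rewrite oob opprK.
  exact: fil_valV.
apply: LamD.
  rewrite pt_scale mulr1; apply: (Lam_pt (Ef_em iR flV)).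
  by have : ((size (m1 - xi *: m2)%R)%:Z <= l%:Z + D%:Z * K%:Z); lia.
apply: (Lam_gen (nu := nu + 1)); last by rewrite ei mulrDr; have := D_gt0; lia.
by apply: Ef_em; apply: filS (filM flV ha'); lia.
Qed.

Lemma Lam_relation e (nu : int) (i l : nat) : Ef nu e -> i%:Z = l%:Z + D%:Z * nu ->
  exists xi, Lam (l%:Z - 1) (e *: taup i - cs xi *: taup l).
Proof.
move=> he ei; have [s [hs hes]] := Ef_expand (nu + 1) he.
have top f eta : fl nu f -> exists xi,
    Lam (l%:Z - 1) ((em f * cs eta) *: taup i - cs xi *: taup l).
  move=> hf; have [xi h] := top_em hf ei; exists (eta * xi).
  have := LamZ0 (Ef_cst oo iR eta) h.
  by rewrite scalerBr !scalerA rmorphM [em f * _]mulrC.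
have [xi h] : exists xi, Lam (l%:Z - 1)
    ((\sum_(p <- s) em p.1 * cs p.2) *: taup i - cs xi *: taup l).
  elim: s hs {hes} => [|p s IH] hs.
    by exists 0; rewrite big_nil rmorph0 !scale0r subrr; exact: Lam0.
  have [|xi h] := IH; first by move=> p' hp'; apply: hs; rewrite inE hp' orbT.
  have [xi' h'] := top p.1 p.2 (hs p (mem_head _ _)).
  exists (xi' + xi); rewrite big_cons rmorphD !scalerDl opprD addrACA.
  exact: LamD.
exists xi; rewrite -[e](subrK (\sum_(p <- s) em p.1 * cs p.2)) scalerDl -addrA.
apply: LamD => //; apply: (Lam_gen hes).
by rewrite ei mulrDr; have := D_gt0; lia.
Qed.

Lemma Lam_top (l : nat) x : Lam l%:Z x ->
  exists xi, Lam (l%:Z - 1) (x - cs xi *: taup l).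
Proof.
move=> [s [hs ->]]; elim: s hs => [|p s IH] hs.
  by exists 0; rewrite big_nil rmorph0 !scale0r subrr; exact: Lam0.
have [|xi h] := IH; first by move=> p' hp'; apply: hs; rewrite inE hp' orbT.
have [nu [h1 h2]] := hs p (mem_head _ _).
have [xi' h'] : exists xi', Lam (l%:Z - 1) (p.1 *: taup p.2 - cs xi' *: taup l).
  have [e|ne] := eqVneq (p.2%:Z - D%:Z * nu) l%:Z.
    by apply: Lam_relation h1 _; lia.
  exists 0; rewrite rmorph0 scale0r subr0; apply: (Lam_gen h1).
  by rewrite lerBrDr lezD1 lt_neqAle ne.
by exists (xi' + xi); rewrite big_cons rmorphD scalerDl opprD addrACA; exact: LamD.
Qed.

Lemma Lam_window (s K : nat) x : Lam ((s + K)%:Z - 1) x ->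
  exists xi : 'I_K -> R, Lam (s%:Z - 1) (x - \sum_(i < K) cs (xi i) *: taup (s + i)).
Proof.
elim: K x => [|K IH] x.
  by rewrite addn0 => h; exists (fun=> 0); rewrite big_ord0 subr0.
have -> : (s + K.+1)%:Z - 1 = (s + K)%N%:Z by lia.
move=> /Lam_top [xi0 /IH [xi h]].
exists (fun i : 'I_K.+1 => oapp xi xi0 (insub (val i))).
move: h; congr (Lam _ _); rewrite big_ord_recr /= insubF ?ltnn //= opprD addrA addrAC.
by congr (_ - _ - _); apply: eq_bigr => i _; rewrite valK.
Qed.

(** The finite generation needed for Nakayama's lemma. For l >= D n the twisted polynomial tau^(l -
    D n) phi_a has degree l and a unit leading coefficient, so tau^l is expressed by a tau^(l - D n)
    and lower powers, without increase of degree. *)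
Lemma Lam_generators j x : Lam j x -> exists e : 'I_(D * n) -> E,
  (forall i : 'I_(D * n), exists nu : int, Ef nu (e i) /\ i%:Z - D%:Z * nu <= j) /\
  x = \sum_i e i *: taup i.
Proof.
pose G j x := exists e : 'I_(D * n) -> E,
  (forall i : 'I_(D * n), exists nu : int, Ef nu (e i) /\ i%:Z - D%:Z * nu <= j) /\
  x = \sum_i e i *: taup i.
rewrite -/(G j x).
have G0 j' : G j' 0.
  exists (fun=> 0); split; last by rewrite big1 // => i _; rewrite scale0r.
  (* The coefficient 0 has every order, so one may choose an order large enough for the degree
     bound. *)
  move=> i; exists (i%:Z + `|j'|%:Z); split; first exact: fil0.
  by have := D_gt0; nia.
have GD j' y y' : G j' y -> G j' y' -> G j' (y + y').
  move=> [e [he ->]] [e' [he' ->]]; exists (fun i => e i + e' i); split.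
    move=> i; have [nu [h1 h2]] := he i; have [nu' [h1' h2']] := he' i.
    case: (leP nu nu') => le.
      by exists nu; split=> //; apply: filD => //; apply: filS h1'.
    by exists nu'; split=> //; apply: filD => //; apply: filS h1; exact: ltW.
  by rewrite -big_split; apply: eq_bigr => i _; rewrite scalerDl.
have GZ j' (nu : int) e y : Ef nu e -> G j' y -> G (j' - D%:Z * nu) (e *: y).
  move=> he [e' [he' ->]]; exists (fun i => e * e' i); split=> [i|].
    have [nu' [h1 h2]] := he' i; exists (nu + nu'); split; first exact: filM.
    by rewrite mulrDr; lia.
  by rewrite scaler_sumr; apply: eq_bigr => i _; rewrite scalerA.
have GS i' j' y : i' <= j' -> G i' y -> G j' y.
  move=> le [e [he ->]]; exists e; split=> // i; have [nu [h1 h2]] := he i.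
  by exists nu; split=> //; exact: le_trans le.
have Gsum j' (I : finType) (y : I -> N) : (forall i, G j' (y i)) -> G j' (\sum_i y i).
  by move=> h; apply: big_ind => //; exact: GD.
have Gbase l : (l < D * n)%N -> G l%:Z (taup l).
  move=> lt; exists (fun i => if i == Ordinal lt then 1 else 0); split.
    move=> i; have [->|_] := eqVneq i (Ordinal lt).
      by exists 0; split; [exact: fil1|rewrite mulr0 subr0].
    exists i%:Z; split; first exact: fil0.
    by have := D_gt0; nia.
  rewrite (bigD1 (Ordinal lt)) //= eqxx scale1r big1 ?addr0 // => i /negbTE ->.
  by rewrite scale0r.
have Gtau l : G l%:Z (taup l).
  elim: l {-2}l (leqnn l) => [|m IH] l le; case: (ltnP l (D * n)) => lt.
  - exact: Gbase.
  - by have := leq_trans lt le; rewrite leqNgt muln_gt0 D_gt0 n0.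
  - exact: Gbase.
  pose u := act 'X^(l - D * n) a.
  have [szu lu] := act_lead (l - D * n) a0.
  rewrite -/n subnK // -/u in szu lu.
  have -> : taup l = cs (u`_l)^-1 *: (em (regular_F_oo oo a) *: taup (l - D * n) -
      \sum_(i < l) cs u`_i *: taup i).
    rewrite -pt_act1 -/u (@pt_taup 1 u l.+1) ?szu // big_ord_recr /= !mul1r.
    under eq_bigr => i _ do rewrite mul1r.
    by rewrite addrAC subrr add0r scalerA -rmorphM mulVr // rmorph1 scale1r.
  have dn0 : (0 < D * n)%N by rewrite muln_gt0 D_gt0 n0.
  have csG xi j' y : G j' y -> G j' (cs xi *: y).
    by move=> /(GZ _ _ _ _ (Ef_cst oo iR xi)); rewrite mulr0 subr0.
  apply: (csG _); apply: (GD).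
    have fa : fl (- n%:Z) (regular_F_oo oo a) by rewrite -oan; exact: fil_val.
    have le' : (l - D * n <= m)%N by rewrite leq_subLR; apply: leq_trans le _; rewrite -add1n leq_add2r.
    apply: GS (GZ _ _ _ _ (Ef_em iR fa) (IH _ le')).
    by rewrite -subzn // mulrN opprK -PoszM subrK.
  rewrite -sumrN; apply: Gsum => i; rewrite -scaleNr -rmorphN; apply: csG.
  by apply: (GS i%:Z); [have := ltn_ord i; lia|apply: IH; have := ltn_ord i; lia].
move=> [s [hs ->]]; elim: s hs => [|p s IH] hs; first by rewrite big_nil; exact: G0.
rewrite big_cons; apply: GD; last by apply: IH => p' hp'; apply: hs; rewrite inE hp' orbT.
have [nu [h1 h2]] := hs p (mem_head _ _).
exact: GS h2 (GZ _ _ _ _ h1 (Gtau p.2)).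
Qed.
End RegularElement.
End DegreeFiltration.

(** * Power series in the uniformizer *)

Section Coordinates.
Variables (k : finFieldType) (F : fieldType) (iF : {rmorphism k -> F}).
Variables (oo : place iF) (R : idomainType) (iR : {rmorphism k -> R}).
Variable z : F_oo oo.
Hypothesis hz : uniformizer z.
Local Notation fl := (F_oo_fil oo).
Local Notation E := (E_F oo iR).
Local Notation Ef := (completed_filtration (FR_filtration oo iR)).
Local Notation em := (F_oo_to_E iR).
Local Notation cs := (cst oo iR).

Lemma uniformizer_val : [/\ z != 0, fl 1 z & fl (- 1) z^-1].
Proof.
have hm : fl 1 z.
  apply/(hz z); exists 1; rewrite mulr1; split=> //; exact: fil1.
have [pi [pi0 hpi]] := val_at_onto oo.
have [y [hy ey]] : exists y, in_A_oo y /\ F_to_F_oo oo pi = z * y.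
  by apply/(hz _)/fil_emb; right; rewrite hpi.
have ep0 : F_to_F_oo oo pi != 0 by rewrite fmorph_eq0.
have z0 : z != 0 by apply: contra_neq ep0 => e; rewrite ey e mul0r.
split=> //; have -> : z^-1 = F_to_F_oo oo pi^-1 * y.
  by rewrite fmorphV ey invfM -mulrA mulVf ?mulr1 //;
    apply: contra_neq ep0 => y0; rewrite ey y0 mulr0.
rewrite -[- 1]addr0; apply: filM => //.
by have := fil_valV oo pi0; rewrite hpi.
Qed.

Local Notation zt := (em z : E).
Local Notation zi := (em z^-1 : E).
Lemma uniformizerK : zi * zt = 1.
Proof. by have [z0 _ _] := uniformizer_val; rewrite -rmorphM mulVf ?rmorph1. Qed.
Lemma Ef_ztX n : Ef n%:Z (zt ^+ n).
Proof.
have [_ h _] := uniformizer_val.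
elim: n => [|n IH]; first by rewrite expr0; exact: fil1.
rewrite exprS; have -> : n.+1%:Z = 1 + n%:Z by lia.
by apply: filM => //; exact: Ef_em.
Qed.
Lemma Ef_ziX n : Ef (- n%:Z) (zi ^+ n).
Proof.
have [_ _ h] := uniformizer_val.
elim: n => [|n IH]; first by rewrite expr0; exact: fil1.
rewrite exprS; have -> : - n.+1%:Z = - 1 + - n%:Z by lia.
by apply: filM => //; exact: Ef_em.
Qed.
Lemma uniformizerXK n : zi ^+ n * zt ^+ n = 1.
Proof. by rewrite -exprMn uniformizerK expr1n. Qed.
Lemma Ef_mul_ziX (nu : int) e n : Ef nu e -> Ef (nu - n%:Z) (zi ^+ n * e).
Proof. by move=> h; rewrite addrC; apply: filM => //; exact: Ef_ziX. Qed.

Lemma Ef_separated (e : E) : (forall n : nat, Ef n%:Z e) -> e = 0.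
Proof.
move=> h; apply: completion_separated => n.
by apply: filS (h `|n|%N); lia.
Qed.

(* R[z], and its closure T = R[[z]] in E_F. *)
Definition RZ (e : E) : Prop := exists s : seq (R * nat),
  e = \sum_(p <- s) cs p.1 * zt ^+ p.2.
Lemma RZD e f : RZ e -> RZ f -> RZ (e + f).
Proof. by move=> [s ->] [u ->]; exists (s ++ u); rewrite big_cat. Qed.
Lemma RZ0 : RZ 0. Proof. by exists [::]; rewrite big_nil. Qed.
Lemma RZm xi n : RZ (cs xi * zt ^+ n).
Proof. by exists [:: (xi, n)]; rewrite big_seq1. Qed.
Lemma RZM e f : RZ e -> RZ f -> RZ (e * f).
Proof.
move=> [s ->] [u ->]; rewrite mulr_suml.
apply: big_ind => [||p _]; [exact: RZ0|exact: RZD|].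
rewrite mulr_sumr; apply: big_ind => [||p' _]; [exact: RZ0|exact: RZD|].
by rewrite mulrACA -rmorphM -exprD; exact: RZm.
Qed.
Lemma RZ_Ef e : RZ e -> Ef 0 e.
Proof.
move=> [s ->]; apply: Ef_sum => p _; rewrite -[0]addr0; apply: filM; first exact: Ef_cst.
exact: filS (Ef_ztX p.2).
Qed.
Lemma RZ_split e : RZ e -> exists xi f, RZ f /\ e = cs xi + zt * f.
Proof.
move=> [s ->]; elim: s => [|[xi [|n]] s [eta [f [hf e']]]].
- by exists 0, 0; rewrite big_nil rmorph0 mulr0 addr0; split=> //; exact: RZ0.
- exists (xi + eta), f; rewrite big_cons e' expr0 mulr1 rmorphD addrA; split=> //.
exists eta, (cs xi * zt ^+ n + f); split; first by apply: RZD => //; exact: RZm.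
by rewrite big_cons e' /= exprS mulrDr; ring.
Qed.

Definition T (e : E) : Prop := forall n : nat, exists2 p, RZ p & Ef n%:Z (e - p).
Lemma T_Ef e : T e -> Ef 0 e.
Proof.
move=> /(_ 0%N) [p /RZ_Ef hp h]; rewrite -[e](subrK p); exact: filD.
Qed.
Lemma RZ_T e : RZ e -> T e.
Proof. by move=> h n; exists e => //; rewrite subrr; exact: fil0. Qed.
Lemma T_closed e : (forall n : nat, exists2 t, T t & Ef n%:Z (e - t)) -> T e.
Proof.
move=> h n; have [t ht het] := h n; have [p hp hpt] := ht n; exists p => //.
by rewrite -(subrKA t); exact: filD.
Qed.
Lemma TD e f : T e -> T f -> T (e + f).
Proof.
move=> he hf n; have [p hp h] := he n; have [p' hp' h'] := hf n.
exists (p + p'); first exact: RZD.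
by rewrite opprD addrACA; exact: filD.
Qed.
Lemma TM e f : T e -> T f -> T (e * f).
Proof.
move=> he hf n; have [p hp h] := he n; have [p' hp' h'] := hf n.
exists (p * p'); first exact: RZM.
have -> : e * f - p * p' = (e - p) * f + p * (f - p') by ring.
apply: filD; first by rewrite -[n%:Z]addr0; apply: filM => //; exact: T_Ef.
by rewrite -[n%:Z]add0r; apply: filM => //; exact: RZ_Ef.
Qed.
Lemma T_cst xi : T (cs xi).
Proof. by apply: RZ_T; rewrite -[cs xi]mulr1 -(expr0 zt); exact: RZm. Qed.
Lemma T0 : T 0. Proof. exact: RZ_T RZ0. Qed.
Lemma T1 : T 1. Proof. by rewrite -(rmorph1 (cst oo iR)); exact: T_cst. Qed.
Lemma TN e : T e -> T (- e).
Proof.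
by move=> he; rewrite -mulN1r -(rmorphN1 (cst oo iR)); apply: TM => //; exact: T_cst.
Qed.
Lemma T_ztX n : T (zt ^+ n).
Proof. by apply: RZ_T; rewrite -[zt ^+ n]mul1r -(rmorph1 (cst oo iR)); exact: RZm. Qed.
Lemma T_sum (I : Type) (s : seq I) (P : pred I) (G : I -> E) :
  (forall i, P i -> T (G i)) -> T (\sum_(i <- s | P i) G i).
Proof. by move=> h; apply: big_ind => //; [exact: T0|exact: TD]. Qed.
Lemma T_sigma e : T e -> T (sigma oo iR e).
Proof.
move=> h n; have [p [s ep] hp] := h n; exists (sigma oo iR p); last first.
  by rewrite -rmorphB; exact: Ef_sigma.
rewrite ep rmorph_sum; exists [seq (p.1 ^+ #|k|, p.2) | p <- s].
rewrite big_map; apply: eq_bigr => q _.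
by rewrite rmorphM rmorphXn /= sigma_cstE sigma_em.
Qed.

Lemma Ef_complete (U : nat -> E) :
  (forall n m : nat, (n <= m)%N -> Ef n%:Z (U m - U n)) ->
  exists e, forall n : nat, Ef n%:Z (e - U n).
Proof.
move=> hU; have [|e he] := @completion_complete _ _ U.
  move=> n; exists `|n|%N => i j hi hj; case: (leqP i j) => le.
    by rewrite -opprB; apply: filN; apply: filS (hU _ _ le); lia.
  by apply: filS (hU _ _ (ltnW le)); lia.
exists e => n; have [K hK] := he n%:Z.
rewrite -(subrKA (U (maxn K n))); apply: filD; first by apply: hK; rewrite leq_maxl.
by apply: hU; rewrite leq_maxr.
Qed.

(** The inverse is the limit of the geometric series in z t. *)
Lemma T_inverse t : T t -> exists2 u, T u & (1 - zt * t) * u = 1.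
Proof.
move=> ht; pose w := zt * t.
have wX n : Ef n%:Z (w ^+ n).
  rewrite exprMn -[n%:Z]addr0; apply: filM; first exact: Ef_ztX.
  elim: n => [|n IH]; first by rewrite expr0; exact: fil1.
  by rewrite exprS -[0]addr0; apply: filM => //; exact: T_Ef.
have Tw n : T (w ^+ n).
  elim: n => [|n IH]; first by rewrite expr0; exact: T1.
  by rewrite exprS; apply: TM => //; apply: TM => //; have := T_ztX 1; rewrite expr1.
pose U n := \sum_(i < n) w ^+ i.
have [n m le|u hu] := @Ef_complete U.
  rewrite -(subnK le); elim: (m - n)%N => [|j IH]; first by rewrite subrr; exact: fil0.
  have -> : U (j.+1 + n)%N - U n = (U (j + n)%N - U n) + w ^+ (j + n).
    by rewrite addSn {1}/U big_ord_recr addrAC.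
  apply: filD => //.
  by apply: filS (wX (j + n)%N); lia.
exists u.
  by apply: T_closed => n; exists (U n) => //; apply: T_sum.
apply/eqP; rewrite -subr_eq0; apply/eqP; apply: Ef_separated => n.
have eU : (1 - w) * U n = 1 - w ^+ n.
  elim: n => [|n IH]; first by rewrite /U big_ord0 expr0 mulr0 subrr.
  by rewrite /U big_ord_recr /= mulrDr IH exprS; ring.
have -> : (1 - zt * t) * u - 1 = (1 - w) * (u - U n) - w ^+ n.
  by rewrite mulrBr eU /w; ring.
apply: filB => //; rewrite -[n%:Z]add0r; apply: filM => //.
apply: filB; first exact: fil1.
by apply: (filS (n := 1)) => //; have := wX 1%N; rewrite expr1.
Qed.

Hypothesis hF : function_field iF.
Lemma pole_element : exists a : regular_ring oo, oo (val a) < 0.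
Proof.
have [f [hf h]] := pole_at_infinity hF oo.
by have [a ea] := regular_ring_exists hf; exists a; rewrite ea.
Qed.

Local Notation dg := (d_oo oo).
Local Notation theta := (teichmuller hF (oo := oo)).
Local Notation code := {ffun 'I_dg -> k}.

(** Teichmuller representatives of a residue basis span modulo order 1 with coefficients in R.
    Subtracting, dividing by z and iterating yields the coefficients as power series in z. *)
Lemma T_span : exists g : 'I_dg -> code, (forall l, g l != 0) /\
  forall e, Ef 0 e -> exists t : 'I_dg -> E,
    (forall l, T (t l)) /\ e = \sum_l t l * em (theta (g l)).
Proof.
have [g [g0 hg]] := teichmuller_span hF oo; exists g; split=> // e he.
pose G l : E := em (theta (g l)).
have step x : Ef 0 x -> exists c : 'I_dg -> R, Ef 1 (x - \sum_l cs (c l) * G l).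
  move=> /(Ef_expand 1) [s [hs hx]].
  have [c hc] : exists c : 'I_dg -> R,
      Ef 1 (\sum_(p <- s) em p.1 * cs p.2 - \sum_l cs (c l) * G l).
    elim: s hs {hx} => [|p s IH] hs.
      exists (fun=> 0); rewrite big_nil big1 ?subr0 => [|l _]; first exact: fil0.
      by rewrite rmorph0 mul0r.
    have [|c hc] := IH; first by move=> p' hp'; apply: hs; rewrite inE hp' orbT.
    have [b hb] := hg p.1 (hs p (mem_head _ _)).
    exists (fun l => iR (b l) * p.2 + c l).
    have -> : \sum_l cs (iR (b l) * p.2 + c l) * G l =
        \sum_l cs (iR (b l) * p.2) * G l + \sum_l cs (c l) * G l.
      by rewrite -big_split; apply: eq_bigr => l _; rewrite rmorphD mulrDl.
    rewrite big_cons opprD addrACA; apply: filD => //.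
    have := filM (Ef_em iR hb) (Ef_cst oo iR p.2); rewrite addr0; congr (Ef 1 _).
    rewrite rmorphB mulrBl rmorph_sum mulr_suml; congr (_ - _).
    by apply: eq_bigr => l _; rewrite !rmorphM /= em_const mulrAC.
  by exists c; rewrite -(subrKA (\sum_(p <- s) em p.1 * cs p.2)); exact: filD.
pose c x : 'I_dg -> R :=
  if pselect (Ef 0 x) is left h then projT1 (cid (step x h)) else fun=> 0.
have cP x : Ef 0 x -> Ef 1 (x - \sum_l cs (c x l) * G l).
  by move=> h; rewrite /c; case: pselect => // h'; exact: (projT2 (cid (step x h'))).
pose nxt x := zi * (x - \sum_l cs (c x l) * G l).
have nxtP x : Ef 0 x -> Ef 0 (nxt x).
  by move=> /cP /(Ef_mul_ziX 1); rewrite subrr expr1.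
pose it n := iter n nxt e.
have itP n : Ef 0 (it n) by elim: n => //= n; exact: nxtP.
pose U l n := \sum_(i < n) cs (c (it i) l) * zt ^+ i.
have eU n : e = \sum_l U l n * G l + zt ^+ n * it n.
  elim: n => [|n IH].
    rewrite big1 ?add0r ?expr0 ?mul1r // => l _; by rewrite /U big_ord0 mul0r.
  have h : zt ^+ n.+1 * it n.+1 =
      zt ^+ n * it n - \sum_l cs (c (it n) l) * zt ^+ n * G l.
    rewrite exprSr /it iterS -/(it n) /nxt -mulrA [zt * (zi * _)]mulrA.
    rewrite [zt * zi]mulrC uniformizerK mul1r mulrBr mulr_sumr; congr (_ - _).
    by apply: eq_bigr => l _; rewrite mulrCA mulrA.
  have h' : \sum_l U l n.+1 * G l =
      \sum_l U l n * G l + \sum_l cs (c (it n) l) * zt ^+ n * G l.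
    by rewrite -big_split; apply: eq_bigr => l _; rewrite /U big_ord_recr mulrDl.
  by rewrite {1}IH h h' addrACA subrr addr0.
have hU l : exists t, forall n : nat, Ef n%:Z (t - U l n).
  apply: Ef_complete => n m le; rewrite -(subnK le).
  elim: (m - n)%N => [|j IH]; first by rewrite subrr; exact: fil0.
  have -> : U l (j.+1 + n)%N - U l n =
      (U l (j + n)%N - U l n) + cs (c (it (j + n)%N) l) * zt ^+ (j + n).
    by rewrite addSn {1}/U big_ord_recr addrAC.
  apply: filD => //; have := filM (Ef_cst oo iR (c (it (j + n)%N) l)) (Ef_ztX (j + n)).
  by apply: filS; lia.
pose t l := projT1 (cid (hU l)).
have tP l n : Ef n%:Z (t l - U l n) by exact: (projT2 (cid (hU l)) n).
exists t; split=> [l|].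
  apply: T_closed => n; exists (U l n); last exact: tP.
  by apply: T_sum => i _; apply: TM; [exact: T_cst|exact: T_ztX].
apply/eqP; rewrite -subr_eq0; apply/eqP; apply: Ef_separated => n.
have -> : e - \sum_l t l * G l = zt ^+ n * it n - \sum_l (t l - U l n) * G l.
  rewrite {1}(eU n); under [in RHS]eq_bigr => l _ do rewrite mulrBl.
  by rewrite sumrB opprB; ring.
apply: filB; first by have := filM (Ef_ztX n) (itP n); rewrite addr0.
apply: Ef_sum => l _; rewrite -[n%:Z]addr0; apply: filM => //.
by apply: Ef_em; exact: teichmuller_integral.
Qed.

Variables (r : nat) (hr : (0 < r)%N) (phi : drinfeld_module oo iR r).

(** The tensor 1 (x) xi equals cst(xi) (x) 1. If cst(xi) had order at least 1, the latter would have
    degree at most -D, contradicting [pure_detect] for the constant xi unless xi = 0. *)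
Lemma cst_Ef1 xi : Ef 1 (cs xi) -> xi = 0.
Proof.
have [a ha] := pole_element; move=> h; apply/eqP; apply: contraT => xi0.
have : (xi%:P : {poly R}) = 0; last first.
  by move/eqP; rewrite polyC_eq0 (negPf xi0).
apply: (@pure_detect _ _ _ hF _ _ _ _ phi a ha [:: (cs xi, (1 : {poly R}))]) => //.
  move=> p; rewrite inE => /eqP -> /=; exists 1; split=> //.
  rewrite size_poly1 mulr1 size_polyC xi0.
  by have := D_gt0 hF oo hr; lia.
rewrite big_seq1 /=.
have := pt_cst phi 1 xi 1; rewrite /pt -/(pt phi _ _) => e.
rewrite alg_polyC in e; apply: etrans e _.
by rewrite pt_scale mulr1.
Qed.

(** By [cst_Ef1] all approximations of e by polynomials in z modulo order at least 1 share the same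
    constant term. After its removal both e and its approximations can be divided by z. *)
Lemma T_split e : T e -> exists xi f, T f /\ e = cs xi + zt * f.
Proof.
move=> h; have [p /RZ_split [xi [f [hf ep]]] hp] := h 1%N.
exists xi, (zi * (e - cs xi)); split; last first.
  by rewrite mulrA [zt * _]mulrC uniformizerK mul1r addrC subrK.
move=> n; have [p' /RZ_split [xi' [f' [hf' ep']]] hp'] := h n.+1.
have exi : xi' = xi.
  apply/eqP; rewrite -subr_eq0; apply/eqP/cst_Ef1; rewrite rmorphB.
  have -> : cs xi' - cs xi = (e - p) - (e - p') + zt * (f - f').
    by rewrite ep ep'; ring.
  apply: filD; first by apply: filB => //; apply: filS hp'; lia.
  rewrite -[1]addr0; apply: filM; first by have := Ef_ztX 1; rewrite expr1.
  by apply: filB; exact: RZ_Ef.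
exists f' => //; have -> : zi * (e - cs xi) - f' = zi * (e - p').
  rewrite ep' exi opprD addrA [in RHS]mulrBr [zi * (zt * _)]mulrA uniformizerK mul1r.
  by [].
have := Ef_mul_ziX 1 hp'; rewrite expr1; apply: filS; lia.
Qed.

End Coordinates.

(** * Bases of windows of the filtration *)

Section Window.
Variables (k : finFieldType) (F : fieldType) (iF : {rmorphism k -> F}).
Hypothesis hF : function_field iF.
Variables (oo : place iF) (R : idomainType) (iR : {rmorphism k -> R}).
Variables (r : nat) (hr : (0 < r)%N) (phi : drinfeld_module oo iR r).
Variables (z : F_oo oo) (hz : uniformizer z).
Local Notation fl := (F_oo_fil oo).
Local Notation E := (E_F oo iR).
Local Notation Ef := (completed_filtration (FR_filtration oo iR)).
Local Notation em := (F_oo_to_E iR).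
Local Notation cs := (cst oo iR).
Local Notation N := (motive_isocrystal phi).
Local Notation D := (r * d_oo oo)%N.
Local Notation tau := (taup phi).
Local Notation Lam := (@Lam _ _ _ _ _ _ _ phi).
Local Notation dg := (d_oo oo).

Local Notation zt := (em z : E).
Local Notation zi := (em z^-1 : E).
Local Notation T := (@T k F iF oo R iR z).

Let theta := teichmuller hF (oo := oo).
Local Notation code := {ffun 'I_dg -> k}.

(** By elimination: the first relation is solved for x_0, since 1 - z c_0 is invertible in R[[z]],
    and substituted in the others, which keep the same form. *)
Lemma nakayama (Q : N -> Prop) : Q 0 -> (forall x y, Q x -> Q y -> Q (x + y)) ->
  (forall t x, T t -> Q x -> Q (t *: x)) ->
  forall n (x : 'I_n -> N),
  (forall i, exists q c, [/\ Q q, forall j : 'I_n, T (c j) &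
     x i = q + zt *: \sum_j c j *: x j]) ->
  forall i, Q (x i).
Proof.
move=> Q0 QD QZ; have Tzt : T zt by have := T_ztX iR z 1; rewrite expr1.
elim=> [|n IH] x hx; first by case.
have [q [c [hq hc e0]]] := hx ord0.
have [u Tu hu] := T_inverse hz (hc ord0).
pose S := \sum_j c (lift ord0 j) *: x (lift ord0 j).
have {}e0 : x ord0 = u *: q + zt *: (u *: S).
  rewrite big_ord_recl -/S scalerDr addrCA scalerA in e0.
  have {}e0 : (1 - zt * c ord0) *: x ord0 = q + zt *: S.
    by apply/eqP; rewrite scalerBl scale1r subr_eq addrC; apply/eqP.
  transitivity (u *: ((1 - zt * c ord0) *: x ord0)).
    by rewrite scalerA [X in _ = X *: _]mulrC hu scale1r.
  by rewrite e0 scalerDr !scalerA [u * zt]mulrC.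
have hl : forall i, Q (x (lift ord0 i)).
  apply: (IH (fun i => x (lift ord0 i))) => i.
  have [p [b [hp hb ei]]] := hx (lift ord0 i).
  exists (p + (zt * b ord0 * u) *: q),
    (fun j => zt * b ord0 * u * c (lift ord0 j) + b (lift ord0 j)); split.
  - by apply: (QD) => //; apply: (QZ) => //; apply: (TM hz) => //; exact: (TM hz).
  - by move=> j; apply: TD => //; do ![apply: (TM hz) => //].
  rewrite ei big_ord_recl e0 -addrA; congr (_ + _).
  have -> : \sum_j (zt * b ord0 * u * c (lift ord0 j) + b (lift ord0 j)) *: x (lift ord0 j) =
      (zt * b ord0 * u) *: S + \sum_j b (lift ord0 j) *: x (lift ord0 j).
    by rewrite /S scaler_sumr -big_split; apply: eq_bigr => j _; rewrite scalerDl scalerA.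
  rewrite !scalerDr !scalerA -!addrA.
  congr (_ *: _ + (_ *: _ + _)); ring.
move=> i; case: (unliftP ord0 i) => [j ->|->]; first exact: hl.
rewrite e0; apply: (QD); first exact: QZ.
apply: (QZ) => //; apply: (QZ) => //.
by apply: big_ind => // j _; apply: (QZ).
Qed.

Lemma zt_Lam j x : Lam j x -> Lam (j - D%:Z) (zt *: x).
Proof. by have := Ef_ztX iR hz 1; rewrite expr1 => h /(LamZ h); rewrite mulr1. Qed.
Lemma zi_Lam j x : Lam j x -> Lam (j + D%:Z) (zi *: x).
Proof.
by have := Ef_ziX iR hz 1; rewrite expr1 => h /(LamZ h); rewrite mulrN1 opprK.
Qed.

Lemma fil_exprz (m : int) : fl m (z ^ m).
Proof.
have [_ h h'] := uniformizer_val hz.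
case: m => m; first by rewrite -exprnP; have := filX m h; rewrite int_mulrn mul1r.
rewrite NegzE -exprnN -exprVn; have := filX m.+1 h'.
by rewrite int_mulrn mulN1r.
Qed.

Section WindowAt.
Variable s : nat.

(** Over R[[z]] the elements z^(nu i) theta_l tau^i with i < D n generate Lam_(s+D-1). By
    [Lam_window] each of them lies in the R-span of the window up to Lam_(s-1) = z Lam_(s+D-1), so
    Nakayama's lemma applies. *)
Lemma window_span x : Lam ((s + D)%:Z - 1) x ->
  exists t : 'I_D -> E, (forall i, T (t i)) /\ x = \sum_i t i *: tau (s + i).
Proof.
have [a ha] := pole_element oo hF; pose n := `|oo (val a)|%N.
have [g [g0 hg]] := T_span iR hz hF; pose J := (s + D)%:Z - 1.
pose Q x := exists t : 'I_D -> E, (forall i, T (t i)) /\ x = \sum_i t i *: tau (s + i).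
have Q0 : Q 0.
  exists (fun=> 0); split=> [i|]; first exact: T0.
  by rewrite big1 // => i _; rewrite scale0r.
have QD y y' : Q y -> Q y' -> Q (y + y').
  move=> [t [ht ->]] [t' [ht' ->]]; exists (fun i => t i + t' i); split=> [i|].
    exact: TD.
  by rewrite -big_split; apply: eq_bigr => i _; rewrite scalerDl.
have QZ t y : T t -> Q y -> Q (t *: y).
  move=> ht [t' [ht' ->]]; exists (fun i => t * t' i); split=> [i|]; first exact: (TM hz).
  by rewrite scaler_sumr; apply: eq_bigr => i _; rewrite scalerA.
(* The least order making e tau^i belong to Lam J. *)
pose nu (i : nat) : int := - ((J - i%:Z) %/ D%:Z)%Z.
have D0 := D_gt0 hF oo hr.
have nuP i : i%:Z - D%:Z * nu i <= J.
  have D0' : D%:Z != 0 by rewrite eqz_nat -lt0n.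
  by rewrite /nu mulrN opprK addrC -lerBrDr mulrC lez_floor.
have nu_min (i : nat) (mu : int) : i%:Z - D%:Z * mu <= J -> nu i <= mu.
  move=> h; rewrite /nu lerNl lez_divRL ?ltz_nat // mulNr mulrC lerBrDr addrC.
  exact: h.
pose y (p : 'I_(D * n) * 'I_dg) : N :=
  (em (z ^ nu p.1) * em (theta (g p.2))) *: tau p.1.
have zz (m : int) : em (z ^ m) * em (z ^ (- m)) = 1.
  have [z0 _ _] := uniformizer_val hz.
  by rewrite -rmorphM -expfzDr // subrr expr0z rmorph1.
have gen x' : Lam J x' -> exists t : 'I_(D * n) * 'I_dg -> E,
    (forall p, T (t p)) /\ x' = \sum_p t p *: y p.
  move=> /(Lam_generators hF hr ha) [e [he ->]].
  have he' i : Ef 0 (em (z ^ (- nu (nat_of_ord i))) * e i).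
    have [mu [h1 /nu_min h2]] := he i.
    have := filM (Ef_em iR (fil_exprz (- nu i))) h1; apply: filS.
    by rewrite addrC subr_ge0.
  pose t i := projT1 (cid (hg _ (he' i))).
  have tP i : (forall l, T (t i l)) /\
      em (z ^ (- nu (nat_of_ord i))) * e i = \sum_l t i l * em (theta (g l)).
    exact: (projT2 (cid (hg _ (he' i)))).
  exists (fun p => t p.1 p.2); split=> [p|]; first by case: (tP p.1).
  rewrite -(pair_bigA _ (fun i l => t i l *: y (i, l))) /=; apply: eq_bigr => i _.
  have [_ ei] := tP i.
  rewrite -[e i]mul1r -(zz (nu i)) -mulrA ei mulr_sumr scaler_suml.
  by apply: eq_bigr => l _; rewrite /y scalerA /= mulrCA.
have hy p : Lam J (y p).
  apply: (Lam_gen phi (nu := nu p.1)) => //.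
  have h := Ef_em iR (teichmuller_integral hF (g p.2)).
  by have := filM (Ef_em iR (fil_exprz (nu p.1))) h; rewrite addr0.
have Qy p : Q (y p).
  rewrite -(enum_rankK p).
  apply: (nakayama Q0 QD QZ (x := fun j => y (enum_val j))) => j.
  have [xi hxi] := Lam_window hF hr ha (hy (enum_val j)).
  have [|t [ht et]] := gen (zi *: (y (enum_val j) - \sum_(i < D) cs (xi i) *: tau (s + i))).
    by have := zi_Lam hxi; congr (Lam _ _); rewrite /J; lia.
  exists (\sum_(i < D) cs (xi i) *: tau (s + i)), (fun j => t (enum_val j)); split=> //.
    by exists (fun i => cs (xi i)); split=> // i; exact: T_cst.
  rewrite -(big_enum_val (fun p => t p *: y p)) /= -et scalerA mulrC (uniformizerK iR hz).
  by rewrite scale1r addrC subrK.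
move=> /gen [t [ht ->]]; apply: (big_ind Q) => // p _.
exact: QZ.
Qed.

(** All t_i are divisible by every power of z, hence 0. Indeed, let xi_j be the constant terms and m
    the sum of the xi_j tau^(s+j). The relation expresses 1 (x) m by terms z f_j tau^(s+j) of degree
    less than s, so [pure_detect] gives m = 0. Then one factor z is removed. *)
Lemma window_free (t : 'I_D -> E) : (forall i, T (t i)) ->
  \sum_i t i *: tau (s + i) = 0 -> forall i, t i = 0.
Proof.
move=> Tt e i.
suff H (K : nat) : exists u : 'I_D -> E, [/\ forall i, T (u i),
    forall i, t i = zt ^+ K * u i & \sum_i u i *: tau (s + i) = 0].
  apply: Ef_separated => K; have [u [Tu -> _]] := H K.
  by have := filM (Ef_ztX iR hz K) (T_Ef hz (Tu i)); rewrite addr0.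
elim: K => [|K [u [Tu eu e0]]]; first by exists t; split=> // j; rewrite expr0 mul1r.
have sp j : exists xi f, T f /\ u j = cs xi + zt * f by exact: (T_split hz hF hr phi (Tu j)).
pose xi j := projT1 (cid (sp j)).
pose f j := projT1 (cid (projT2 (cid (sp j)))).
have fP j : T (f j) /\ u j = cs (xi j) + zt * f j.
  exact: (projT2 (cid (projT2 (cid (sp j))))).
pose m : {poly R} := \sum_(j < D) xi j *: 'X^(s + j).
have em' : pt phi 1 m = \sum_(j < D) cs (xi j) *: tau (s + j).
  by rewrite /m pt_sum; apply: eq_bigr => j _; rewrite pt_cst.
have e1 : \sum_j u j *: tau (s + j) =
    \sum_(j < D) cs (xi j) *: tau (s + j) + zt *: \sum_j f j *: tau (s + j).
  rewrite scaler_sumr -big_split; apply: eq_bigr => j _.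
  by have [_ ->] := fP j; rewrite scalerDl scalerA.
have m0 : m = 0.
  have [a ha] := pole_element oo hF.
  apply/eqP; apply: contraT => m0.
  have szm : (s < size m)%N.
    rewrite ltnNge; apply/negP => le; move/negP: m0; apply.
    apply/eqP/polyP => l; rewrite coef0.
    case: (ltnP l s) => lt; last by rewrite nth_default // (leq_trans le).
    rewrite coef_sum big1 // => j _; rewrite coefZ coefXn ltn_eqF ?mulr0 //.
    by rewrite ltn_addr.
  suff /eqP : (m : A_motive phi) = 0 by rewrite (negPf m0).
  apply: (@pure_detect _ _ _ hF _ _ _ _ phi a ha
    [seq (- zt * f j, 'X^(s + j) : A_motive phi) | j <- enum 'I_D]) => //.
    move=> p /mapP [j _ ->]; exists 1; split => /=.
      have h1 : Ef 1 zt by have := Ef_ztX iR hz 1; rewrite expr1.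
      rewrite -[cfil _ _]/(Ef 1 (- zt * f j)) mulNr; apply: filN.
      by have := filM h1 (T_Ef hz (proj1 (fP j))); rewrite addr0.
    rewrite size_polyXn mulr1 ltrBlDr -PoszD ltz_nat.
    by apply: leq_trans (leq_add szm (ltn_ord j)); rewrite addSn addnS.
  rewrite big_map big_enum /= -/(pt phi 1 m) em'.
  have -> : \sum_(j < D) cs (xi j) *: tau (s + j) = - (zt *: \sum_j f j *: tau (s + j)).
    by apply/eqP; rewrite -addr_eq0 -e1 e0.
  rewrite scaler_sumr -sumrN; apply: eq_bigr => j _.
  by rewrite -[RHS]/(pt phi _ _) [RHS]pt1 scalerA mulNr scaleNr.
have xi0 j : xi j = 0.
  have : m`_(s + j) = 0 by rewrite m0 coef0.
  rewrite /m coef_sum (bigD1 j) //= big1 ?addr0 => [|l nlj].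
    by rewrite coefZ coefXn eqxx mulr1.
  rewrite coefZ coefXn eqn_add2l; case: eqP => [/val_inj ejl|_]; last exact: mulr0.
  by rewrite ejl eqxx in nlj.
exists f; split=> [j|j|].
- by case: (fP j).
- by have [_ ej] := fP j; rewrite eu ej xi0 rmorph0 add0r exprSr mulrA.
have : zi *: (\sum_j u j *: tau (s + j)) = 0 by rewrite e0 scaler0.
rewrite e1 big1 ?add0r => [|j _]; last by rewrite xi0 rmorph0 scale0r.
by rewrite scalerA (uniformizerK iR hz) scale1r.
Qed.
End WindowAt.
End Window.

(** * E_F-linear coordinates *)

Section DualBasis.
Variable S : pzRingType.

Lemma linear_map (U V : lmodType S) (f : U -> V) : linear f ->
  exists g : {linear U -> V}, forall x, g x = f x.
Proof.
move=> hf; pose lf := GRing.isLinear.Build S U V *:%R f hf.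
pose g : {linear U -> V} := HB.pack f lf.
by exists g.
Qed.

Lemma dual_basis (P : lmodType S) n (b : 'I_n -> P) (c : 'I_n -> P -> S) :
  (forall i a x y, c i (a *: x + y) = a * c i x + c i y) ->
  (forall x, x = \sum_i c i x *: b i) -> finitely_generated P /\ projective P.
Proof.
move=> clin cb; split; first by exists n, b => x; exists (fun i => c i x).
move=> U V g h gsurj.
pose u i := projT1 (cid (gsurj (h (b i)))).
have uP i : g (u i) = h (b i) by exact: (projT2 (cid (gsurj (h (b i))))).
have [|h' hh'] := @linear_map P U (fun x => \sum_i c i x *: u i).
  move=> a x y; rewrite scaler_sumr -big_split; apply: eq_bigr => i _.
  by rewrite clin scalerDl scalerA.
exists h' => x; rewrite hh' [in RHS](cb x) !linear_sum.
by apply: eq_bigr => i _; rewrite !linearZ uP.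
Qed.
End DualBasis.

(** * Coordinates over R((z)) and their averages over Teichmuller representatives *)

Section Average.
Variables (k : finFieldType) (F : fieldType) (iF : {rmorphism k -> F}).
Hypothesis hF : function_field iF.
Variables (oo : place iF) (R : idomainType) (iR : {rmorphism k -> R}).
Variables (r : nat) (hr : (0 < r)%N) (phi : drinfeld_module oo iR r).
Variables (z : F_oo oo) (hz : uniformizer z).
Local Notation fl := (F_oo_fil oo).
Local Notation E := (E_F oo iR).
Local Notation Ef := (completed_filtration (FR_filtration oo iR)).
Local Notation em := (F_oo_to_E iR).
Local Notation cs := (cst oo iR).
Local Notation N := (motive_isocrystal phi).
Local Notation D := (r * d_oo oo)%N.
Local Notation tau := (taup phi).
Local Notation Lam := (@Lam _ _ _ _ _ _ _ phi).
Local Notation dg := (d_oo oo).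

Local Notation zt := (em z : E).
Local Notation zi := (em z^-1 : E).
Local Notation T := (@T k F iF oo R iR z).

Local Notation code := {ffun 'I_dg -> k}.
Local Notation theta := (teichmuller hF (oo := oo)).

(* T[1/z] = R((z)). *)
Definition TZ (e : E) : Prop := exists m t, T t /\ e = zi ^+ m * t.

Lemma uniformizerKX m : zt ^+ m * zi ^+ m = 1.
Proof. by rewrite mulrC (uniformizerXK iR hz). Qed.
Lemma TZ_T e : T e -> TZ e.
Proof. by move=> h; exists 0%N, e; rewrite expr0 mul1r. Qed.
Lemma TZ0 : TZ 0. Proof. exact: TZ_T (T0 iR z). Qed.
Lemma TZD e f : TZ e -> TZ f -> TZ (e + f).
Proof.
move=> [m [t [ht ->]]] [m' [t' [ht' ->]]].
exists (m + m')%N, (zt ^+ m' * t + zt ^+ m * t'); split.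
  by apply: TD; apply: (TM hz) => //; exact: T_ztX.
rewrite exprD mulrDr; congr (_ + _).
  by rewrite mulrA -(mulrA (zi ^+ m)) (uniformizerXK iR hz) mulr1.
by rewrite mulrA [zi ^+ m * _]mulrC -(mulrA (zi ^+ m')) (uniformizerXK iR hz) mulr1.
Qed.
Lemma TZM e f : TZ e -> TZ f -> TZ (e * f).
Proof.
move=> [m [t [ht ->]]] [m' [t' [ht' ->]]]; exists (m + m')%N, (t * t').
by split; [exact: (TM hz)|rewrite mulrACA exprD].
Qed.
Lemma TZN e : TZ e -> TZ (- e).
Proof.
move=> [m [t [ht ->]]]; exists m, (- t); split; last by rewrite mulrN.
exact: (TN hz).
Qed.
Lemma TZ_ziX m : TZ (zi ^+ m).
Proof. by exists m, 1; split; [exact: T1|rewrite mulr1]. Qed.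
Lemma TZ_sigma e : TZ e -> TZ (sigma oo iR e).
Proof.
move=> [m [t [ht ->]]]; exists m, (sigma oo iR t); split; first exact: T_sigma.
by rewrite rmorphM rmorphXn /= sigma_em.
Qed.

Lemma E_span : exists g : 'I_dg -> code, (forall l, g l != 0) /\
  forall e : E, exists u : 'I_dg -> E,
    (forall l, TZ (u l)) /\ e = \sum_l u l * em (theta (g l)).
Proof.
clear hr; have [g [g0 hg]] := T_span iR hz hF; exists g; split=> // e.
have [m hm] := fil_exhaustive Ef e.
have [|t [Tt et]] := hg (zt ^+ `|m| * e).
  apply: filS (filM (Ef_ztX iR hz `|m|) hm); lia.
exists (fun l => zi ^+ `|m| * t l); split=> [l|].
  by apply: TZM; [exact: TZ_ziX|exact: TZ_T].
rewrite -[LHS]mul1r -(uniformizerXK iR hz `|m|) -mulrA et mulr_sumr.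
by apply: eq_bigr => l _; rewrite mulrA.
Qed.

Section Coords.
Variable s : nat.

Lemma coords_unique (c : 'I_D -> E) : (forall i, TZ (c i)) ->
  \sum_i c i *: tau (s + i) = 0 -> forall i, c i = 0.
Proof.
move=> Tc e i.
pose m j := projT1 (cid (Tc j)).
have mP j : exists t, T t /\ c j = zi ^+ m j * t by exact: (projT2 (cid (Tc j))).
pose K := \max_j m j.
have TK j : T (zt ^+ K * c j).
  have [t [ht ->]] := mP j; have le : (m j <= K)%N by exact: (leq_bigmax j).
  rewrite -(subnK le) exprD mulrA -(mulrA (zt ^+ _)) uniformizerKX mulr1.
  by apply: (TM hz) => //; exact: T_ztX.
have : zt ^+ K * c i = 0.
  apply: (window_free hF hr hz TK).
  transitivity (zt ^+ K *: \sum_i c i *: tau (s + i)); last by rewrite e scaler0.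
  by rewrite scaler_sumr; apply: eq_bigr => j _; rewrite scalerA.
move/(congr1 ( *%R (zi ^+ K))); rewrite mulrA (uniformizerXK iR hz) mul1r mulr0.
exact.
Qed.

(** One statement covers both existence over R((z)) and integrality on the window, so that the
    single choice [coord] has both properties. *)
Lemma coords_exist x : exists c : 'I_D -> E, [/\ forall i, TZ (c i),
  x = \sum_i c i *: tau (s + i) & Lam ((s + D)%:Z - 1) x -> forall i, T (c i)].
Proof.
have [h|nh] := pselect (Lam ((s + D)%:Z - 1) x).
  have [t [ht et]] := window_span hF hr hz h.
  by exists t; split=> // i; exact: TZ_T.
have [j hj] := Lam_exhaustive hr x.
have [|t [ht et]] := window_span hF hr hz (phi := phi) (s := s) (x := zt ^+ `|j| *: x).
  apply: LamS (LamZ (Ef_ztX iR hz `|j|) hj).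
  by have := D_gt0 hF oo hr; nia.
exists (fun i => zi ^+ `|j| * t i); split=> // [i|].
  by apply: TZM; [exact: TZ_ziX|exact: TZ_T].
rewrite -[LHS]scale1r -(uniformizerXK iR hz `|j|) -scalerA et scaler_sumr.
by apply: eq_bigr => i _; rewrite scalerA.
Qed.

Definition coord (i : 'I_D) (x : N) : E := projT1 (cid (coords_exist x)) i.
Lemma coordTZ i x : TZ (coord i x).
Proof. by rewrite /coord; case: cid => c []. Qed.
Lemma coordT i x : Lam ((s + D)%:Z - 1) x -> T (coord i x).
Proof. by rewrite /coord; case: cid => c [_ _ h] /= hx; exact: h. Qed.
Lemma coordE x : x = \sum_i coord i x *: tau (s + i).
Proof. by rewrite /coord; case: cid => c []. Qed.
Lemma coord_unique x (c : 'I_D -> E) : (forall i, TZ (c i)) ->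
  x = \sum_i c i *: tau (s + i) -> forall i, coord i x = c i.
Proof.
move=> hc ex i; apply/eqP; rewrite -subr_eq0; apply/eqP.
apply: (coords_unique (c := fun i => coord i x - c i)).
  by move=> j; apply: TZD; [exact: coordTZ|exact: TZN].
transitivity (x - x); last exact: subrr.
rewrite {2}(coordE x) {3}ex -sumrB.
by apply: eq_bigr => j _; rewrite scalerBl.
Qed.
Lemma coordD i x y : coord i (x + y) = coord i x + coord i y.
Proof.
apply: (coord_unique (c := fun i => coord i x + coord i y)).
  by move=> j; apply: TZD; exact: coordTZ.
rewrite {1}(coordE x) {1}(coordE y) -big_split.
by apply: eq_bigr => j _; rewrite scalerDl.
Qed.
Lemma coordZ e i x : TZ e -> coord i (e *: x) = e * coord i x.
Proof.
move=> he; apply: (coord_unique (c := fun i => e * coord i x)).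
  by move=> j; apply: TZM => //; exact: coordTZ.
rewrite {1}(coordE x) scaler_sumr.
by apply: eq_bigr => j _; rewrite scalerA.
Qed.

(* coord is only R((z))-linear. The nonzero Teichmuller representatives form  *)
(* a group, of order q^d - 1 = -1 in k, spanning E_F over R((z)): averaging   *)
(* over this group as in Maschke's theorem makes the coordinates E_F-linear.  *)
Definition average (i : 'I_D) (x : N) : E :=
  - \sum_(c : code | c != 0) em (theta c)^-1 * coord i (em (theta c) *: x).

Lemma averageD i x y : average i (x + y) = average i x + average i y.
Proof.
rewrite /average -opprD -big_split; congr (- _); apply: eq_bigr => c _.
by rewrite scalerDr coordD mulrDr.
Qed.
Lemma averageZ_TZ e i x : TZ e -> average i (e *: x) = e * average i x.
Proof.
move=> he; rewrite /average mulrN mulr_sumr; congr (- _); apply: eq_bigr => c _.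
by rewrite scalerA [_ * e]mulrC -scalerA coordZ // mulrCA.
Qed.
(** Multiplication by theta_b permutes the nonzero representatives; reindexing the sum brings out
    the factor theta_b. *)
Lemma averageZ_theta b i x : b != 0 ->
  average i (em (theta b) *: x) = em (theta b) * average i x.
Proof.
move=> b0; have [f [finj f0 fE]] := teichmuller_shift hF b0.
rewrite /average mulrN mulr_sumr; congr (- _).
rewrite [RHS](reindex_inj finj) /=; apply: eq_big => [c|c c0]; first by rewrite f0.
have tb0 := teichmuller_neq0 hF b0.
rewrite scalerA -rmorphM [theta c * _]mulrC fE mulrA; congr (_ * _).
by rewrite -rmorphM -fE invfM mulrA mulfV // mul1r.
Qed.
Lemma averageZ e i x : average i (e *: x) = e * average i x.
Proof.
have [g [g0 hg]] := E_span; have [u [hu ->]] := hg e.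
rewrite scaler_suml mulr_suml.
rewrite (big_morph (average i) (averageD i) (_ : average i 0 = 0)).
  apply: eq_bigr => l _.
  by rewrite -scalerA averageZ_TZ // averageZ_theta // mulrA.
by apply: (addrI (average i 0)); rewrite -averageD !addr0.
Qed.
(** Each nonzero representative contributes theta^-1 (theta x) = x. The number of summands is -1 in
    k, and the sign in [average] cancels it. *)
Lemma averageE x : x = \sum_i average i x *: tau (s + i).
Proof.
transitivity (- \sum_(c : code | c != 0) x).
  rewrite -[LHS]scale1r; transitivity ((em (- \sum_(c : code | c != 0) 1)) *: x).
    by rewrite (card_teichmuller hF oo) opprK rmorph1.
  rewrite rmorphN scaleNr rmorph_sum scaler_suml; congr (- _).
  by apply: eq_bigr => c _; rewrite rmorph1 scale1r.
rewrite /average; under [RHS]eq_bigr => i _ do rewrite scaleNr scaler_suml.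
rewrite sumrN exchange_big /=; congr (- _); apply: eq_bigr => c c0.
transitivity (em (theta c)^-1 *: (em (theta c) *: x)).
  by rewrite scalerA -rmorphM mulVf ?rmorph1 ?scale1r // teichmuller_neq0.
rewrite {1}(coordE (em (theta c) *: x)) scaler_sumr.
by apply: eq_bigr => i _; rewrite scalerA.
Qed.
Lemma average_Ef i x : Lam ((s + D)%:Z - 1) x -> Ef 0 (average i x).
Proof.
move=> h; apply: filN; apply: Ef_sum => c c0; rewrite -[0]addr0; apply: filM.
  by apply: Ef_em; exact: teichmullerV_integral.
apply: (T_Ef hz); apply: coordT; apply: LamZ0 => //.
by apply: Ef_em; exact: teichmuller_integral.
Qed.
End Coords.
End Average.

(** * The isocrystal and its slope *)

Section Isocrystal.
Variables (k : finFieldType) (F : fieldType) (iF : {rmorphism k -> F}).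
Hypothesis hF : function_field iF.
Variables (oo : place iF) (R : idomainType) (iR : {rmorphism k -> R}).
Variables (r : nat) (hr : (0 < r)%N) (phi : drinfeld_module oo iR r).
Variables (z : F_oo oo) (hz : uniformizer z).
Local Notation E := (E_F oo iR).
Local Notation EA := (E_A oo iR).
Local Notation Ef := (completed_filtration (FR_filtration oo iR)).
Local Notation em := (F_oo_to_E iR).
Local Notation N := (motive_isocrystal phi).
Local Notation D := (r * d_oo oo)%N.
Local Notation tau := (taup phi).
Local Notation Lam := (@Lam _ _ _ _ _ _ _ phi).
Local Notation zt := (em z : E).
Local Notation zi := (em z^-1 : E).
Local Notation T := (@T k F iF oo R iR z).
Local Notation TZ := (@TZ k F iF oo R iR z).
Local Notation sg := (sigma oo iR).
Local Notation t := (motive_isocrystal_tau phi).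
Local Notation ps := (pure_tensor sg).
Local Notation lin := (linearization t).
Local Notation average := (average hF hr hz).

Lemma motive_isocrystal_tauD : {morph t : x y / x + y}.
Proof. exact: (tensor_liftD (motive_isocrystal_balanced phi)). Qed.
Lemma motive_isocrystal_tau0 : t 0 = 0.
Proof. exact: (tensor_lift0 (motive_isocrystal_balanced phi)). Qed.
Lemma motive_isocrystal_tauZ e x : t (e *: x) = sg e *: t x.
Proof.
elim/tensor_ind: x => [x y hx hy||a m].
- by rewrite scalerDr !motive_isocrystal_tauD hx hy scalerDr.
- by rewrite scaler0 motive_isocrystal_tau0 scaler0.
by rewrite scale_pure !motive_isocrystal_tau_pure scale_pure rmorphM.
Qed.
Lemma tau_taup i : t (tau i) = tau i.+1.
Proof.
rewrite [LHS]motive_isocrystal_tau_pure rmorph1; congr (pure_tensor _ _ _).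
have := @tp_mul_mono _ R iR 1 1 'X^i.
by rewrite !scale1r twistXn -exprSr => h; exact: h.
Qed.
Lemma iter_taup m i : iter m t (tau i) = tau (m + i)%N.
Proof. by elim: m => //= m ->; exact: tau_taup. Qed.
Lemma tau_Lam j x : Lam j x -> Lam (j + 1) (t x).
Proof.
move=> [s [hs ->]].
rewrite (big_morph t motive_isocrystal_tauD motive_isocrystal_tau0).
apply: Lam_sum => p /hs [nu [h1 h2]].
rewrite motive_isocrystal_tauZ tau_taup.
apply: (Lam_gen phi (nu := nu)); first exact: Ef_sigma.
by move: h2; rewrite -addn1 PoszD addrAC lerD2r.
Qed.
Lemma iter_Lam m j x : Lam j x -> Lam (j + m%:Z) (iter m t x).
Proof.
move=> h; elim: m => [|m IH] /=; first by rewrite addr0.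
by rewrite -addn1 PoszD addrA; exact: tau_Lam.
Qed.

Lemma linearization_balanced : balanced sg (W := N) (fun e x => e *: t x).
Proof.
split=> [e f x|e x y|e f x]; first by rewrite scalerDl.
  by rewrite motive_isocrystal_tauD scalerDr.
by rewrite motive_isocrystal_tauZ scalerA.
Qed.
Lemma linearization_span (u : 'I_D -> E) :
  lin (\sum_i u i *: ps 1 (tau i)) = \sum_i u i *: tau (1 + i).
Proof.
rewrite /linearization.
rewrite (big_morph _ (tensor_liftD linearization_balanced)
  (tensor_lift0 linearization_balanced)).
apply: eq_bigr => i _.
by rewrite scale_pure tensor_lift_pure ?tau_taup ?mulr1 //; exact: linearization_balanced.
Qed.

(** Coefficients in E_F are reduced to R((z)) by writing them in terms of the theta_l. These are
    fixed by sigma, so they may be moved across the tensor product onto tau^i, where theta_l tau^i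
    is expanded in coordinates over R((z)). *)
Lemma frobenius_span (y : tensor sg N) : exists u : 'I_D -> E,
  (forall i, TZ (u i)) /\ y = \sum_i u i *: ps 1 (tau i).
Proof.
pose Q y := exists u : 'I_D -> E,
  (forall i, TZ (u i)) /\ y = \sum_i u i *: ps 1 (tau i).
have [bl br bb] := pure_balanced sg N.
have Q0 : Q 0.
  exists (fun=> 0); split=> [i|]; first exact: TZ0.
  by rewrite big1 // => i _; rewrite scale0r.
have QD x y' : Q x -> Q y' -> Q (x + y').
  move=> [u [hu ->]] [u' [hu' ->]]; exists (fun i => u i + u' i); split=> [i|].
    exact: TZD.
  by rewrite -big_split; apply: eq_bigr => i _; rewrite scalerDl.
have Qsum n (G : 'I_n -> tensor sg N) : (forall i, Q (G i)) -> Q (\sum_i G i).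
  by move=> h; apply: big_ind.
have expand e x (c : 'I_D -> E) : x = \sum_i c i *: tau i ->
    ps e x = \sum_i (e * sg (c i)) *: ps 1 (tau i).
  move=> ->; rewrite (big_morph _ (br e) (balanced0r (pure_balanced sg N) e)).
  by apply: eq_bigr => i _; rewrite -bb scale_pure mulr1.
elim/tensor_ind: y => [x y||e x]; [exact: QD|exact: Q0|].
rewrite (expand e x _ (averageE hF hr hz 0 x)); apply: (Qsum) => i.
move: (e * _) => f; have [g [_ hg]] := E_span hF iR hz.
have [v [hv ->]] := hg f; rewrite scaler_suml; apply: (Qsum) => l.
rewrite scale_pure mulr1.
have := bb (v l) (em (teichmuller hF (g l))) (tau i); rewrite sigma_em => ->.
exists (fun j => v l * sg (coord hF hr hz 0 j (em (teichmuller hF (g l)) *: tau i))).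
split=> [j|]; first by apply: TZM => //; apply: TZ_sigma => //; exact: coordTZ.
by apply: expand; exact: coordE.
Qed.

(** The generators 1 (x) tau^i of the window s = 0 are sent to the tau^(i+1) of the window s = 1.
    Independence of the latter over R((z)) gives injectivity, and the averaged coordinates for s = 1
    give an explicit preimage. *)
Lemma linearization_bijective : bijective lin.
Proof.
pose inv (x : N) : tensor sg N := \sum_i average 1 i x *: ps 1 (tau i).
have linK x : lin (inv x) = x.
  by rewrite linearization_span -averageE.
have lin0 y : lin y = 0 -> y = 0.
  have [u [hu ->]] := frobenius_span y; rewrite linearization_span => h.
  by apply: big1 => i _; rewrite (coords_unique hF hr hz hu h) scale0r.
exists inv => // y; apply/eqP; rewrite -subr_eq0; apply/eqP; apply: lin0.
by rewrite [LHS](tensor_liftB linearization_balanced) -!/(lin _) linK subrr.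
Qed.

Lemma motive_isocrystal_isocrystal : isocrystal t.
Proof.
have [fg pr] := @dual_basis E N D (fun i => tau i) (average 0)
  (fun i a x y => etrans (averageD hF hr hz 0 i _ y)
     (congr1 (fun u => u + _) (averageZ hF hr hz 0 a i x)))
  (averageE hF hr hz 0).
split=> //; [exact: motive_isocrystal_tauD|exact: motive_isocrystal_tauZ|].
exact: linearization_bijective.
Qed.

Lemma E_A_integral (e : EA) : Ef 0 (E_A_incl oo iR e).
Proof. by have /asboolP := valP e. Qed.
Lemma E_A_lift (e : E) : Ef 0 e -> exists e' : EA, E_A_incl oo iR e' = e.
Proof.
move=> h; have h' : @integral_pred _ (FR_filtration oo iR) e by apply/asboolP.
by exists (Sub e h' : integral_elements _).
Qed.

Definition Lam_lattice : submodule (restrict_scalars (E_A_incl oo iR) N) :=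
  @Submodule EA (restrict_scalars (E_A_incl oo iR) N) (Lam (D%:Z - 1))
    (Lam0 _ _) (@LamD _ _ _ _ _ _ _ _ _)
    (fun a x => @LamZ0 _ _ _ _ _ _ _ _ _ _ _ (E_A_integral a)).

Lemma Lam_lattice_dual_basis : exists (b : 'I_D -> submodule_type Lam_lattice)
    (c : 'I_D -> submodule_type Lam_lattice -> EA),
  (forall i a x y, c i (a *: x + y) = a * c i x + c i y) /\
  forall x, x = \sum_i c i x *: b i.
Proof.
have bP (i : 'I_D) : sub_pred Lam_lattice (tau i).
  apply/asboolP; rewrite -[tau i]scale1r; apply: (Lam_gen phi (nu := 0)).
    exact: fil1.
  by rewrite mulr0 subr0 lerBrDr; have := ltn_ord i; lia.
have cP (i : 'I_D) (x : submodule_type Lam_lattice) :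
    exists e : EA, E_A_incl oo iR e = average 0 i (val x : N).
  by apply: E_A_lift; apply: average_Ef; have /asboolP := valP x.
pose c i x := projT1 (cid (cP i x)).
have cE i x : E_A_incl oo iR (c i x) = average 0 i (val x : N).
  exact: (projT2 (cid (cP i x))).
exists (fun i : 'I_D => Sub (tau i : restrict_scalars (E_A_incl oo iR) N) (bP i)), c.
split=> [i a x y|x].
  apply: val_inj; rewrite -!/(E_A_incl oo iR _) cE rmorphD rmorphM !cE.
  by rewrite -averageZ -averageD.
apply: val_inj; rewrite raddf_sum.
rewrite [LHS](averageE hF hr hz 0); apply: eq_bigr => i _.
by rewrite -cE.
Qed.

Lemma Lam_lattice_lattice : lattice z Lam_lattice.
Proof.
have [b [c [clin cb]]] := Lam_lattice_dual_basis.
have [fg pr] := dual_basis clin cb; split=> // x.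
have [j hj] := Lam_exhaustive hr x; exists `|j|%N; rewrite rmorphXn.
apply: LamS (LamZ (Ef_ztX iR hz `|j|) hj).
by have := D_gt0 hF oo hr; nia.
Qed.

(** Both modules to be compared equal Lam_(2D-1): it is z^-1 Lam_(D-1), and by the window s = D it
    is generated by the tau^D tau^i with i < D. *)
Lemma motive_isocrystal_pure : pure z t (- (1 / r%:R)).
Proof.
(* With n = r the power of tau in the definition of purity is r d = D, and n alpha = -1. *)
exists r, (-1), Lam_lattice; split=> //.
- by rewrite mulrN mul1r mulfV ?pnatr_eq0 -?lt0n.
- exact: Lam_lattice_lattice.
move=> x; rewrite exprN1; split=> [[y [Ly ->]]|[s [hs ->]]].
  (* Multiplication by z^-1 moves y into Lam_(2D-1), whose window coordinates at s = D are integral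
     and so come from E_A. *)
  have hy := zi_Lam hz Ly.
  have [|c [hc ->]] := window_span hF hr hz (phi := phi) (s := D) (x := zi *: y).
    by apply: LamS hy; rewrite PoszD addrAC.
  have cP i : exists e : EA, E_A_incl oo iR e = c i.
    by apply: E_A_lift; exact: (T_Ef hz).
  pose e i := projT1 (cid (cP i)).
  have eE i : E_A_incl oo iR (e i) = c i by exact: (projT2 (cid (cP i))).
  exists [seq (e i, tau i) | i : 'I_D <- enum 'I_D]; split=> [p /mapP[i _ ->]|].
    rewrite /= -[tau i]scale1r; apply: (Lam_gen phi (nu := 0)); first exact: fil1.
    by rewrite mulr0 subr0 lerBrDr; have := ltn_ord i; lia.
  rewrite big_map big_enum; apply: eq_bigr => i _.
  by rewrite -eE; congr (_ *: _); rewrite iter_taup.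
exists (zt *: \sum_(p <- s) E_A_incl oo iR p.1 *: iter D t p.2); split; last first.
  by rewrite scalerA (uniformizerK iR hz) scale1r.
suff /(zt_Lam hz) : Lam (D%:Z - 1 + D%:Z)
    (\sum_(p <- s) E_A_incl oo iR p.1 *: iter D t p.2) by rewrite addrK.
rewrite big_seq; apply: big_ind; [exact: Lam0|exact: LamD|].
move=> p /hs hp; apply: LamZ0; first exact: E_A_integral.
exact: iter_Lam.
Qed.
End Isocrystal.

Theorem proposition17p5
    (k : finFieldType) (F : fieldType) (iF : {rmorphism k -> F})
    (hF : function_field iF) (oo : place iF)
    (R : idomainType) (iR : {rmorphism k -> R}) (hR : noetherian R)
    (r : nat) (hr : (1 <= r)%N) (phi : drinfeld_module oo iR r)
    (z : F_oo oo) (hz : uniformizer z) :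
  isocrystal (N := motive_isocrystal phi) (motive_isocrystal_tau phi) /\
  pure z (N := motive_isocrystal phi) (motive_isocrystal_tau phi)
    (- (1 / r%:R))%R.
Proof.
by split; [exact: motive_isocrystal_isocrystal|exact: motive_isocrystal_pure].
Qed.
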